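(* Let $H\in(1/2,1)$, $\gamma\in(1/2,H)$, $\alpha>1$, let $W^H$ be a real-valued fractional Brownian motion with Hurst parameter $H$ on a probability space $(\Omega,\mathcal{F},\mathbb{P})$, and let $\xi$ be a time-independent smooth divergence-free vector field on $\mathbb{T}^2$. Let $t>0$ and let $\omega$ be a (weak) solution on $[0,t]$ of the vorticity equation $d\omega_s+u_s\cdot\nabla\omega_s\,ds+\xi\cdot\nabla\omega_s\,dW^H_s=\Delta\omega_s\,ds$ with paths in $C([0,t],\mathcal{B}_\alpha)\cap C^\gamma([0,t],\mathcal{B}_{\alpha-\gamma})$. Let $\varphi$ be a smooth real-valued test function on $\mathbb{T}^2$ such that $\int_0^t(\omega_s,\xi\cdot\nabla\varphi)^2\,ds>0$ almost surely. For $k\ge0$ define $$Q_k:=\sum_{j\in\mathcal{A}_t^{2^k}}\big((\omega_{(j+1)2^{-k}},\varphi)-(\omega_{j2^{-k}},\varphi)\big)^2,\qquad H_k:=\frac12\left(\frac1{\log2}\log\frac{Q_k}{Q_{k+1}}+1\right),$$ where $H_k$ is well defined for all sufficiently large $k$ almost surely. Then, $\mathbb{P}$-almost surely, $\lim_{k\to\infty}H_k=H$.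
   Context: For $\beta\in\mathbb{R}$, $\mathcal{B}_\beta=H^{2\beta}(\mathbb{T}^2)$ is the $L^2$-based Sobolev space on the two-dimensional torus; $C^\gamma([0,t],\mathcal{B}_\beta)$ denotes $\gamma$-Hölder continuous functions. $(f,g)=\int_{\mathbb{T}^2}f g\,dx$. $\mathcal{A}_t^{2^k}=\{j\ge0:\ [j2^{-k},(j+1)2^{-k}]\subset[0,t]\}$. $u_s$ is the divergence-free zero-mean velocity field with $\mathrm{curl}\,u_s=\omega_s$ (Biot–Savart law on the torus). That $\omega$ is a weak solution means that, almost surely, for every $\psi\in C^\infty(\mathbb{T}^2)$ and every $r\in[0,t]$, $(\omega_r,\psi)=(\omega_0,\psi)+\int_0^r(\omega_s,u_s\cdot\nabla\psi+\Delta\psi)\,ds+\int_0^r(\omega_s,\xi\cdot\nabla\psi)\,dW^H_s$, the last integral being a pathwise Young integral. *)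

(* Defs.v *)
From mathcomp Require Export all_boot all_order all_algebra.
From mathcomp Require Export all_classical all_reals all_analysis.

Set Implicit Arguments.
Unset Strict Implicit.
Unset Printing Implicit Defensive.

Import Order.TTheory GRing.Theory Num.Theory.
Import numFieldNormedType.Exports.

Local Open Scope classical_set_scope.
Local Open Scope ring_scope.

(** Functions on the torus [R^2 / Z^2] are [Z^2]-periodic functions on the
    plane; integrals are taken over the fundamental domain [[0, 1]^2]. *)
Section torus.
Context {R : realType}.
Implicit Types (f g : R * R -> R) (v : R * R -> R * R).

Definition torus_periodic f :=
  forall x : R * R, f (x.1 + 1, x.2) = f x /\ f (x.1, x.2 + 1) = f x.

Definition torus_domain : set (R * R) := `[0, 1] `*` `[0, 1].

Definition lebesgue2 := (@lebesgue_measure R \x @lebesgue_measure R)%E.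

Definition inner f g : R := \int[lebesgue2]_(x in torus_domain) (f x * g x).

Definition L2 f :=
  [/\ torus_periodic f, measurable_fun torus_domain f &
      lebesgue2.-integrable torus_domain (fun x => (f x ^+ 2)%:E)].

Definition partial1 f : R * R -> R := 'D_((1, 0) : R * R) f.
Definition partial2 f : R * R -> R := 'D_((0, 1) : R * R) f.

Fixpoint Cn (n : nat) f : Prop :=
  if n is m.+1 then
    [/\ continuous f,
        forall x, derivable f x ((1, 0) : R * R),
        forall x, derivable f x ((0, 1) : R * R),
        Cn m (partial1 f) & Cn m (partial2 f)]
  else continuous f.

Definition torus_smooth f := torus_periodic f /\ forall n, Cn n f.

(** The derivative of [f] along [v], i.e. [v . grad f]. *)
Definition advect v f : R * R -> R :=
  fun x => (v x).1 * partial1 f x + (v x).2 * partial2 f x.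

Definition laplacian f : R * R -> R :=
  fun x => partial1 (partial1 f) x + partial2 (partial2 f) x.

Definition smooth_field v := torus_smooth (fst \o v) /\ torus_smooth (snd \o v).

Definition divergence_free v :=
  forall x, partial1 (fst \o v) x + partial2 (snd \o v) x = 0.

(** [v] is the divergence-free zero-mean [L2] field with
    [partial1 v2 - partial2 v1 = w], all derivatives being distributional.
    It is determined by [w] up to a null set. *)
Definition biot_savart (w : R * R -> R) v :=
  [/\ L2 (fst \o v), L2 (snd \o v),
      inner (fst \o v) (cst 1) = 0 /\ inner (snd \o v) (cst 1) = 0,
      forall psi, torus_smooth psi ->
        inner (fst \o v) (partial1 psi) + inner (snd \o v) (partial2 psi) = 0
    & forall psi, torus_smooth psi ->
        inner (fst \o v) (partial2 psi) - inner (snd \o v) (partial1 psi)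
        = inner w psi].

End torus.

Section sobolev.
Context {R : realType}.
Implicit Types (f : R * R -> R) (k : int * int) (w : R -> R * R -> R).

Definition phase k (x : R * R) : R :=
  2 * pi * (k.1%:~R * x.1 + k.2%:~R * x.2).

(** [|c_k|^2], where [c_k] is the integral of [f x * exp (- i phase k x)]. *)
Definition fourier_sq f k : R :=
  inner f (cos \o phase k) ^+ 2 + inner f (sin \o phase k) ^+ 2.

(** The norm of [(1 - Delta)^(s/2) f] in [L2]. *)
Definition sobolev_norm (s : R) f : \bar R :=
  ((\esum_(k in [set: int * int])
     ((1 + (2 * pi) ^+ 2 * (k.1%:~R ^+ 2 + k.2%:~R ^+ 2)) `^ s
      * fourier_sq f k)%:E) `^ 2^-1)%E.

(** The scale [B_beta = H^(2 beta)].  Its elements are taken to be functions,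
    which is adequate for [0 <= beta] only. *)
Definition Bnorm (beta : R) f : \bar R := sobolev_norm (2 * beta) f.

Definition Bspace (beta : R) f := L2 f /\ (Bnorm beta f < +oo)%E.

Definition continuous_path (beta t : R) w :=
  (forall s, s \in `[0, t] -> Bspace beta (w s)) /\
  (forall s, s \in `[0, t] ->
     (fun r => Bnorm beta (w r \- w s)) @ within `[0, t] (nbhs s) --> 0%E).

Definition holder_path (gamma beta t : R) w :=
  (forall s, s \in `[0, t] -> Bspace beta (w s)) /\
  (exists C : R, forall r s, r \in `[0, t] -> s \in `[0, t] ->
     (Bnorm beta (w r \- w s)%R <= (C * `|r - s| `^ gamma)%:E)%E).

End sobolev.

Section young.
Context {R : realType}.
Implicit Types f g : R -> R.

(** [l] is the limit of the left-point sums of [f dg] over the partitions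
    [a :: s] of [[a, b]] as the mesh tends to [0]. *)
Definition is_young_integral f g (a b l : R) :=
  forall e : R, 0 < e -> exists2 delta : R, 0 < delta &
    forall s : seq R, itv_partition a b s ->
      let p := a :: s in
      (forall i, (i < size s)%N -> p`_i.+1 - p`_i < delta) ->
      `| \sum_(0 <= i < size s) f p`_i * (g p`_i.+1 - g p`_i) - l | < e.

End young.

Section fractional_brownian_motion.
Context d (Omega : measurableType d) {R : realType} (P : probability Omega R).

(** [normal_prob] is the Gaussian law only for a nonzero standard deviation. *)
Definition gaussian (X : Omega -> R) :=
  exists m sigma : R, forall A : set R, measurable A ->
    P (X @^-1` A) = if sigma == 0 then \d_m A else normal_prob m sigma A.

Definition gaussian_process (I : set R) (X : R -> {RV P >-> R}) :=
  forall (n : nat) (tau c : 'I_n -> R), (forall i, I (tau i)) ->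
    gaussian (fun x => \sum_(i < n) c i * X (tau i) x).

(** The time set is [[0, +oo[]; values of [W] at negative times are ignored. *)
Definition fractional_brownian_motion (h : R) (W : R -> {RV P >-> R}) :=
  [/\ gaussian_process `[0, +oo[ W,
      forall s, 0 <= s -> ('E_P[W s] = 0)%E,
      forall s r, 0 <= s -> 0 <= r ->
        covariance P (W s) (W r) =
        ((s `^ (2 * h) + r `^ (2 * h) - `|s - r| `^ (2 * h)) / 2)%:E
    & {ae P, forall x, {within `[0, +oo[, continuous (fun s => W s x)}}].

End fractional_brownian_motion.

Section vorticity.
Context {R : realType}.

(** Pathwise: [z] is a path of the driving noise and [w] one of the vorticity. *)
Definition weak_solution (xi : R * R -> R * R) (t : R) (z : R -> R)
    (w : R -> R * R -> R) :=
  exists2 u : R -> R * R -> R * R,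
    forall s, s \in `[0, t] -> biot_savart (w s) (u s) &
    forall psi, torus_smooth psi -> forall r, r \in `[0, t] ->
      exists2 l : R,
        is_young_integral (fun s => inner (w s) (advect xi psi)) z 0 r l &
        inner (w r) psi = inner (w 0) psi
          + \int[lebesgue_measure]_(s in `[0, r])
              inner (w s) (advect (u s) psi \+ laplacian psi)
          + l.

Definition dyadic_indices (t : R) (k : nat) : set nat :=
  [set j | [set` `[j%:R / 2 ^+ k, j.+1%:R / 2 ^+ k]] `<=` [set` `[0, t]]].

Definition dyadic_qv (t : R) (X : R -> R) (k : nat) : R :=
  \sum_(j \in dyadic_indices t k)
    (X (j.+1%:R / 2 ^+ k) - X (j%:R / 2 ^+ k)) ^+ 2.

Definition hurst_estimator (Q : nat -> R) (k : nat) : R :=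
  2^-1 * ((ln 2)^-1 * ln (Q k / Q k.+1) + 1).

End vorticity.

(* Main.v *)
Require Import Defs.
From mathcomp Require Import measurable_realfun ring lra zify.

Import Order.TTheory GRing.Theory Num.Theory.
Import numFieldNormedType.Exports.
Local Open Scope classical_set_scope.
Local Open Scope ring_scope.

Set Implicit Arguments.
Unset Strict Implicit.
Unset Printing Implicit Defensive.

(** Tested against [phi], a solution is a path
    [X r = X 0 + D r + I r], where [D] is the time integral of the drift, [I]
    is the Young integral of [g] against the noise path [z], and
    [g s] is the inner product of [omega s] and [xi . grad phi].  Write
    [p = 2 ^ (2 h - 1)].  It suffices that, almost surely,
    [p ^ k * dyadic_qv t X k] tends to the integral of [g ^ 2] over [[0, t]]:
    this limit is positive, so the ratio of successive quadratic variations
    tends to [p], and the estimator to [h] (lemma [hurst_estimator_cvg]).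

    For the noise itself, [p ^ k] times the sum of the squared increments over
    the dyadic intervals of level [k] contained in an interval [[0, T]], for
    [T] dyadic, tends almost surely to [T] (lemma [fbm_qv_ae]).  Indeed the
    increments are jointly Gaussian, so by Isserlis' formula the variance of
    the sum is twice the sum of the squared covariances; these covariances are
    nonnegative since [h > 1 / 2], and add up to the variance of the total
    increment.  This gives a geometric decay in [k], hence almost sure
    convergence without a law of large numbers.

    The passage from the noise to [X] is pathwise (lemma [dyadic_qv_cvg]).
    The path [D] is Lipschitz, so its quadratic variation is [O (2 ^ - k)],
    which is negligible because [p < 2].  Over a dyadic interval of level [k],
    the Young integral differs from [g dz] at the left end by the sum over [n]
    of the corrections made by passing from level [k + n] to [k + n + 1]; by the
    Cauchy-Schwarz inequality, their square sums over all intervals are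
    controlled by the Hoelder exponent [gamma] of [g] and by the dyadic
    quadratic variations of [z], and decay geometrically in [n] because
    [gamma + h > 1] (lemma [young_remainder_cvg]).  There remain the square
    sums of [g dz], which are Riemann sums of [g ^ 2] for masses that
    equidistribute (lemma [weighted_sum_cvg]).

    It remains to see that [g] is Hoelder continuous and [D] Lipschitz.  The
    paths of the vorticity are Hoelder continuous in a Sobolev space of
    nonnegative order, hence in mean square by the inequality
    [parseval_le]; this rests on the density of trigonometric polynomials,
    which is proved by approximating the indicators of half-planes and then of
    all Borel sets.  The Biot-Savart law does not increase the modulus of any
    Fourier coefficient (lemma [biot_savart_fourier_le]), so the velocity is
    Hoelder continuous in mean square as well.  The drift is the sum of a
    bilinear form in vorticity and velocity and of a linear form in vorticity,
    both with smooth coefficients, hence a continuous function of time. *)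

(** * Finite sums and limits of sequences *)

Section finite_sums.
Context {R : realType}.

(** The Cauchy-Schwarz inequality for a nonnegative quadratic form. *)
Lemma quadratic_form_CS (A B C : R) :
  (forall x y, 0 <= x ^+ 2 * A + 2 * (x * y) * B + y ^+ 2 * C) ->
  B ^+ 2 <= A * C.
Proof.
move=> H.
have A0 : 0 <= A by have := H 1 0; lra.
have C0 : 0 <= C by have := H 0 1; lra.
have [Cp|Cn] := ltP 0 C.
  have := H C (- B).
  have -> : C ^+ 2 * A + 2 * (C * - B) * B + (- B) ^+ 2 * C
      = C * (A * C - B ^+ 2) by ring.
  by rewrite pmulr_rge0// subr_ge0.
have -> : C = 0 by apply/eqP; rewrite eq_le Cn C0.
rewrite mulr0; have := H (- B) (A + 1).
have -> : C = 0 by apply/eqP; rewrite eq_le Cn C0.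
rewrite mulr0 addr0 => k1.
have : B ^+ 2 * (A + 2) <= 0 by nra.
by rewrite pmulr_lle0//; lra.
Qed.

Lemma sum_mul_sqr_le n (a b : nat -> R) :
  (\sum_(i < n) a i * b i) ^+ 2
  <= (\sum_(i < n) a i ^+ 2) * (\sum_(i < n) b i ^+ 2).
Proof.
apply: quadratic_form_CS => x y.
rewrite !mulr_sumr -!big_split/=; apply: sumr_ge0 => i _.
have -> : x ^+ 2 * a i ^+ 2 + 2 * (x * y) * (a i * b i) + y ^+ 2 * b i ^+ 2
  = (x * a i + y * b i) ^+ 2 by ring.
exact: sqr_ge0.
Qed.

(** A finite form of Minkowski's inequality for square sums, in which the
    terms are weighted geometrically. *)
Lemma sqr_sum_geometric_le n (theta : R) (d : nat -> R) :
  0 < theta -> theta < 1 ->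
  (\sum_(m < n) d m) ^+ 2
  <= (1 - theta)^-1 * \sum_(m < n) theta ^- m * d m ^+ 2.
Proof.
move=> th0 th1; set s := Num.sqrt theta.
have s0 : 0 < s by rewrite sqrtr_gt0.
have sE : s ^+ 2 = theta by rewrite sqr_sqrtr// ltW.
have -> : \sum_(m < n) d m = \sum_(m < n) s ^+ m * (s ^- m * d m).
  by apply: eq_bigr => m _; rewrite mulrA divff ?mul1r// expf_neq0 ?gt_eqF.
apply: le_trans (sum_mul_sqr_le n (fun m => s ^+ m) (fun m => s ^- m * d m)) _.
have -> : \sum_(i < n) (s ^- i * d i) ^+ 2 = \sum_(m < n) theta ^- m * d m ^+ 2.
  by apply: eq_bigr => m _; rewrite exprMn exprVn -exprM mulnC exprM sE.
apply: ler_wpM2r.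
  apply: sumr_ge0 => m _; rewrite mulr_ge0 ?sqr_ge0// invr_ge0 exprn_ge0// ltW//.
have -> : \sum_(i < n) (s ^+ i) ^+ 2 = series (geometric 1 theta) n.
  rewrite /series/= big_mkord; apply: eq_bigr => i _.
  by rewrite -exprM mulnC exprM sE /=; rewrite mul1r.
rewrite geometric_seriesE ?lt_eqF//= mul1r ler_pdivrMr ?subr_gt0//.
rewrite mulVf ?gt_eqF ?subr_gt0// gerBl exprn_ge0// ltW//.
Qed.

Lemma sum_pairs (F : nat -> R) n :
  \sum_(l < 2 * n) F l = \sum_(l < n) (F (2 * l)%N + F (2 * l).+1).
Proof.
elim: n => [|n IH]; first by rewrite muln0 !big_ord0.
by rewrite mulnS !addSn add0n !big_ord_recr/= IH addrA.
Qed.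

Lemma sum_blocks (F : nat -> R) N n :
  \sum_(j < N * n) F j = \sum_(i < N) \sum_(l < n) F (i * n + l)%N.
Proof.
elim: N => [|N IH]; first by rewrite mul0n !big_ord0.
rewrite big_ord_recr/= -IH mulSn addnC big_split_ord/=.
by [].
Qed.

Lemma ler_sum_widen (F : nat -> R) m n : (forall i, 0 <= F i) -> (m <= n)%N ->
  \sum_(i < m) F i <= \sum_(i < n) F i.
Proof.
move=> F0 mn; rewrite -(subnKC mn) big_split_ord/= lerDl.
by apply: sumr_ge0.
Qed.

Lemma cvg_sum_ord (N : nat) (F : nat -> nat -> R) (l : nat -> R) :
  (forall i, (i < N)%N -> F i n @[n --> \oo] --> l i) ->
  \sum_(i < N) F i n @[n --> \oo] --> \sum_(i < N) l i.
Proof.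
elim: N => [|N IH] Fl.
  by under eq_fun do rewrite big_ord0; rewrite big_ord0; exact: cvg_cst.
under eq_fun do rewrite big_ord_recr/=.
rewrite big_ord_recr/=; apply: cvgD; last exact: Fl.
by apply: IH => i iN; apply: Fl; rewrite ltnW.
Qed.

End finite_sums.

(** Limit rules stated for sequences given by their general term. *)
Section eq_limits.
Context {R : realType}.

Lemma cvgn_near_eq (u v : nat -> R) (l : R) :
  (\forall n \near \oo, v n = u n) -> u n @[n --> \oo] --> l ->
  v n @[n --> \oo] --> l.
Proof.
move=> uv; apply: cvg_trans; apply: (@near_eq_cvg nat R \oo%classic _ u v).
by apply: filterS uv => n ->.
Qed.

Lemma cvgn_eq (u v : nat -> R) (l : R) :
  (forall n, v n = u n) -> u n @[n --> \oo] --> l -> v n @[n --> \oo] --> l.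
Proof. by move=> uv; apply: cvgn_near_eq; exact: nearW. Qed.

Lemma cvgn_cst (c : R) : c @[n --> \oo] --> c.
Proof. exact: cvg_cst. Qed.

Lemma cvgnD (u v : nat -> R) (a b : R) : u n @[n --> \oo] --> a ->
  v n @[n --> \oo] --> b -> u n + v n @[n --> \oo] --> a + b.
Proof. exact: cvgD. Qed.

Lemma cvgnB (u v : nat -> R) (a b : R) : u n @[n --> \oo] --> a ->
  v n @[n --> \oo] --> b -> u n - v n @[n --> \oo] --> a - b.
Proof. exact: cvgB. Qed.

Lemma cvgnM (u v : nat -> R) (a b : R) : u n @[n --> \oo] --> a ->
  v n @[n --> \oo] --> b -> u n * v n @[n --> \oo] --> a * b.
Proof. exact: cvgM. Qed.

Lemma cvgnV (u : nat -> R) (a : R) : a != 0 -> u n @[n --> \oo] --> a ->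
  (u n)^-1 @[n --> \oo] --> a^-1.
Proof. exact: cvgV. Qed.

End eq_limits.

(** * Dyadic points and dyadic quadratic variations *)

Section dyadic.
Context {R : realType}.

(** The [j]-th dyadic point of level [k]. *)
Definition dy (k j : nat) : R := j%:R / 2 ^+ k.

Lemma exp2_gt0 k : 0 < 2 ^+ k :> R.
Proof. by rewrite exprn_gt0. Qed.

Lemma dy0 k : dy k 0 = 0.
Proof. by rewrite /dy mul0r. Qed.

Lemma dyS k j : dy k j.+1 = dy k j + 2 ^- k.
Proof. by rewrite /dy -[j.+1]addn1 natrD mulrDl mul1r. Qed.

Lemma dy_ge0 k j : 0 <= dy k j.
Proof. by rewrite /dy divr_ge0// ltW// exp2_gt0. Qed.

Lemma dy_shift m n i : dy (m + n) (i * 2 ^ n) = dy m i.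
Proof.
rewrite /dy natrM natrX exprD invfM mulrACA divff ?mulr1//.
Qed.

Lemma dy_shift1 k i : dy k.+1 (2 * i) = dy k i.
Proof. by rewrite -[RHS](dy_shift k 1 i) addn1 mulnC. Qed.

Lemma ler_dy k : {homo dy k : i j / (i <= j)%N >-> i <= j}.
Proof.
by move=> i j ij; rewrite ler_pM2r ?ler_nat// invr_gt0 exp2_gt0.
Qed.

Lemma cvg_exp2V : (2 ^- k : R) @[k --> \oo] --> 0.
Proof.
under eq_fun do rewrite -exprVn.
by apply: cvg_expr; rewrite ger0_norm// invf_lt1// ltr1n.
Qed.

(** The number of dyadic intervals of level [k] contained in [[0, t]]. *)
Definition ndy (t : R) (k : nat) : nat := Num.truncn (t * 2 ^+ k).

Lemma dy_ndy t k j : (j < ndy t k)%N = (dy k j.+1 <= t).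
Proof. by rewrite /ndy truncn_gt_nat /dy ler_pdivrMr// exp2_gt0. Qed.

Lemma dy_le t k j : 0 <= t -> (j <= ndy t k)%N -> dy k j <= t.
Proof.
by move=> t0; case: j => [|j]; [rewrite dy0|rewrite dy_ndy].
Qed.

Lemma lt_dy_ndyS t k : t < dy k (ndy t k).+1.
Proof. by rewrite ltNge -dy_ndy ltnn. Qed.

Lemma ndy_le t (T k : nat) : 0 <= t -> t <= T%:R -> (ndy t k <= T * 2 ^ k)%N.
Proof.
move=> t0 tT; rewrite -(@ler_nat R) natrM natrX.
apply: (@le_trans _ _ (t * 2 ^+ k)).
  by rewrite truncn_le// mulr_ge0// ltW// exp2_gt0.
by rewrite ler_pM2r// exp2_gt0.
Qed.

Lemma ndy_shift_ge t m n : 0 <= t -> (ndy t m * 2 ^ n <= ndy t (m + n))%N.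
Proof.
move=> t0; have := dy_le t0 (leqnn (ndy t m)).
rewrite -(dy_shift m n); case: (_ * _)%N => // j.
by rewrite -dy_ndy.
Qed.

Lemma ndy_shift_le t m n : (ndy t (m + n) <= (ndy t m).+1 * 2 ^ n)%N.
Proof.
rewrite leqNgt; apply/negP; rewrite dy_ndy => h.
have := lt_dy_ndyS t m; rewrite -(dy_shift m n) ltNge => /negP; apply.
by apply: le_trans h; exact: ler_dy.
Qed.

Lemma dyadic_indicesE (t : R) k : 0 <= t -> dyadic_indices t k = `I_(ndy t k).
Proof.
move=> t0; apply/seteqP; split => j /=; rewrite /dyadic_indices/=.
  move=> /(_ (dy k j.+1)) /=; rewrite dy_ndy !in_itv/= lexx andbT.
  by rewrite ler_dy// dy_ge0/=; apply.
rewrite dy_ndy => h s /=; rewrite !in_itv/= => /andP[s1 s2].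
by rewrite (le_trans (dy_ge0 k j))//= (le_trans s2).
Qed.

(** The increment of [z] over the [j]-th dyadic interval of level [k]. *)
Definition dinc (z : R -> R) k j := z (dy k j.+1) - z (dy k j).

Lemma dyadic_qvE (t : R) X k : 0 <= t ->
  dyadic_qv t X k = \sum_(j < ndy t k) dinc X k j ^+ 2.
Proof.
by move=> t0; rewrite /dyadic_qv dyadic_indicesE// -fsbig_ord.
Qed.

End dyadic.

Section integral_increments.
Context {R : realType}.
Notation mu := (@lebesgue_measure R).

(** If [f] stays within [e] of [c], its integral stays within [e] per unit of
    length of that of [c]. *)
Lemma integral_increment_le (f : R -> R) (t a b c e : R) :
  {within `[0, t], continuous f} -> 0 <= a -> a <= b -> b <= t ->
  (forall s, a <= s <= b -> `|f s - c| <= e) ->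
  `|\int[mu]_(s in `[0, b]) f s - \int[mu]_(s in `[0, a]) f s - c * (b - a)|
  <= e * (b - a).
Proof.
move=> cf a0 ab bt fce.
have intf : mu.-integrable `[0, t] (EFin \o f).
  by apply: continuous_compact_integrable => //; exact: segment_compact.
have intfb : mu.-integrable `[0, b] (EFin \o f).
  apply: integrableS intf => //.
  by apply: subset_itvl; rewrite bnd_simp.
have mab : measurable (`]a, b] : set R) by [].
have intab : mu.-integrable `]a, b] (EFin \o f).
  apply: integrableS intfb => //.
  by apply: subset_itvr; rewrite bnd_simp.
have intc r : mu.-integrable `]a, b] (EFin \o (cst r)).
  have : mu.-integrable `[a, b] (EFin \o (cst r)).
    apply: continuous_compact_integrable; first exact: segment_compact.
    by apply: continuous_subspaceT => x; exact: cvg_cst.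
  by apply: integrableS => //; apply: subset_itvr; rewrite bnd_simp.
rewrite Rintegral_itvB ?bnd_simp//.
have len r : \int[mu]_(s in `]a, b]) r = r * (b - a).
  rewrite Rintegral_cst//; congr (_ * _).
  transitivity (fine (mu `]a, b])) => //.
  rewrite lebesgue_measure_itv/= lte_fin.
  by case: ltgtP ab => //= ->; rewrite subrr.
rewrite -len -RintegralB//; last exact: intc.
have intB : mu.-integrable `]a, b] (EFin \o (fun s => f s - c)).
  exact: (integrableB _ intab (intc c)).
rewrite (le_trans (le_normr_Rintegral _ _))// -len.
apply: le_Rintegral => //; last 2 first.
- exact: intc.
- move=> s /=; rewrite in_itv/= => /andP[s1 s2]; apply: fce.
  by rewrite (ltW s1) s2.
exact: integrable_norm intB.
Qed.

End integral_increments.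

(** * Riemann sums for masses that equidistribute *)

Section weighted_sums.
Context {R : realType}.

Lemma near_shift_nat (Q : nat -> Prop) m :
  (\forall n \near \oo, Q (m + n)%N) -> \forall k \near \oo, Q k.
Proof.
move=> [n0 _ h]; exists (m + n0)%N => // k /= mk.
by have := h (k - m)%N; rewrite subnKC /=; [apply|]; lia.
Qed.

(** If the masses [a k j] put on the dyadic points of level [k] converge to
    Lebesgue measure on every dyadic interval, the weighted sums of a uniformly
    continuous [G] converge to its integral [I t].  The function [I] enters
    only through the mean value estimate for its increments. *)
Lemma weighted_sum_cvg (a : nat -> nat -> R) (t M : R) (G I : R -> R) :
  0 <= t -> (forall k j, 0 <= a k j) ->
  (forall m i, \sum_(j < i * 2 ^ n) a (m + n)%N j @[n --> \oo]
     --> (dy m i : R)) ->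
  (forall s : R, 0 <= s <= t -> `|G s| <= M) ->
  (forall e : R, 0 < e -> exists2 delta : R, 0 < delta & forall r s : R,
     0 <= r <= t -> 0 <= s <= t -> `|r - s| < delta -> `|G r - G s| <= e) ->
  I 0 = 0 ->
  (forall x y c e : R, 0 <= x -> x <= y -> y <= t ->
     (forall s : R, x <= s <= y -> `|G s - c| <= e) ->
     `|I y - I x - c * (y - x)| <= e * (y - x)) ->
  \sum_(j < ndy t k) a k j * G (dy k j) @[k --> \oo] --> I t.
Proof.
move=> t0 a0 acvg GM Gmod I0 Iincr.
have M0 : 0 <= M by rewrite (le_trans _ (GM 0 _))// lexx.
apply/cvgrPdist_le => e e0.
pose e1 := e / (8 * (t + 1)).
have t1 : 0 < t + 1 by rewrite ltr_wpDl.
have e10 : 0 < e1 by rewrite divr_gt0// mulr_gt0.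
have e1t : e1 * t <= e / 8.
  rewrite /e1 mulrAC ler_pdivrMr ?mulr_gt0//.
  rewrite (_ : e / 8 * (8 * (t + 1)) = e * (t + 1)); last by field.
  by rewrite ler_pM2l// lerDl.
have [delta d0 Gd] := Gmod _ e10.
(* a level at which G varies by at most e1 on each interval, and at which one
   more interval carries a negligible integral *)
have [m [md mM]] : exists m : nat, (2 ^- m : R) < delta /\ M * 2 ^- m <= e / 8.
  have h1 : \forall m \near \oo, (2 ^- m : R) < delta.
    exact: (cvgr_lt _ (@cvg_exp2V R)).
  have h2 : \forall m \near \oo, M * 2 ^- m <= e / 8.
    have : M * 2 ^- m @[m --> \oo] --> M * 0.
      by apply: cvgM; [exact: cvg_cst|exact: cvg_exp2V].
    rewrite mulr0 => /cvgr_le; apply.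
    by rewrite divr_gt0.
  near \oo => m; exists m; split; near: m; [exact: h1|exact: h2].
pose N := ndy t m.
pose S n i := \sum_(j < i * 2 ^ n) a (m + n)%N j.
pose B n i := \sum_(l < 2 ^ n) a (m + n)%N (i * 2 ^ n + l)%N.
have BE n i : B n i = S n i.+1 - S n i.
  rewrite /S /B [in X in _ = X - _](_ : i.+1 * 2 ^ n = i * 2 ^ n + 2 ^ n)%N.
    by rewrite big_split_ord/= [X in _ = X - _]addrC addrK.
  by rewrite mulSn addnC.
have dyN : dy m N <= t by exact: dy_le.
have Bcvg i : B n i @[n --> \oo] --> (2 ^- m : R).
  under eq_fun do rewrite BE.
  have -> : (2 ^- m : R) = dy m i.+1 - dy m i by rewrite dyS addrC addKr.
  by apply: cvgB; exact: acvg.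
have pos (i n : nat) (l : 'I_(2 ^ n)) : (i < N)%N ->
    (0 <= (dy (m + n) (i * 2 ^ n + l) : R) <= t) /\
    `|(dy (m + n) (i * 2 ^ n + l) : R) - dy m i| < delta.
  move=> iN.
  have l1 : dy m i <= dy (m + n) (i * 2 ^ n + l) :> R.
    by rewrite -(dy_shift m n) ler_dy// leq_addr.
  have l2 : dy (m + n) (i * 2 ^ n + l) <= dy m i + 2 ^- m :> R.
    rewrite -dyS -(dy_shift m n i.+1) ler_dy//.
    by rewrite mulSn addnC leq_add2r ltnW.
  have l3 : dy m i + 2 ^- m <= t by rewrite -dyS -dy_ndy.
  rewrite dy_ge0 (le_trans l2)//; split=> //.
  by rewrite ger0_norm ?subr_ge0// (le_lt_trans _ md)// lerBlDl.
(* at level m + n, freeze G at the left end of its interval of level m; the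
   points beyond the last such interval below t lie in one more interval *)
have bound1 n : `|\sum_(j < ndy t (m + n)) a (m + n)%N j * G (dy (m + n) j)
    - \sum_(i < N) G (dy m i) * B n i|
    <= e1 * S n N + M * (S n N.+1 - S n N).
  rewrite -(subnKC (ndy_shift_ge m n t0)) big_split_ord/=.
  rewrite [X in `|X + _ - _|](@sum_blocks _
    (fun j => a (m + n)%N j * G (dy (m + n) j))) -/N addrAC.
  apply: le_trans (ler_normD _ _) _; apply: lerD.
    rewrite -sumrB /S sum_blocks mulr_sumr.
    apply: le_trans (ler_norm_sum _ _ _) _; apply: ler_sum => i _.
    rewrite /B mulr_sumr -sumrB mulr_sumr.
    apply: le_trans (ler_norm_sum _ _ _) _; apply: ler_sum => l _.
    rewrite [G (dy m i) * _]mulrC -mulrBr normrM ger0_norm// mulrC.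
    apply: ler_wpM2r => //.
    have [p1 p2] := pos i n l (ltn_ord i); apply: Gd => //.
    by rewrite dy_ge0/= (le_trans _ dyN)// ler_dy// ltnW.
  apply: le_trans (ler_norm_sum _ _ _) _.
  apply: (@le_trans _ _ (\sum_(i < ndy t (m + n) - ndy t m * 2 ^ n)
      M * a (m + n)%N (N * 2 ^ n + i)%N)).
    apply: ler_sum => i _; rewrite normrM ger0_norm// mulrC.
    apply: ler_wpM2r => //; apply: GM.
    rewrite dy_ge0 dy_le//=.
    by have := ltn_ord i; rewrite /N; lia.
  rewrite -mulr_sumr ler_wpM2l// -BE /B.
  apply: (@ler_sum_widen _ (fun i => a (m + n)%N (N * 2 ^ n + i)%N)) => //.
  by rewrite leq_subLR (leq_trans (ndy_shift_le _ _ _))// mulSn addnC.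
have bound2 : `|\sum_(i < N) G (dy m i) * 2 ^- m - I t| <= e1 * t + M * 2 ^- m.
  have -> : I t = \sum_(i < N) (I (dy m i.+1) - I (dy m i)) + (I t - I (dy m N)).
    rewrite -(big_mkord xpredT (fun i => I (dy m i.+1) - I (dy m i))).
    by rewrite telescope_sumr// dy0 I0 subr0 addrC subrK.
  rewrite opprD addrA -sumrB.
  apply: le_trans (ler_normB _ _) _; apply: lerD.
    apply: (@le_trans _ _ (e1 * dy m N)); last by rewrite ler_pM2l.
    rewrite /dy mulrCA -[N in leRHS]card_ord -sumr_const mulr_suml.
    apply: le_trans (ler_norm_sum _ _ _) _; apply: ler_sum => i _.
    rewrite mul1r -normrN opprB.
    have iN : dy m i.+1 <= t by rewrite -dy_ndy.
    have := Iincr (dy m i) (dy m i.+1) (G (dy m i)) e1.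
    have -> : dy m i.+1 - dy m i = 2 ^- m :> R by rewrite dyS addrC addKr.
    apply => //.
    - exact: dy_ge0.
    - by rewrite ler_dy.
    - move=> s /andP[s1 s2]; apply: Gd.
      + by rewrite (le_trans (dy_ge0 _ _) s1) (le_trans s2).
      + by rewrite dy_ge0 (le_trans s1)// (le_trans s2).
      + rewrite ger0_norm ?subr_ge0// (le_lt_trans _ md)// lerBlDl -dyS//.
  have := Iincr (dy m N) t 0 M; rewrite mul0r subr0 => h.
  apply: le_trans (h _ _ _ _) _ => //.
  - exact: dy_ge0.
  - move=> s /andP[s1 s2]; rewrite subr0; apply: GM.
    by rewrite s2 andbT (le_trans _ s1)// dy_ge0.
  - by rewrite ler_wpM2l// lerBlDl -dyS ltW// lt_dy_ndyS.
pose V n := \sum_(i < N) G (dy m i) * B n i - \sum_(i < N) G (dy m i) * 2 ^- m.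
have Vcvg : V n @[n --> \oo] --> 0.
  have -> : 0 = \sum_(i < N) G (dy m i) * 2 ^- m
      - \sum_(i < N) G (dy m i) * 2 ^- m by rewrite subrr.
  apply: cvgB; last exact: cvg_cst.
  apply: (@cvg_sum_ord _ N (fun i n => G (dy m i) * B n i)
    (fun i => G (dy m i) * 2 ^- m)).
  by move=> i _; apply: cvgM; [exact: cvg_cst|exact: Bcvg].
have Ucvg : e1 * S n N + M * (S n N.+1 - S n N) + `|V n| @[n --> \oo]
    --> e1 * dy m N + M * 2 ^- m + `|0 : R|.
  have c1 : e1 * S n N @[n --> \oo] --> e1 * dy m N.
    by apply: cvgM; [exact: cvg_cst|exact: acvg].
  have c2 : M * (S n N.+1 - S n N) @[n --> \oo] --> M * 2 ^- m.
    by under eq_fun do rewrite -BE; apply: cvgM; [exact: cvg_cst|exact: Bcvg].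
  exact: (cvgD (cvgD c1 c2) (cvg_norm Vcvg)).
apply: (@near_shift_nat _ m).
have Ule : e1 * dy m N + M * 2 ^- m + `|0 : R| < e / 2.
  rewrite normr0 addr0 (@le_lt_trans _ _ (e / 8 + e / 8))//; last lra.
  by rewrite lerD// (le_trans _ e1t)// ler_pM2l.
near=> n.
have Un : e1 * S n N + M * (S n N.+1 - S n N) + `|V n| <= e / 2.
  by near: n; exact: (cvgr_le _ Ucvg _ Ule).
rewrite distrC.
set A := \sum_(_ < _) _ in bound1 *.
set A2 := \sum_(i < N) G (dy m i) * B n i.
set A3 := \sum_(i < N) G (dy m i) * 2 ^- m in bound2.
have := bound1 n; rewrite -/A -/A2 => b1.
move: Un; rewrite /V -/A2 -/A3 => Un.
have : `|A - I t| <= `|A - A2| + `|A2 - A3| + `|A3 - I t|.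
  rewrite (_ : A - I t = (A - A2) + (A2 - A3) + (A3 - I t)); last by ring.
  by rewrite (le_trans (ler_normD _ _))// lerD2r ler_normD.
move=> h; apply: le_trans h _.
have : `|A3 - I t| <= e / 8 + e / 8.
  by apply: le_trans bound2 _; rewrite lerD.
have : `|A - A2| + `|A2 - A3| <= e / 2 by apply: le_trans Un; rewrite lerD2r.
by lra.
Unshelve. all: by end_near.
Qed.

End weighted_sums.

(** * Young integrals over dyadic intervals *)

Section young_remainder.
Context {R : realType}.
Variables (g z : R -> R).

(** The left-point sum of [g dz] over the [j]-th dyadic interval of level [k],
    subdivided at level [k + n]. *)
Definition ysum (k n j : nat) : R :=
  \sum_(l < 2 ^ n) g (dy (k + n) (j * 2 ^ n + l)) * dinc z (k + n) (j * 2 ^ n + l).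

Lemma ysum0 k j : ysum k 0 j = g (dy k j) * dinc z k j.
Proof. by rewrite /ysum expn0 big_ord1 addn0 muln1 addn0. Qed.

Lemma dinc_halves (k i : nat) :
  dinc z k i = dinc z k.+1 (2 * i) + dinc z k.+1 (2 * i).+1.
Proof.
rewrite /dinc (_ : (2 * i).+2 = 2 * i.+1)%N; last by lia.
by rewrite !dy_shift1; ring.
Qed.

(** One refinement replaces the value of [g] by its value at the midpoint, on
    the right half of each interval. *)
Lemma ysum_refine (k n j : nat) : ysum k n.+1 j - ysum k n j
  = \sum_(l < 2 ^ n)
      (g (dy (k + n).+1 (2 * (j * 2 ^ n + l)).+1)
       - g (dy (k + n).+1 (2 * (j * 2 ^ n + l))))
      * dinc z (k + n).+1 (2 * (j * 2 ^ n + l)).+1.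
Proof.
rewrite /ysum expnS (@sum_pairs _ (fun l => g (dy (k + n.+1) (j * (2 * 2 ^ n) + l))
  * dinc z (k + n.+1) (j * (2 * 2 ^ n) + l))) -sumrB addnS.
apply: eq_bigr => l _.
rewrite (_ : j * (2 * 2 ^ n) + 2 * l = 2 * (j * 2 ^ n + l))%N; last by lia.
rewrite (_ : j * (2 * 2 ^ n) + (2 * l).+1 = (2 * (j * 2 ^ n + l)).+1)%N; last by lia.
rewrite (dinc_halves (k + n)) dy_shift1.
by ring.
Qed.

(** In the application [p = 2 ^ (2 h - 1)] and [q = 2 ^ (- gamma)], and then
    the hypothesis [pq] reads [1 < gamma + h]. *)
Variables (t Cg K p q : R) (T : nat).
Hypotheses (t_ge0 : 0 <= t) (tT : t <= T%:R) (p_gt0 : 0 < p) (q_gt0 : 0 < q).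
Hypothesis g_incr : forall k j, dy k j.+1 <= t ->
  `|g (dy k j.+1) - g (dy k j)| <= Cg * q ^+ k.
Hypothesis z_qv : forall k N, (N <= T * 2 ^ k)%N ->
  \sum_(j < N) dinc z k j ^+ 2 <= K * p ^- k.
Hypothesis pq : 2 * (q ^+ 2 / p) < 1.

Lemma ysum_refine_sqr_le (k n j : nat) : (j < ndy t k)%N ->
  (ysum k n.+1 j - ysum k n j) ^+ 2
  <= 2 ^+ n * (Cg * q ^+ (k + n).+1) ^+ 2
     * \sum_(l < 2 ^ n.+1) dinc z (k + n).+1 (j * 2 ^ n.+1 + l) ^+ 2.
Proof.
move=> jt; rewrite ysum_refine.
apply: le_trans (sum_mul_sqr_le _
  (fun l => g (dy (k + n).+1 (2 * (j * 2 ^ n + l)).+1)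
       - g (dy (k + n).+1 (2 * (j * 2 ^ n + l))))
  (fun l => dinc z (k + n).+1 (2 * (j * 2 ^ n + l)).+1)) _.
apply: ler_pM.
- by apply: sumr_ge0 => i _; exact: sqr_ge0.
- by apply: sumr_ge0 => i _; exact: sqr_ge0.
- have -> : 2 ^+ n = (2 ^ n)%:R :> R by rewrite natrX.
  rewrite mulr_natl -[X in _ *+ X](card_ord (2 ^ n)) -sumr_const.
  apply: ler_sum => l _; rewrite -real_normK ?num_real// ler_pXn2r ?nnegrE//.
    apply: g_incr; rewrite dy_ndy in jt.
    apply: le_trans jt.
    rewrite -(dy_shift k n.+1) addnS; apply: ler_dy; rewrite expnS.
    by have := ltn_ord l; nia.
  apply: le_trans (normr_ge0 _) (g_incr _).
    rewrite dy_ndy in jt; apply: le_trans jt.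
    rewrite -(dy_shift k n.+1) addnS; apply: (@ler_dy _ (k + n).+1 (2 * (j * 2 ^ n + l)).+1).
    by rewrite expnS; have := ltn_ord l; nia.
- rewrite expnS (@sum_pairs _
    (fun l => dinc z (k + n).+1 (j * (2 * 2 ^ n) + l) ^+ 2)).
  apply: ler_sum => l _.
  rewrite (_ : j * (2 * 2 ^ n) + (2 * l).+1 = (2 * (j * 2 ^ n + l)).+1)%N; last by lia.
  by rewrite lerDr sqr_ge0.
Qed.

Lemma sum_ysum_refine_sqr_le (k n : nat) :
  \sum_(j < ndy t k) (ysum k n.+1 j - ysum k n j) ^+ 2
  <= Cg ^+ 2 * K * (q ^+ 2 / p) ^+ k.+1 * (2 * (q ^+ 2 / p)) ^+ n.
Proof.
apply: (@le_trans _ _ (2 ^+ n * (Cg * q ^+ (k + n).+1) ^+ 2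
  * (K * p ^- (k + n).+1))).
  apply: (@le_trans _ _ (2 ^+ n * (Cg * q ^+ (k + n).+1) ^+ 2
     * \sum_(j < ndy t k * 2 ^ n.+1) dinc z (k + n).+1 j ^+ 2)).
    rewrite (@sum_blocks _ (fun j => dinc z (k + n).+1 j ^+ 2)) mulr_sumr.
    apply: ler_sum => j _.
    exact: ysum_refine_sqr_le.
  apply: ler_wpM2l; first by rewrite mulr_ge0 ?sqr_ge0 ?exprn_ge0.
  apply: z_qv; rewrite -addnS expnD mulnA leq_mul2r.
  by rewrite ndy_le// orbT.
rewrite le_eqVlt; apply/orP; left; apply/eqP.
rewrite -addSn exprMn -exprM mulnC exprM -exprVn.
move: (q ^+ 2) (p^-1) => a b; rewrite !exprMn !exprD.
by move: (2 ^+ n) (a ^+ n) (b ^+ n) (a ^+ k.+1) (b ^+ k.+1) => *; ring.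
Qed.

(** The increments of the successive refinements are square summable with
    geometric decay in [n], so they add up in square mean; the bound decays in
    [k] faster than the quadratic variation itself, by the factor
    [q ^ (2 k)]. *)
Lemma sum_ysum_sqr_le : exists C : R, forall k n : nat,
  \sum_(j < ndy t k) (ysum k n j - g (dy k j) * dinc z k j) ^+ 2
  <= C * (q ^+ 2 / p) ^+ k.
Proof.
pose lam := 2 * (q ^+ 2 / p).
have lam0 : 0 < lam by rewrite mulr_gt0// divr_gt0// exprn_gt0.
(* any weight strictly between lam and 1 will do *)
pose th := (1 + lam) / 2.
have th0 : 0 < th by rewrite divr_gt0// addr_gt0.
have th1 : th < 1 by rewrite /th; have := pq; rewrite -/lam; lra.
have lth : lam / th < 1.
  by rewrite ltr_pdivrMr// mul1r /th; have := pq; rewrite -/lam; lra.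
exists ((1 - th)^-1 * (Cg ^+ 2 * K * (q ^+ 2 / p) * (1 - lam / th)^-1)) => k n.
have K0 : 0 <= K.
  have := z_qv (leq0n (T * 2 ^ 0)); rewrite big_ord0 expr0 invr1 mulr1.
  exact.
have tel j : ysum k n j - g (dy k j) * dinc z k j
    = \sum_(m < n) (ysum k m.+1 j - ysum k m j).
  rewrite -(big_mkord xpredT (fun m => ysum k m.+1 j - ysum k m j)).
  by rewrite telescope_sumr// ysum0.
under eq_bigr do rewrite tel.
apply: (@le_trans _ _ (\sum_(j < ndy t k) (1 - th)^-1 *
   \sum_(m < n) th ^- m * (ysum k m.+1 j - ysum k m j) ^+ 2)).
  apply: ler_sum => j _.
  exact: (@sqr_sum_geometric_le _ n th (fun m => ysum k m.+1 j - ysum k m j)).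
rewrite -mulr_sumr -[leRHS]mulrA.
apply: ler_wpM2l; first by rewrite invr_ge0 subr_ge0 ltW.
rewrite exchange_big/=.
apply: (@le_trans _ _ (\sum_(m < n)
   (Cg ^+ 2 * K * (q ^+ 2 / p) ^+ k.+1) * (lam / th) ^+ m)).
  apply: ler_sum => m _; rewrite -mulr_sumr.
  apply: le_trans (ler_wpM2l _ (sum_ysum_refine_sqr_le k m)) _.
    by rewrite invr_ge0 exprn_ge0// ltW.
  by rewrite -/lam [(lam / th) ^+ m]expr_div_n; rewrite le_eqVlt; apply/orP; left; apply/eqP; ring.
rewrite -mulr_sumr [_ ^+ k.+1]exprS.
have E : \sum_(i < n) (lam / th) ^+ i <= (1 - lam / th)^-1.
  have -> : \sum_(i < n) (lam / th) ^+ i = series (geometric 1 (lam / th)) n.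
    rewrite /series/= big_mkord; apply: eq_bigr => i _.
    by rewrite mul1r.
  rewrite geometric_seriesE ?lt_eqF//= mul1r ler_pdivrMr ?subr_gt0//.
  rewrite mulVf ?gt_eqF ?subr_gt0// gerBl exprn_ge0// divr_ge0// ltW//.
rewrite (_ : Cg ^+ 2 * K * (q ^+ 2 / p) * (1 - lam / th)^-1 * (q ^+ 2 / p) ^+ k
  = Cg ^+ 2 * K * (q ^+ 2 / p * (q ^+ 2 / p) ^+ k) * (1 - lam / th)^-1); last by ring.
apply: ler_wpM2l => //.
have qp0 : 0 <= q ^+ 2 / p by rewrite divr_ge0 ?sqr_ge0// ltW.
by rewrite mulr_ge0//; [rewrite mulr_ge0// sqr_ge0|rewrite mulr_ge0// exprn_ge0].
Qed.

(** Replacing the integral [Y k j] of [g dz] over each dyadic interval by its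
    left-point approximation changes the increments by an amount which is
    negligible for the quadratic variation at scale [p ^- k]. *)
Lemma young_remainder_cvg (Y : nat -> nat -> R) : q < 1 ->
  (forall k j, (j < ndy t k)%N -> ysum k n j @[n --> \oo] --> Y k j) ->
  p ^+ k * \sum_(j < ndy t k) (Y k j - g (dy k j) * dinc z k j) ^+ 2
    @[k --> \oo] --> 0.
Proof.
move=> q1 Ycvg; have [C HC] := sum_ysum_sqr_le.
have bnd k : \sum_(j < ndy t k) (Y k j - g (dy k j) * dinc z k j) ^+ 2
    <= C * (q ^+ 2 / p) ^+ k.
  rewrite leNgt; apply/negP => h.
  have cv : \sum_(j < ndy t k) (ysum k n j - g (dy k j) * dinc z k j) ^+ 2
     @[n --> \oo] --> \sum_(j < ndy t k) (Y k j - g (dy k j) * dinc z k j) ^+ 2.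
    apply: (@cvg_sum_ord _ _ (fun j n => (ysum k n j - g (dy k j) * dinc z k j) ^+ 2)
      (fun j => (Y k j - g (dy k j) * dinc z k j) ^+ 2)) => j jt.
    under eq_fun do rewrite expr2; rewrite expr2.
    have c1 : ysum k n j - g (dy k j) * dinc z k j @[n --> \oo]
       --> Y k j - g (dy k j) * dinc z k j.
      by apply: cvgB; [exact: Ycvg|exact: cvg_cst].
    exact: cvgM.
  have [n0 _ /(_ n0)] := cvgr_gt _ cv _ h.
  by move=> /(_ (leqnn _)); rewrite ltNge HC.
apply: (@squeeze_cvgr _ _ _ _ (fun=> 0) (fun k => C * (q ^+ 2) ^+ k)).
- near=> k; rewrite mulr_ge0 ?exprn_ge0 ?(ltW p_gt0)//=; last first.
    by apply: sumr_ge0 => j _; exact: sqr_ge0.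
  apply: le_trans (ler_wpM2l _ (bnd k)) _; first by rewrite exprn_ge0 ?(ltW p_gt0).
  rewrite expr_div_n mulrCA [p ^+ k * _]mulrCA divff ?mulr1//.
  by rewrite expf_neq0 ?gt_eqF.
- exact: cvg_cst.
- rewrite -[0](mulr0 C); apply: cvgM; first exact: cvg_cst.
  apply: cvg_expr; rewrite ger0_norm ?sqr_ge0//.
  by rewrite exprn_ilt1// ltW.
Unshelve. all: by end_near.
Qed.

End young_remainder.

Section young_dyadic.
Context {R : realType}.

Lemma young_integral_dyadic (g z : R -> R) (k J : nat) (l : R) :
  is_young_integral g z 0 (dy k J) l ->
  \sum_(i < J * 2 ^ n) g (dy (k + n) i) * dinc z (k + n) i @[n --> \oo] --> l.
Proof.
move=> gzl; apply/cvgrPdist_lt => e /gzl[delta d0 H].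
apply: (@near_shift_nat _ 0); near=> n; rewrite add0n.
have nd : 2 ^- n < delta by near: n; exact: (cvgr_lt _ (@cvg_exp2V R)).
have knd : 2 ^- (k + n) < delta.
  apply: le_lt_trans nd; rewrite lef_pV2 ?posrE ?exp2_gt0//.
  by rewrite ler_eXn2l ?ltr1n// leq_addl.
pose N := (J * 2 ^ n)%N.
pose s := mkseq (fun i => dy (k + n) i.+1 : R) N.
have ss : size s = N by rewrite size_mkseq.
have snth i : (i <= N)%N -> (0 :: s)`_i = dy (k + n) i.
  by case: i => [|i iN]; rewrite ?dy0//= nth_mkseq.
have lt_dy i : dy (k + n) i < dy (k + n) i.+1 :> R.
  by rewrite dyS ltrDl invr_gt0 exp2_gt0.
have part : itv_partition 0 (dy k J) s.
  split.
    apply/(pathP 0) => i; rewrite ss => iN.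
    by rewrite snth ?(ltnW iN)// nth_mkseq.
  by rewrite (last_nth 0) ss snth// dy_shift.
have := H s part; rewrite ss => /(_ _)/=.
rewrite big_mkord distrC => h.
rewrite (eq_bigr (fun i : 'I_N => g (0 :: s)`_i * (z s`_i - z (0 :: s)`_i))).
  apply: h => i iN; have := snth _ iN => /= ->; rewrite snth ?(ltnW iN)//.
  by rewrite dyS addrC addKr.
by move=> i _; rewrite snth ?(ltnW (ltn_ord i))// nth_mkseq.
Unshelve. all: by end_near.
Qed.

Lemma young_integral_ysum (g z : R -> R) (k j : nat) (l l' : R) :
  is_young_integral g z 0 (dy k j) l ->
  is_young_integral g z 0 (dy k j.+1) l' ->
  ysum g z k n j @[n --> \oo] --> l' - l.
Proof.
move=> /young_integral_dyadic h /young_integral_dyadic h'.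
apply: cvgn_eq (cvgB h' h) => n; rewrite !fctE /ysum (_ : j.+1 * 2 ^ n = j * 2 ^ n + 2 ^ n)%N.
  by rewrite big_split_ord/= [X in _ = X - _]addrC addrK.
by rewrite mulSn addnC.
Qed.

End young_dyadic.

Section perturbation.
Context {R : realType}.

Lemma cvg_sqr0 (u : nat -> R) : u n ^+ 2 @[n --> \oo] --> 0 ->
  u n @[n --> \oo] --> 0.
Proof.
move=> h; apply/norm_cvg0P.
have h1 : Num.sqrt (u n ^+ 2) @[n --> \oo] --> Num.sqrt (0 : R).
  exact: continuous_cvg _ (@sqrt_continuous R 0) h.
rewrite sqrtr0 in h1.
by apply: (@cvgn_eq _ _ (fun n => `|u n|) _ _ h1) => n; rewrite sqrtr_sqr.
Qed.

(** An error of negligible quadratic variation does not change the limit: the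
    cross terms are controlled by the Cauchy-Schwarz inequality. *)
Lemma sum_sqr_perturb (p L : R) (N : nat -> nat) (x e : nat -> nat -> R) :
  0 < p ->
  p ^+ k * \sum_(j < N k) x k j ^+ 2 @[k --> \oo] --> L ->
  p ^+ k * \sum_(j < N k) e k j ^+ 2 @[k --> \oo] --> 0 ->
  p ^+ k * \sum_(j < N k) (x k j + e k j) ^+ 2 @[k --> \oo] --> L.
Proof.
move=> p0 hx he.
have cr : p ^+ k * \sum_(j < N k) x k j * e k j @[k --> \oo] --> 0.
  apply: cvg_sqr0; apply: (@squeeze_cvgr _ _ _ _ (fun=> 0)
    (fun k => (p ^+ k * \sum_(j < N k) x k j ^+ 2)
              * (p ^+ k * \sum_(j < N k) e k j ^+ 2))).
  - apply: nearW => k; rewrite sqr_ge0/= exprMn [leRHS]mulrACA -[p ^+ k * p ^+ k]expr2.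
    by apply: ler_wpM2l; [exact: sqr_ge0|exact: (@sum_mul_sqr_le _ _ (x k) (e k))].
  - exact: cvg_cst.
  - by have := cvgnM hx he; rewrite mulr0.
have := cvgnD (cvgnD hx (cvgnM (@cvgn_cst R 2) cr)) he.
rewrite mulr0 !addr0 => h3; apply: cvgn_eq h3 => k; rewrite mulrCA -!mulrDr; congr (_ * _).
rewrite mulr_sumr -!big_split/=; apply: eq_bigr => j _; ring.
Qed.

End perturbation.

(** * From scaled quadratic variations to the Hurst parameter *)

Section hurst.
Context {R : realType}.

(** Only the positivity of the limit [L] matters: the ratio of successive
    terms tends to [2 ^ (2 h - 1)] whatever its value. *)
Lemma hurst_estimator_cvg (h L : R) (Q : nat -> R) : 0 < L ->
  (2 `^ (2 * h - 1)) ^+ k * Q k @[k --> \oo] --> L ->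
  (\forall k \near \oo, 0 < Q k) /\ hurst_estimator Q @ \oo --> h.
Proof.
set p := _ `^ _ => L0 hL.
have p0 : 0 < p by rewrite powR_gt0.
have Qpos : \forall k \near \oo, 0 < Q k.
  have [n0 _ hn] := cvgr_gt _ hL _ L0; exists n0 => // k /hn/=.
  by rewrite pmulr_rgt0// exprn_gt0.
split => //.
have QS : \forall k \near \oo, 0 < Q k.+1.
  by have [n0 _ hn] := Qpos; exists n0 => // k /= nk; apply: hn => /=; lia.
have rat : Q k / Q k.+1 @[k --> \oo] --> p.
  have hS : p ^+ k.+1 * Q k.+1 @[k --> \oo] --> L.
    by have := hL; rewrite -(@cvg_shiftS R^o).
  have := cvgnM (@cvgn_cst R p) (cvgnM hL (cvgnV (lt0r_neq0 L0) hS)).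
  rewrite divff ?gt_eqF// mulr1 => h3; apply: cvgn_near_eq h3.
  move: QS; apply: filterS => k Qk /=.
  rewrite exprS; field.
  by rewrite !gt_eqF ?exprn_gt0.
have lnp : ln p = (2 * h - 1) * ln 2 by rewrite ln_powR.
have ln2 : 0 < ln (2 : R) by rewrite ln_gt0 ?ltr1n.
have := continuous_cvg _ (continuous_ln p0) rat.
rewrite lnp => hln.
have -> : h = 2^-1 * ((ln 2)^-1 * ((2 * h - 1) * ln 2) + 1).
  by field; rewrite gt_eqF.
apply: cvgM; first exact: cvg_cst.
apply: cvgD; last exact: cvg_cst.
by apply: cvgM; [exact: cvg_cst|exact: hln].
Qed.

Lemma exp2V_powR (gamma : R) k : (2 ^- k) `^ gamma = (2 `^ (- gamma)) ^+ k.
Proof.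
rewrite -powR_invn// -powR_mulrn ?powR_ge0// -!powRrM.
by congr powR; rewrite mulNr mulrC mulNr.
Qed.

Lemma powR2_lt1 (x : R) : x < 0 -> 2 `^ x < 1 :> R.
Proof.
move=> x0; rewrite /powR gt_eqF// expR_lt1 nmulr_rlt0//.
by rewrite ln_gt0 ?ltr1n.
Qed.

End hurst.

Section moduli_of_continuity.
Context {R : realType}.

Lemma modulus_continuous_within (f : R -> R) (t : R) :
  (forall e : R, 0 < e -> exists2 delta : R, 0 < delta & forall r s : R,
     0 <= r <= t -> 0 <= s <= t -> `|r - s| < delta -> `|f r - f s| <= e) ->
  {within `[0, t], continuous f}.
Proof.
move=> fmod; apply/subspace_continuousP => x /=; rewrite in_itv/= => xt.
apply/cvgrPdist_le => e /fmod[delta d0 H].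
have hx : nbhs x (fun y => `|x - y| < delta) by exact: nbhsx_ballx.
rewrite near_withinE; apply: filterS hx => y xy /=; rewrite in_itv/= => yt.
exact: H.
Qed.

Lemma hoelder_modulus (f : R -> R) (t C gamma : R) : 0 < gamma ->
  (forall r s, 0 <= r <= t -> 0 <= s <= t ->
     `|f r - f s| <= C * `|r - s| `^ gamma) ->
  forall e : R, 0 < e -> exists2 delta : R, 0 < delta & forall r s : R,
     0 <= r <= t -> 0 <= s <= t -> `|r - s| < delta -> `|f r - f s| <= e.
Proof.
move=> gamma0 fC e e0.
pose C' := `|C| + 1.
have C'0 : 0 < C' by rewrite ltr_wpDl.
exists ((e / C') `^ gamma^-1); first by rewrite powR_gt0// divr_gt0.
move=> r s r0 s0 rs; apply: le_trans (fC _ _ r0 s0) _.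
have h : `|r - s| `^ gamma <= e / C'.
  rewrite -[leRHS]powRr1 ?divr_ge0 ?(ltW e0) ?(ltW C'0)//.
  rewrite -(mulVf (lt0r_neq0 gamma0)) powRrM.
  by apply: ge0_ler_powR; rewrite ?nnegrE ?powR_ge0 ?normr_ge0// ltW.
apply: (@le_trans _ _ (C' * (e / C'))).
  apply: (@le_trans _ _ (C' * `|r - s| `^ gamma)); last by rewrite ler_pM2l.
  by rewrite ler_wpM2r ?powR_ge0// (le_trans (ler_norm _))// lerDl.
by rewrite mulrCA divff ?mulr1// gt_eqF.
Qed.

End moduli_of_continuity.

(** * Quadratic variation along a solution *)

Section pathwise.
Context {R : realType}.
Notation mu := (@lebesgue_measure R).

(** If the quadratic variations of [z], scaled by [p ^ k] with
    [p = 2 ^ (2 h - 1)], tend to the length of every dyadic interval, then those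
    of [X], the sum of a Lipschitz path [D] and of the Young integral of [g dz],
    tend at the same scale to the integral of [g ^ 2]. *)
Lemma dyadic_qv_cvg (h gamma t : R) (z X D g : R -> R) :
  h < 1 -> 0 < gamma -> 1 < gamma + h -> 0 < t ->
  (forall m i, (2 `^ (2 * h - 1)) ^+ (m + n)
     * \sum_(j < i * 2 ^ n) dinc z (m + n) j ^+ 2 @[n --> \oo] --> dy m i) ->
  (exists C : R, forall r s, 0 <= r <= t -> 0 <= s <= t ->
     `|g r - g s| <= C * `|r - s| `^ gamma) ->
  (exists M : R, forall r s, 0 <= r <= t -> 0 <= s <= t ->
     `|D r - D s| <= M * `|r - s|) ->
  (forall r, 0 <= r <= t -> exists2 l : R,
     is_young_integral g z 0 r l & X r = X 0 + D r + l) ->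
  (2 `^ (2 * h - 1)) ^+ k * dyadic_qv t X k @[k --> \oo]
    --> \int[mu]_(s in `[0, t]) g s ^+ 2.
Proof.
move=> h1 gamma0 gh t0 zqv [C gC] [M DM] Xeq.
set p := _ `^ _ in zqv *.
have p0 : 0 < p by rewrite powR_gt0.
have p2 : p < 2.
  rewrite -[ltRHS]powRr1// /p /powR gt_eqF// ltr_expR ltr_pM2r ?ln_gt0 ?ltr1n//.
  lra.
pose q : R := 2 `^ (- gamma).
have q0 : 0 < q by rewrite powR_gt0.
have q1 : q < 1 by apply: powR2_lt1; rewrite oppr_lt0.
(* this is where gamma + h > 1 is used *)
have pq : 2 * (q ^+ 2 / p) < 1.
  rewrite -{1}[2]powRr1// -powR_mulrn ?powR_ge0// -powRrM -powRN.
  rewrite -powRD ?pnatr_eq0 ?implybT// -powRD ?pnatr_eq0 ?implybT//.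
  by apply: powR2_lt1; lra.
have t0' := ltW t0.
pose T := (Num.truncn t).+1.
have tT : t <= T%:R by rewrite ltW// truncnS_gt.
(* the quadratic variations of z over [0, T] are at most K p^-k *)
have [K zK] : exists K : R, forall k N, (N <= T * 2 ^ k)%N ->
    \sum_(j < N) dinc z k j ^+ 2 <= K * p ^- k.
  have cv := zqv 0%N T.
  have bd : cvgn (fun n => p ^+ (0 + n) *
      \sum_(j < T * 2 ^ n) dinc z (0 + n) j ^+ 2) by apply/cvg_ex; exists (dy 0 T).
  have [|K HK] := (@ex_bound _ _ _ _ _ _).1 (cvg_seq_bounded bd).
    exact: (@globally_properfilter _ setT 0%N).
  exists K => k N NT.
  rewrite -ler_pdivrMr ?invr_gt0 ?exprn_gt0// invrK mulrC.
  have := HK k I; rewrite /= add0n; apply: le_trans; apply: le_trans (ler_norm _).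
  rewrite ler_pM2l ?exprn_gt0//.
  by apply: (@ler_sum_widen _ (fun j => dinc z k j ^+ 2)) => // i; exact: sqr_ge0.
have dyle k j : (j <= ndy t k)%N -> 0 <= (dy k j : R) <= t.
  by move=> jt; rewrite dy_ge0 dy_le.
have dyd k j : `|dy k j.+1 - dy k j| = 2 ^- k :> R.
  by rewrite dyS addrC addKr ger0_norm// invr_ge0 exprn_ge0.
have gincr k j : dy k j.+1 <= t -> `|g (dy k j.+1) - g (dy k j)| <= C * q ^+ k.
  rewrite -dy_ndy => jt; rewrite -exp2V_powR -(dyd k j).
  by apply: gC; apply: dyle => //; exact: ltnW.
(* choice of the integrals at the dyadic times *)
have [l Hl] : {l : R -> R | forall r, 0 <= r <= t ->
    is_young_integral g z 0 r (l r) /\ X r = X 0 + D r + l r}.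
  have : forall r, exists l, 0 <= r <= t ->
      is_young_integral g z 0 r l /\ X r = X 0 + D r + l.
    move=> r; have [rt|_] := boolP (0 <= r <= t); last by exists 0.
    by have [l ? ?] := Xeq r rt; exists l.
  by move=> /choice[l Hl]; exists l.
(* the increments of X are those of D, plus g dz at left points, plus rem *)
pose rem k j := l (dy k j.+1) - l (dy k j) - g (dy k j) * dinc z k j.
have remcvg : p ^+ k * \sum_(j < ndy t k) rem k j ^+ 2 @[k --> \oo] --> 0.
  apply: (@young_remainder_cvg R g z t C K p q T t0' tT p0 q0 gincr zK pq
    (fun k j => l (dy k j.+1) - l (dy k j)) q1) => k j jt.
  apply: young_integral_ysum.
  - by apply: (proj1 (Hl _ _)); apply: dyle; rewrite ltnW.
  - by apply: (proj1 (Hl _ _)); apply: dyle.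
(* a Lipschitz path has quadratic variation of order 2^-k, and p < 2 *)
have Dcvg : p ^+ k * \sum_(j < ndy t k) dinc D k j ^+ 2 @[k --> \oo] --> 0.
  apply: (@squeeze_cvgr _ _ _ _ (fun=> 0) (fun k => T%:R * M ^+ 2 * (p / 2) ^+ k)).
  - apply: nearW => k; rewrite mulr_ge0 ?exprn_ge0 ?(ltW p0)//=; last first.
      by apply: sumr_ge0 => j _; exact: sqr_ge0.
    apply: (@le_trans _ _ (p ^+ k * ((T * 2 ^ k)%:R * (M * 2 ^- k) ^+ 2))).
      rewrite ler_pM2l ?exprn_gt0//.
      apply: (@le_trans _ _ ((ndy t k)%:R * (M * 2 ^- k) ^+ 2)).
        rewrite mulr_natl -[X in _ *+ X]card_ord -sumr_const.
        apply: ler_sum => j _; rewrite -real_normK ?num_real//.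
        have DMj : `|dinc D k j| <= M * 2 ^- k.
          rewrite -(dyd k j); apply: DM; apply: dyle => //.
          by rewrite ltnW.
        by rewrite ler_pXn2r// nnegrE (le_trans _ DMj).
      by rewrite ler_wpM2r ?sqr_ge0// ler_nat ndy_le.
    rewrite le_eqVlt; apply/orP; left; apply/eqP.
    rewrite natrM natrX [(p / 2) ^+ k]expr_div_n.
    have : 2 ^+ k != 0 :> R by rewrite expf_neq0.
    by move: (2 ^+ k) (p ^+ k) => a b a0; field.
  - exact: cvgn_cst.
  - rewrite -[0](mulr0 (T%:R * M ^+ 2)); apply: cvgnM; first exact: cvgn_cst.
    apply: cvg_expr; rewrite ger0_norm ?divr_ge0 ?(ltW p0)//.
    by rewrite ltr_pdivrMr// mul1r.
have ecvg : p ^+ k * \sum_(j < ndy t k) (dinc D k j + rem k j) ^+ 2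
    @[k --> \oo] --> 0.
  exact: sum_sqr_perturb.
have Gmod := hoelder_modulus gamma0 gC.
pose Mg := `|C| * t `^ gamma + `|g 0|.
have gMg s : 0 <= s <= t -> `|g s| <= Mg.
  move=> /andP[s0 st]; rewrite -[g s](subrK (g 0)).
  apply: le_trans (ler_normD _ _) _; rewrite lerD2r.
  have gs0 : `|g s - g 0| <= C * `|s - 0| `^ gamma.
    by apply: gC; rewrite ?s0 ?lexx.
  apply: le_trans gs0 _; rewrite subr0 ger0_norm//.
  apply: (@le_trans _ _ (`|C| * s `^ gamma)).
    by rewrite ler_wpM2r ?powR_ge0// ler_norm.
  by rewrite ler_wpM2l// ge0_ler_powR// ?nnegrE// ltW.
have Mg0 : 0 <= Mg by rewrite (le_trans _ (gMg 0 _))// lexx.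
have G2mod (e : R) : 0 < e -> exists2 delta : R, 0 < delta & forall r s : R,
     0 <= r <= t -> 0 <= s <= t -> `|r - s| < delta ->
     `|g r ^+ 2 - g s ^+ 2| <= e.
  move=> e0; have e'0 : 0 < e / (2 * Mg + 1).
    by rewrite divr_gt0// ltr_wpDl// mulr_ge0.
  have [delta d0 H] := Gmod _ e'0; exists delta => // r s rt st rs.
  rewrite subr_sqr normrM.
  apply: (@le_trans _ _ (e / (2 * Mg + 1) * (2 * Mg + 1))).
    apply: ler_pM => //; first exact: H.
    rewrite (le_trans (ler_normD _ _))//.
    by have := gMg r rt; have := gMg s st; lra.
  by rewrite divfK// gt_eqF// ltr_wpDl// mulr_ge0.
have gcvg : p ^+ k * \sum_(j < ndy t k) (g (dy k j) * dinc z k j) ^+ 2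
    @[k --> \oo] --> \int[mu]_(s in `[0, t]) g s ^+ 2.
  have := @weighted_sum_cvg R (fun k j => p ^+ k * dinc z k j ^+ 2) t (Mg ^+ 2)
    (fun s => g s ^+ 2) (fun x => \int[mu]_(s in `[0, x]) g s ^+ 2) t0'.
  move=> H; apply: cvgn_eq (H _ _ _ _ _ _).
  - move=> k; rewrite mulr_sumr; apply: eq_bigr => j _.
    by rewrite exprMn -mulrA [_ ^+ 2 * _]mulrC.
  - by move=> k j; rewrite mulr_ge0 ?sqr_ge0// exprn_ge0// ltW.
  - move=> m i; apply: cvgn_eq (zqv m i) => n.
    by rewrite mulr_sumr.
  - move=> s st; rewrite ger0_norm ?sqr_ge0// -real_normK ?num_real//.
    by rewrite ler_pXn2r ?nnegrE ?gMg.
  - exact: G2mod.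
  - by rewrite set_itv1 Rintegral_set1.
  - move=> x y c e x0 xy yt Hxy.
    exact: (integral_increment_le (modulus_continuous_within G2mod) x0 xy yt Hxy).
apply: cvgn_eq (@sum_sqr_perturb R p _ (ndy t)
  (fun k j => g (dy k j) * dinc z k j) (fun k j => dinc D k j + rem k j)
  p0 gcvg ecvg) => k.
rewrite dyadic_qvE//; congr (_ * _); apply: eq_bigr => j _; congr (_ ^+ 2).
have [_ Xj1] := Hl _ (dyle k j.+1 (ltn_ord j)).
have [_ Xj] := Hl _ (dyle k j (ltnW (ltn_ord j))).
by rewrite /rem /dinc Xj1 Xj; ring.
Qed.

End pathwise.

(** * Square integrable functions *)

Section square_integrable.
Context {R : realType} d (T : measurableType d).
Variables (mu : {measure set T -> \bar R}) (D : set T).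
Hypotheses (mD : measurable D) (muD : (mu D < +oo)%E).
Implicit Types f g h : T -> R.

Notation rI f := (mu.-integrable D (EFin \o f)).

(** The function [f] is square integrable on [D]. *)
Definition sqi f := measurable_fun D f /\ rI (fun x => f x ^+ 2).

(** The inner product of square integrable functions on [D]. *)
Definition ip f g : R := \int[mu]_(x in D) (f x * g x).

Lemma rI_le f g : measurable_fun D f -> (forall x, D x -> `|f x| <= g x) ->
  rI g -> rI f.
Proof.
move=> mf fg; apply: le_integrable => //; first exact/measurable_EFinP.
by move=> x Dx /=; rewrite lee_fin (le_trans (fg x Dx))// ler_norm.
Qed.

Lemma rI_D f g : rI f -> rI g -> rI (fun x => f x + g x).
Proof.
move=> hf hg; have := integrableD mD hf hg.
by apply: eq_integrable.
Qed.

Lemma rI_Z c f : rI f -> rI (fun x => c * f x).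
Proof.
move=> hf; have := integrableZl mD c hf.
by apply: eq_integrable.
Qed.

Lemma rI_cst c : rI (fun=> c).
Proof.
have := measurable_bounded_integrable mD muD (@measurable_cst _ _ _ _ D c).
by apply; exists `|c|; split; rewrite ?num_real// => x cx y _ /=; exact: ltW.
Qed.

Lemma sqi_bounded f C : measurable_fun D f -> (forall x, D x -> `|f x| <= C) ->
  sqi f.
Proof.
move=> mf fC; split => //.
apply: (@rI_le _ (fun=> C ^+ 2)); last exact: rI_cst.
  exact: measurable_funX.
move=> x Dx; rewrite normrX ler_pXn2r ?nnegrE ?fC//.
exact: le_trans (fC x Dx).
Qed.

Lemma sqi_mul f g : sqi f -> sqi g -> rI (fun x => f x * g x).
Proof.
move=> [mf if2] [mg ig2].
apply: (@rI_le _ (fun x => f x ^+ 2 + g x ^+ 2)); last exact: rI_D.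
  exact: measurable_funM.
move=> x _; have := sqr_ge0 (`|f x| - `|g x|).
rewrite sqrrB !real_normK ?num_real// normrM.
have := sqr_ge0 (f x); have := sqr_ge0 (g x); lra.
Qed.

Lemma sqiZ c f : sqi f -> sqi (fun x => c * f x).
Proof.
move=> [mf if2]; split; first exact: measurable_funM.
have := rI_Z (c ^+ 2) if2.
by apply: eq_integrable => // x _ /=; rewrite exprMn.
Qed.

Lemma sqiD f g : sqi f -> sqi g -> sqi (fun x => f x + g x).
Proof.
move=> sf sg; have [[mf if2] [mg ig2]] := (sf, sg).
split; first exact: measurable_funD.
have := rI_D (rI_D if2 (rI_Z 2 (sqi_mul sf sg))) ig2.
by apply: eq_integrable => // x _ /=; congr EFin; ring.
Qed.

Lemma sqiB f g : sqi f -> sqi g -> sqi (fun x => f x - g x).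
Proof.
move=> sf sg; have := sqiD sf (sqiZ (-1) sg).
by congr sqi; apply/funext => x; rewrite mulN1r.
Qed.

Lemma ipC f g : ip f g = ip g f.
Proof. by apply: eq_Rintegral => x _; rewrite mulrC. Qed.

Lemma ipDl f g h : sqi f -> sqi g -> sqi h ->
  ip (fun x => f x + g x) h = ip f h + ip g h.
Proof.
move=> sf sg sh; rewrite /ip -RintegralD//; try exact: sqi_mul.
by apply: eq_Rintegral => x _; rewrite mulrDl.
Qed.

Lemma ipZl c f h : sqi f -> sqi h -> ip (fun x => c * f x) h = c * ip f h.
Proof.
move=> sf sh; rewrite /ip -RintegralZl//; last exact: sqi_mul.
by apply: eq_Rintegral => x _; rewrite mulrA.
Qed.

Lemma ipBl f g h : sqi f -> sqi g -> sqi h ->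
  ip (fun x => f x - g x) h = ip f h - ip g h.
Proof.
move=> sf sg sh; rewrite -mulN1r -ipZl// -ipDl//; last exact: sqiZ.
by congr ip; apply/funext => x; rewrite mulN1r.
Qed.

Lemma ipDr f g h : sqi f -> sqi g -> sqi h ->
  ip h (fun x => f x + g x) = ip h f + ip h g.
Proof. by move=> *; rewrite !(ipC h) ipDl. Qed.

Lemma ipZr c f h : sqi f -> sqi h -> ip h (fun x => c * f x) = c * ip h f.
Proof. by move=> *; rewrite !(ipC h) ipZl. Qed.

Lemma ipBr f g h : sqi f -> sqi g -> sqi h ->
  ip h (fun x => f x - g x) = ip h f - ip h g.
Proof. by move=> *; rewrite !(ipC h) ipBl. Qed.

Lemma ip_sqrD f g : sqi f -> sqi g ->
  ip (fun x => f x + g x) (fun x => f x + g x) = ip f f + 2 * ip f g + ip g g.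
Proof.
move=> sf sg; rewrite ipDl// ?ipDr//; try exact: sqiD.
by rewrite [ip g f]ipC; ring.
Qed.

Lemma ip_sqrB f g : sqi f -> sqi g ->
  ip (fun x => f x - g x) (fun x => f x - g x) = ip f f - 2 * ip f g + ip g g.
Proof.
move=> sf sg; rewrite ipBl// ?ipBr//; try exact: sqiB.
by rewrite [ip g f]ipC; ring.
Qed.

Lemma ip_ge0 f : 0 <= ip f f.
Proof. by apply: Rintegral_ge0 => x _; rewrite -expr2 sqr_ge0. Qed.

Lemma ip_CS f g : sqi f -> sqi g -> ip f g ^+ 2 <= ip f f * ip g g.
Proof.
move=> sf sg.
apply: quadratic_form_CS => a b.
have sa := sqiZ a sf; have sb := sqiZ b sg.
have := ip_ge0 (fun x => a * f x + b * g x).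
rewrite ipDl// ?ipDr// ?ipZl// ?ipZr//; try exact: sqiD.
rewrite [ip g f]ipC => h; apply: le_trans h _.
by rewrite le_eqVlt; apply/orP; left; apply/eqP; ring.
Qed.

(** The triangle inequality for the norm in the mean of order two. *)
Lemma ip_sqrtD f g : sqi f -> sqi g ->
  Num.sqrt (ip (fun x => f x + g x) (fun x => f x + g x))
  <= Num.sqrt (ip f f) + Num.sqrt (ip g g).
Proof.
move=> sf sg; have sD := sqiD sf sg.
rewrite -[leRHS]ger0_norm ?addr_ge0 ?sqrtr_ge0// -sqrtr_sqr.
rewrite ler_sqrt ?sqr_ge0// sqrrD !sqr_sqrtr ?ip_ge0//.
rewrite ipDl// ?ipDr// [ip g f]ipC -sqrtrM ?ip_ge0//.
have : ip f g <= Num.sqrt (ip f f * ip g g).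
  by rewrite (le_trans (ler_norm _))// -sqrtr_sqr ler_sqrt ?ip_CS// mulr_ge0 ?ip_ge0.
rewrite mulr2n; lra.
Qed.

(** Dominated convergence in the mean of order two. *)
Lemma ip_dominated (g : nat -> T -> R) f G :
  (forall n, measurable_fun D (g n)) -> measurable_fun D f -> sqi G ->
  {ae mu, forall x, D x -> g n x @[n --> \oo] --> f x} ->
  (forall n x, D x -> `|g n x| <= G x) -> (forall x, D x -> `|f x| <= G x) ->
  ip (fun x => f x - g n x) (fun x => f x - g n x) @[n --> \oo] --> 0.
Proof.
move=> mg mf [mG iG] gf gG fG.
pose F n x := (((f x - g n x) * (f x - g n x))%:E : \bar R).
have mF n : measurable_fun D (F n).
  by apply/measurable_EFinP; apply: measurable_funM; exact: measurable_funB.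
have cF : {ae mu, forall x, D x -> F n x @[n --> \oo] --> (0 : \bar R)}.
  apply: filterS gf => x gfx Dx; apply: cvg_EFin; first exact: nearW.
  have h0 := cvgnB (@cvgn_cst R (f x)) (gfx Dx); rewrite subrr in h0.
  by have := cvgnM h0 h0; rewrite mulr0.
have i4G : mu.-integrable D (fun x => (4 * G x ^+ 2)%:E) by exact: rI_Z.
have leF : {ae mu, forall x n, D x -> (`|F n x| <= (4 * G x ^+ 2)%:E)%E}.
  apply: aeW => x n Dx; rewrite /F /= lee_fin -expr2 ger0_norm ?sqr_ge0//.
  rewrite -real_normK ?num_real//.
  have h : `|f x - g n x| <= 2 * G x.
    have := ler_normB (f x) (g n x).
    by have := gG n x Dx; have := fG x Dx; lra.
  have : `|f x - g n x| ^+ 2 <= (2 * G x) ^+ 2.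
    by rewrite ler_pXn2r// nnegrE (le_trans _ h).
  by rewrite exprMn; lra.
have m0 : measurable_fun D (cst (0 : \bar R)) by exact: measurable_cst.
have [_ _] := @dominated_convergence _ _ _ mu D mD F (cst 0%E) _ mF m0 cF i4G leF.
rewrite integral0 => lim0.
have := fine_cvg lim0; exact.
Qed.

End square_integrable.

(** * Moments of Gaussian variables *)

Section normal_moments.
Context {R : realType}.
Notation mu := (@lebesgue_measure R).

Lemma is_derive_normal_pdf (m s x : R) : s != 0 ->
  is_derive x 1 (normal_pdf m s) (- (x - m) / s ^+ 2 * normal_pdf m s x).
Proof.
move=> s0; rewrite normal_pdfE// /normal_fun.
pose u (y : R) := - (y - m) ^+ 2 / (s ^+ 2 *+ 2).
have du : is_derive x 1 u (- (x - m) / s ^+ 2).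
  rewrite /u; apply: is_derive_eq.
  by rewrite scaler0 add0r subr0 /GRing.scale/=; field.
have := is_derive1_comp (is_derive_expR (u x)) du.
move=> /(is_deriveZ (normal_peak s)) h.
apply: is_derive_eq (h) _.
by rewrite /GRing.scale/= /u; ring.
Qed.

(** This decay beats the cubic growth allowed below for the boundary terms of
    the integration by parts. *)
Lemma normal_pdf_decay (m s : R) : s != 0 -> exists2 A : R, 0 <= A &
  forall x, normal_pdf m s x * (x - m) ^+ 4 <= A.
Proof.
move=> s0; have s2 : 0 < s ^+ 2 by rewrite exprn_even_gt0.
exists (normal_peak s * (8 * (s ^+ 2) ^+ 2)).
  by rewrite mulr_ge0 ?normal_peak_ge0// mulr_ge0// sqr_ge0.
move=> x; rewrite normal_pdfE// /normal_fun -mulrA.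
apply: ler_wpM2l; first exact: normal_peak_ge0.
set u := (x - m) ^+ 2 / (s ^+ 2 *+ 2).
have u0 : 0 <= u by rewrite divr_ge0 ?sqr_ge0// mulrn_wge0// ltW.
have -> : (x - m) ^+ 4 = u ^+ 2 * (4 * (s ^+ 2) ^+ 2).
  by rewrite /u; field.
rewrite mulNr -/u expRN.
have := expR_ge1Dxn 1 u0; rewrite [(1.+1)`!%:R](_ : _ = 2)// => hu.
rewrite mulrC ler_pdivrMr ?expR_gt0//.
have h2 : u ^+ 2 <= 2 * expR u.
  by have := expR_gt0 u; lra.
have s4 : 0 <= 4 * (s ^+ 2) ^+ 2 by rewrite mulr_ge0// sqr_ge0.
apply: le_trans (ler_wpM2r s4 h2) _.
by rewrite le_eqVlt; apply/orP; left; apply/eqP; ring.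
Qed.

(** Gaussian integration by parts: [- s ^ 2 Q (x - m)] times the density is a
    primitive of [a (x - m) - c] times the density, and it vanishes at
    infinity. *)
Lemma normal_by_parts (m s c K : R) (Q Q' a : R -> R) : s != 0 ->
  (forall y : R, is_derive y 1 Q (Q' y)) ->
  (forall y, `|Q y| <= K * (1 + `|y| ^+ 3)) ->
  continuous a -> (forall y, 0 <= a y) ->
  (forall y, a y - c = y * Q y - s ^+ 2 * Q' y) ->
  (\int[mu]_x (a (x - m) * normal_pdf m s x)%:E = c%:E)%E.
Proof.
move=> s0 dQ QK ca a0 aQ.
pose phi := normal_pdf m s.
have cphi : continuous phi by exact: continuous_normal_pdf.
have phi0 x : 0 <= phi x by exact: normal_pdf_ge0.
pose am x := a (x - m).
have cam : continuous am.
  move=> x; apply: (@continuous_comp _ _ _ (fun x => x - m) a); last exact: ca.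
  by apply: cvgB; [exact: cvg_id|exact: cvg_cst].
have camphi : continuous (fun x => am x * phi x).
  by move=> x; apply: cvgM; [exact: cam|exact: cphi].
pose F x := - s ^+ 2 * (Q (x - m) * phi x).
have dF (x : R) : is_derive x 1 F ((am x - c) * phi x).
  have d1 : is_derive x 1 (fun x => x - m) 1.
    by apply: is_derive_eq; rewrite subr0.
  have d2 := @is_derive1_comp R Q (fun x => x - m) x _ _ (dQ (x - m)) d1.
  have d3 := is_deriveM d2 (is_derive_normal_pdf m x s0).
  have d4 := is_deriveZ (- s ^+ 2) d3.
  apply: is_derive_eq (d4) _.
  rewrite /GRing.scale/= /am aQ -/phi; field.
  by [].
(* integrate over [m - n - 1, m + n + 1] and let n grow; monotone convergence
   applies since the integrand is nonnegative *)
pose E n := `[m - n.+1%:R, m + n.+1%:R]%classic : set R.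
have mE n : measurable (E n) by exact: measurable_itv.
have ndE : nondecreasing_seq E.
  move=> i j ij; apply/subsetPset => x; rewrite /E/= !in_itv/= => /andP[x1 x2].
  have : i.+1%:R <= j.+1%:R :> R by rewrite ler_nat.
  by move=> ?; apply/andP; split; lra.
have UE : \bigcup_n E n = setT.
  rewrite -subTset => x _; exists (Num.truncn `|x - m|) => //.
  rewrite /E/= in_itv/=; have := truncnS_gt `|x - m|.
  rewrite ltr_norml => /andP[h1 h2]; apply/andP; split; lra.
have cvE (f : R -> R) : continuous f -> (forall x, 0 <= f x) ->
   (\int[mu]_(x in E i) (f x)%:E @[i --> \oo] --> \int[mu]_x (f x)%:E)%E.
  move=> cf f0; rewrite -UE.
  apply: ge0_nondecreasing_set_cvg_integral => //.
  - move=> i; apply/measurable_EFinP; apply: measurable_funTS.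
    exact: continuous_measurable_fun.
  - by move=> i x _; rewrite lee_fin.
have FTC n : (\int[mu]_(x in E n) ((am x - c) * phi x)%:E
    = (F (m + n.+1%:R))%:E - (F (m - n.+1%:R))%:E)%E.
  have cF : continuous F.
    move=> x; have [dv _] := dF x.
    by apply: differentiable_continuous; apply/derivable1_diffP.
  apply: continuous_FTC2.
  - by have := ltr0Sn R n; lra.
  - apply: continuous_subspaceT => x; apply: cvgM; last exact: cphi.
    by apply: cvgB; [exact: cam|exact: cvg_cst].
  - split.
    + by move=> x _; have [] := dF x.
    + exact/cvg_at_right_filter/cF.
    + exact/cvg_at_left_filter/cF.
  - by move=> x _; rewrite derive1E; exact: (@derive_val _ _ _ _ _ _ _ (dF x)).
have split_int n : (\int[mu]_(x in E n) (am x * phi x)%:E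
    = (F (m + n.+1%:R) - F (m - n.+1%:R))%:E
      + c%:E * \int[mu]_(x in E n) (phi x)%:E)%E.
  have icont (f : R -> R) : continuous f -> mu.-integrable (E n) (EFin \o f).
    move=> cf; apply: continuous_compact_integrable; first exact: segment_compact.
    exact: continuous_subspaceT.
  rewrite EFinB -FTC -integralZl; [|exact: mE|exact: icont].
  rewrite -integralD//=.
  - by apply: eq_integral => x _; rewrite -EFinM -EFinD; congr EFin; ring.
  - exact: mE.
  - apply: (icont (fun x => (am x - c) * phi x)) => x.
    apply: cvgM; last exact: cphi.
    by apply: cvgB; [exact: cam|exact: cvg_cst].
  - apply: (icont (fun x => c * phi x)) => x.
    by apply: cvgM; [exact: cvg_cst|exact: cphi].
have [A A0 HA] := normal_pdf_decay m s0.
have Fbnd n (b : R) : `|b - m| = n.+1%:R ->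
    `|F b| <= s ^+ 2 * (`|K| * 2) * A * n.+1%:R^-1.
  move=> bn; rewrite /F normrM normrN [`|s ^+ 2|]ger0_norm ?sqr_ge0//.
  rewrite (_ : s ^+ 2 * _ * A * _ = s ^+ 2 * (`|K| * (2 * (A * n.+1%:R^-1)))); last by ring.
  apply: ler_wpM2l; first exact: sqr_ge0.
  rewrite normrM [`|phi b|]ger0_norm//.
  have w1 : 1 <= `|b - m| by rewrite bn ler1n.
  have w0 : 0 < `|b - m| by rewrite (lt_le_trans _ w1).
  apply: (@le_trans _ _ (`|K| * (2 * `|b - m| ^+ 3) * phi b)).
    apply: ler_wpM2r => //; apply: le_trans (QK _) _.
    apply: (@le_trans _ _ (`|K| * (1 + `|b - m| ^+ 3))).
      apply: ler_wpM2r; last exact: ler_norm.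
      by rewrite addr_ge0// exprn_ge0.
    apply: ler_wpM2l => //.
    have : 1 <= `|b - m| ^+ 3 by rewrite exprn_ege1.
    lra.
  rewrite -mulrA ler_wpM2l// -mulrA ler_pM2l// -bn ler_pdivlMr//.
  apply: le_trans (HA b); rewrite mulrC mulrA -exprS [leRHS]mulrC.
  rewrite (_ : (b - m) ^+ 4 = `|b - m| ^+ 4)//.
  by rewrite -normrX ger0_norm// exprn_even_ge0.
have Fcvg (sg : R) : `|sg| = 1 -> F (m + sg * n.+1%:R) @[n --> \oo] --> 0.
  move=> sg1; apply/norm_cvg0P.
  apply: (@squeeze_cvgr _ _ _ _ (fun=> 0)
    (fun n => s ^+ 2 * (`|K| * 2) * A * n.+1%:R^-1)).
  - apply: nearW => n; rewrite normr_ge0/=; apply: Fbnd.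
    by rewrite addrC addKr normrM sg1 mul1r ger0_norm.
  - exact: cvg_cst.
  - have h := cvgnM (@cvgn_cst R (s ^+ 2 * (`|K| * 2) * A)) (@cvg_harmonic R).
    by rewrite mulr0 in h; exact: h.
have lim0 : F (m + n.+1%:R) - F (m - n.+1%:R) @[n --> \oo] --> 0.
  have h := cvgnB (Fcvg 1 (normr1 _)) (Fcvg (-1) (normrN1 _)).
  by rewrite subr0 in h; apply: cvgn_eq h => n; rewrite mul1r mulN1r.
have lim1 : (\int[mu]_(x in E n) (am x * phi x)%:E @[n --> \oo] --> c%:E)%E.
  under eq_fun do rewrite split_int.
  have l3 := @cvE phi cphi phi0; rewrite integral_normal_pdf in l3.
  have l4 := @cvgeZl nat \oo%classic R _ _ c%:E isT l3; rewrite mule1 in l4.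
  rewrite (_ : nbhs c%:E = nbhs (0 + c%:E)%E); last by rewrite add0e.
  apply: cvgeD => //.
  by apply: cvg_EFin; [exact: nearW|exact: lim0].
have := @cvE (fun x => am x * phi x) camphi.
move=> /(_ (fun x => mulr_ge0 (a0 _) (phi0 x))) lim2.
exact: (cvg_unique _ lim2 lim1).
Qed.

End normal_moments.

Section gaussian_law.
Context {R : realType}.
Notation mu := (@lebesgue_measure R).

Lemma ge0_integral_normal_prob (m s : R) (f : R -> \bar R) :
  measurable_fun setT f -> (forall x, 0 <= f x)%E ->
  (\int[normal_prob m s]_x f x = \int[mu]_x (f x * (normal_pdf m s x)%:E))%E.
Proof.
move=> mf f0.
have dom := normal_prob_dominates m s.
rewrite -(Radon_Nikodym_SigmaFinite.change_of_variables dom)//.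
have irn := Radon_Nikodym_SigmaFinite.f_integrable dom.
have mpdf : measurable_fun setT (fun x => (normal_pdf m s x)%:E).
  by apply/measurable_EFinP; exact: measurable_normal_pdf.
apply: ae_eq_integral => //.
- by apply: emeasurable_funM => //; exact: (measurable_int mu).
- exact: emeasurable_funM.
- apply: ae_eqe_mul2l => /=; apply: integral_ae_eq => //.
  move=> E _ mE.
  by rewrite -(Radon_Nikodym_SigmaFinite.f_integral dom mE).
Qed.

Context d (Omega : measurableType d) (P : probability Omega R).

(** The transfer of integration by parts to a random variable, including the
    degenerate law [s = 0]. *)
Lemma gaussian_by_parts (X : Omega -> R) (m s c K : R) (Q Q' a : R -> R) :
  measurable_fun setT X ->
  (forall A : set R, measurable A ->
    P (X @^-1` A) = if s == 0 then \d_m A else normal_prob m s A) ->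
  (forall y : R, is_derive y 1 Q (Q' y)) ->
  (forall y, `|Q y| <= K * (1 + `|y| ^+ 3)) ->
  continuous a -> (forall y, 0 <= a y) ->
  (forall y, a y - c = y * Q y - s ^+ 2 * Q' y) ->
  (\int[P]_w (a (X w - m))%:E = c%:E)%E.
Proof.
move=> mX lawX dQ QK ca a0 aQ.
have mX' : @measurable_fun _ _ _ (measurableTypeR R) setT X by exact: mX.
pose X' : {mfun Omega >-> measurableTypeR R} :=
  @mfun_Sub _ _ Omega (measurableTypeR R) X (mem_set mX').
pose f (y : R) := (a (y - m))%:E.
have mf : @measurable_fun _ _ (measurableTypeR R) _ setT f.
  apply/measurable_EFinP; apply: continuous_measurable_fun => x.
  apply: (@continuous_comp _ _ _ (fun x => x - m) a); last exact: ca.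
  by apply: cvgB; [exact: cvg_id|exact: cvg_cst].
have f0 y : (0 <= f y)%E by rewrite lee_fin.
have := @ge0_integral_distribution _ _ _ _ _ P X' f mf f0; rewrite /f/= => <-.
have [s0|s0] := eqVneq s 0.
  transitivity (\int[@dirac _ (measurableTypeR R) m R]_y f y)%E.
    apply: eq_measure_integral => A mA _.
    by have := lawX A mA; rewrite s0 eqxx.
  rewrite integral_dirac// diracT mul1e /f subrr; congr EFin.
  by apply/eqP; rewrite -subr_eq0 aQ s0 mul0r expr0n mul0r subr0.
transitivity (\int[normal_prob m s]_y f y)%E.
  apply: eq_measure_integral => A mA _.
  by have := lawX A mA; rewrite (negbTE s0).
rewrite ge0_integral_normal_prob//.
under eq_integral do rewrite -EFinM.
exact: (normal_by_parts m s0 dQ QK).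
Qed.

Lemma le_rintegrable (f g : Omega -> R) : measurable_fun setT f ->
  (forall x, `|f x| <= g x) -> P.-integrable setT (EFin \o g) ->
  P.-integrable setT (EFin \o f).
Proof. by move=> mf fg; apply: (rI_le measurableT mf) => x _; exact: fg. Qed.

Lemma rintegrableD (f g : Omega -> R) : P.-integrable setT (EFin \o f) ->
  P.-integrable setT (EFin \o g) ->
  P.-integrable setT (EFin \o (fun w => f w + g w)).
Proof. exact: (rI_D measurableT). Qed.

Lemma rintegrableZ (c : R) (f : Omega -> R) : P.-integrable setT (EFin \o f) ->
  P.-integrable setT (EFin \o (fun w => c * f w)).
Proof. exact: (rI_Z measurableT). Qed.

Lemma rintegrable_cst (c : R) : P.-integrable setT (EFin \o (fun=> c)).
Proof. exact: finite_measure_integrable_cst. Qed.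

Lemma Rintegral_prob_cst (c : R) : \int[P]_w c = c.
Proof.
have h : fine (P [set: Omega]) = 1 by rewrite probability_setT.
by rewrite Rintegral_cst// [fine _]h mulr1.
Qed.

Lemma ge0_rintegrable (f : Omega -> R) (c : R) : measurable_fun setT f ->
  (forall x, 0 <= f x) -> (\int[P]_x (f x)%:E = c%:E)%E ->
  P.-integrable setT (EFin \o f) /\ \int[P]_x f x = c.
Proof.
move=> mf f0 fc; split; last by rewrite /Rintegral fc.
apply/integrableP; split; first exact/measurable_EFinP.
under eq_integral do rewrite /= ger0_norm//.
by rewrite fc ltry.
Qed.

(** The second and fourth moments of a centred Gaussian variable. *)
Lemma gaussian_moments (X : Omega -> R) : measurable_fun setT X ->
  gaussian P X -> \int[P]_w X w = 0 -> exists2 v : R,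
  P.-integrable setT (EFin \o (fun w => X w ^+ 4)) &
  \int[P]_w X w ^+ 2 = v /\ \int[P]_w X w ^+ 4 = 3 * v ^+ 2.
Proof.
move=> mX [m [s lawX]] EX0.
have mXm : measurable_fun setT (fun w => X w - m) by exact: measurable_funB.
have pow_cont n (c : R) : continuous (fun y : R => (y + c) ^+ n).
  move=> y; apply: (@continuous_comp _ _ _ (fun y => y + c) (fun y => y ^+ n)).
    by apply: cvgD; [exact: cvg_id|exact: cvg_cst].
  exact: exprn_continuous.
have w1 (y : R) : `|y| <= 1 + `|y| ^+ 3.
  have [y1|y1] := leP `|y| 1; first by rewrite (le_trans y1)// lerDl exprn_ge0.
  by rewrite ler_wpDl// -[leLHS]expr1 ler_weXn2l// ltW.
have i2 : (\int[P]_w ((X w - m) ^+ 2)%:E = (s ^+ 2)%:E)%E.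
  apply: (@gaussian_by_parts X m s _ 1 id (cst 1) (fun y => y ^+ 2)) => //.
  - by move=> y; rewrite mul1r.
  - exact: exprn_continuous.
  - by move=> y; exact: sqr_ge0.
  - by move=> y /=; ring.
(* the law is centred at m, not yet known to be 0; comparing the second moments
   of X - m and X - m + 1 gives the mean of X - m without integrating a
   function of varying sign *)
have i2' : (\int[P]_w ((X w - m + 1) ^+ 2)%:E = (s ^+ 2 + 1)%:E)%E.
  apply: (@gaussian_by_parts X m s _ 3 (fun y => y + 2) (cst 1)
    (fun y => (y + 1) ^+ 2)) => //.
  - by move=> y; apply: is_derive_eq; rewrite addr0.
  - move=> y; rewrite (le_trans (ler_normD _ _))// [`|2|]ger0_norm//.
    have := w1 y; have : 0 <= `|y| ^+ 3 by rewrite exprn_ge0.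
    lra.
  - by move=> y; exact: sqr_ge0.
  - by move=> y /=; ring.
have i4 : (\int[P]_w ((X w - m) ^+ 4)%:E = (3 * (s ^+ 2) ^+ 2)%:E)%E.
  apply: (@gaussian_by_parts X m s _ (1 + 3 * s ^+ 2)
    (fun y => y ^+ 3 + 3 * s ^+ 2 * y) (fun y => 3 * y ^+ 2 + 3 * s ^+ 2)
    (fun y => y ^+ 4)) => //.
  - by move=> y; apply: is_derive_eq; rewrite /GRing.scale/=; ring.
  - move=> y; apply: le_trans (ler_normD _ _) _.
    have s30 : 0 <= 3 * s ^+ 2 by rewrite mulr_ge0// sqr_ge0.
    rewrite [`|3 * _ * y|]normrM normrX (ger0_norm s30).
    by have := ler_wpM2l s30 (w1 y); lra.
  - exact: exprn_continuous.
  - by move=> y; rewrite exprn_even_ge0.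
  - by move=> y /=; ring.
have [j2 e2] := ge0_rintegrable (measurable_funX 2 mXm) (fun w => sqr_ge0 _) i2.
have [j4 e4] := ge0_rintegrable (measurable_funX 4 mXm)
  (fun w => exprn_even_ge0 (X w - m) (isT : ~~ odd 4)) i4.
have mXm1 : measurable_fun setT (fun w => X w - m + 1) by exact: measurable_funD.
have [j2' e2'] := ge0_rintegrable (measurable_funX 2 mXm1) (fun w => sqr_ge0 _) i2'.
have j1 : P.-integrable setT (EFin \o (fun w => X w - m)).
  apply: (@le_rintegrable _ (fun w => (X w - m) ^+ 2 + 1)) => //.
    move=> w; have := sqr_ge0 (`|X w - m| - 1).
    rewrite -[(X w - m) ^+ 2]real_normK ?num_real//.
    by have := sqr_ge0 `|X w - m|; nra.
  exact: rintegrableD j2 (rintegrable_cst 1).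
have Em : \int[P]_w (X w - m) = 0.
  have : \int[P]_w ((X w - m + 1) ^+ 2)
      = \int[P]_w ((X w - m) ^+ 2) + 2 * \int[P]_w (X w - m) + 1.
    rewrite -RintegralZl// -RintegralD//; last exact: rintegrableZ.
    rewrite -[X in _ = _ + X]Rintegral_prob_cst -RintegralD//.
    - by apply: eq_Rintegral => w _; ring.
    - by apply: rintegrableD => //; exact: rintegrableZ.
    - exact: rintegrable_cst.
  rewrite e2 e2'; lra.
have jX : P.-integrable setT (EFin \o X).
  have := rintegrableD j1 (rintegrable_cst m).
  by apply: eq_integrable => // w _ /=; rewrite subrK.
have m0 : m = 0.
  have := Em; rewrite RintegralB// ?EX0 ?Rintegral_prob_cst; [lra|exact: rintegrable_cst].
move: j4 e2 e4; rewrite m0 => j4 e2 e4.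
exists (s ^+ 2).
  by move: j4; apply: eq_integrable => // w _ /=; rewrite subr0.
split.
  by rewrite -e2; apply: eq_Rintegral => w _; rewrite subr0.
by rewrite -e4; apply: eq_Rintegral => w _; rewrite subr0.
Qed.

End gaussian_law.

(** * Fourth moments and almost sure convergence *)

Section fourth_moments.
Context {R : realType} d (Omega : measurableType d) (P : probability Omega R).
Implicit Types X Y Z : Omega -> R.

(** Random variables with a finite fourth moment. *)
Definition L4 X := measurable_fun setT X /\
  P.-integrable setT (EFin \o (fun w => X w ^+ 4)).

Lemma L4_le_integrable X Y (f : Omega -> R) : L4 X -> L4 Y ->
  measurable_fun setT f ->
  (forall w, `|f w| <= 1 + X w ^+ 4 + Y w ^+ 4) ->
  P.-integrable setT (EFin \o f).
Proof.
move=> [mX iX] [mY iY] mf fle.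
apply: (le_rintegrable (g := fun w => 1 + X w ^+ 4 + Y w ^+ 4)) => //.
by apply: rintegrableD => //; apply: rintegrableD => //; exact: rintegrable_cst.
Qed.

Let le1_pow4 (x : R) : `|x| <= 1 + x ^+ 4 /\ x ^+ 2 <= 1 + x ^+ 4.
Proof.
have e4 : x ^+ 4 = `|x| ^+ 4 by rewrite -normrX ger0_norm// exprn_even_ge0.
have e2 : x ^+ 2 = `|x| ^+ 2 by rewrite real_normK ?num_real.
rewrite e4 e2; move: `|x| => y.
have := sqr_ge0 (y ^+ 2 - 1); have := sqr_ge0 (y - 1).
by have := sqr_ge0 (y ^+ 2); split; nra.
Qed.

Lemma L4_integrable X : L4 X -> P.-integrable setT (EFin \o X).
Proof.
move=> X4; have [mX _] := X4; apply: (L4_le_integrable X4 X4) => // w.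
have [+ _] := le1_pow4 (X w).
by have : 0 <= X w ^+ 4 by [rewrite exprn_even_ge0]; lra.
Qed.

Lemma L4_integrableM X Y : L4 X -> L4 Y ->
  P.-integrable setT (EFin \o (fun w => X w * Y w)).
Proof.
move=> X4 Y4; have [[mX _] [mY _]] := (X4, Y4).
apply: (L4_le_integrable X4 Y4); first exact: measurable_funM.
move=> w; have [_ h1] := le1_pow4 (X w); have [_ h2] := le1_pow4 (Y w).
rewrite normrM; have := sqr_ge0 (`|X w| - `|Y w|).
rewrite sqrrB !real_normK ?num_real//.
have := sqr_ge0 (X w); have := sqr_ge0 (Y w).
have : 0 <= X w ^+ 4 by rewrite exprn_even_ge0.
have : 0 <= Y w ^+ 4 by rewrite exprn_even_ge0.
lra.
Qed.

Lemma L4_integrable_sqrM X Y : L4 X -> L4 Y ->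
  P.-integrable setT (EFin \o (fun w => X w ^+ 2 * Y w ^+ 2)).
Proof.
move=> X4 Y4; have [[mX _] [mY _]] := (X4, Y4).
apply: (L4_le_integrable X4 Y4).
  by apply: measurable_funM; exact: measurable_funX.
move=> w; have p0 : 0 <= X w ^+ 2 * Y w ^+ 2 by rewrite mulr_ge0 ?sqr_ge0.
rewrite (ger0_norm p0); have := sqr_ge0 (X w ^+ 2 - Y w ^+ 2).
have := sqr_ge0 (X w ^+ 2 + Y w ^+ 2).
by rewrite sqrrB sqrrD -!exprM; lra.
Qed.

Lemma Rintegral_sum_ord N (F : nat -> Omega -> R) :
  (forall i, (i < N)%N -> P.-integrable setT (EFin \o F i)) ->
  P.-integrable setT (EFin \o (fun w => \sum_(i < N) F i w)) /\
  \int[P]_w (\sum_(i < N) F i w) = \sum_(i < N) \int[P]_w F i w.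
Proof.
elim: N => [|N IH] iF.
  have -> : (fun w => \sum_(i < 0) F i w) = (fun=> 0).
    by apply/funext => w; rewrite big_ord0.
  by rewrite big_ord0; split; [exact: rintegrable_cst|exact: Rintegral_prob_cst].
have [i0 e0] := IH (fun i iN => iF i (ltnW iN)).
have iN := iF N (ltnSn N).
have -> : (fun w => \sum_(i < N.+1) F i w)
    = (fun w => \sum_(i < N) F i w + F N w).
  by apply/funext => w; rewrite big_ord_recr.
by rewrite big_ord_recr/= -e0 -RintegralD//; split; first exact: rintegrableD.
Qed.

Lemma Rintegral_sqr_sum N (Y : nat -> Omega -> R) :
  (forall i j, P.-integrable setT (EFin \o (fun w => Y i w * Y j w))) ->
  P.-integrable setT (EFin \o (fun w => (\sum_(i < N) Y i w) ^+ 2)) /\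
  \int[P]_w ((\sum_(i < N) Y i w) ^+ 2)
    = \sum_(i < N) \sum_(j < N) \int[P]_w (Y i w * Y j w).
Proof.
move=> iY.
have E w : (\sum_(i < N) Y i w) ^+ 2 = \sum_(i < N) \sum_(j < N) Y i w * Y j w.
  by rewrite expr2 mulr_suml; apply: eq_bigr => i _; rewrite mulr_sumr.
have -> : (fun w => (\sum_(i < N) Y i w) ^+ 2)
    = (fun w => \sum_(i < N) \sum_(j < N) Y i w * Y j w).
  exact/funext.
have H i := @Rintegral_sum_ord N (fun j w => Y i w * Y j w) (fun j _ => iY i j).
have [h1 ->] := @Rintegral_sum_ord N (fun i w => \sum_(j < N) Y i w * Y j w)
   (fun i _ => (H i).1).
split => //; apply: eq_bigr => i _; exact: (H i).2.
Qed.

Lemma gaussian_L4 X : measurable_fun setT X -> gaussian P X ->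
  \int[P]_w X w = 0 -> L4 X.
Proof. by move=> mX gX X0; have [v iv _] := gaussian_moments mX gX X0. Qed.

(** Isserlis' formula, by polarization of the fourth moment. *)
Lemma isserlis X Y : measurable_fun setT X -> measurable_fun setT Y ->
  \int[P]_w X w = 0 -> \int[P]_w Y w = 0 ->
  gaussian P X -> gaussian P Y ->
  gaussian P (fun w => X w + Y w) -> gaussian P (fun w => X w - Y w) ->
  \int[P]_w (X w ^+ 2 * Y w ^+ 2)
  = \int[P]_w (X w ^+ 2) * \int[P]_w (Y w ^+ 2) + 2 * (\int[P]_w (X w * Y w)) ^+ 2.
Proof.
move=> mX mY X0 Y0 gX gY gD gB.
have X4 := gaussian_L4 mX gX X0; have Y4 := gaussian_L4 mY gY Y0.
have iX := L4_integrable X4; have iY := L4_integrable Y4.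
have iX2 : P.-integrable setT (EFin \o (fun w => X w ^+ 2)).
  exact: (L4_integrableM X4 X4).
have iY2 : P.-integrable setT (EFin \o (fun w => Y w ^+ 2)).
  exact: (L4_integrableM Y4 Y4).
have iXY := L4_integrableM X4 Y4.
have iXY2 := L4_integrable_sqrM X4 Y4.
have [_ iX4] := X4; have [_ iY4] := Y4.
have D0 : \int[P]_w (X w + Y w) = 0 by rewrite RintegralD// X0 Y0 addr0.
have B0 : \int[P]_w (X w - Y w) = 0 by rewrite RintegralB// X0 Y0 subr0.
have [vX _ [X2e X4e]] := gaussian_moments mX gX X0.
have [vY _ [Y2e Y4e]] := gaussian_moments mY gY Y0.
have [vD iD4 [D2e D4e]] := gaussian_moments (measurable_funD mX mY) gD D0.
have [vB iB4 [B2e B4e]] := gaussian_moments (measurable_funB mX mY) gB B0.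
have sq (c : R) : \int[P]_w ((X w + c * Y w) ^+ 2)
    = vX + c ^+ 2 * vY + 2 * c * \int[P]_w (X w * Y w).
  rewrite -X2e -Y2e -!RintegralZl// -!RintegralD//.
  - by apply: eq_Rintegral => w _; ring.
  - by apply: rintegrableD => //; exact: rintegrableZ.
  - exact: rintegrableZ.
  - exact: rintegrableZ.
have vDe : vD = vX + vY + 2 * \int[P]_w (X w * Y w).
  have := sq 1; rewrite -D2e expr1n mul1r mulr1 => <-.
  by apply: eq_Rintegral => w _; rewrite mul1r.
have vBe : vB = vX + vY - 2 * \int[P]_w (X w * Y w).
  have := sq (-1); rewrite -B2e sqrrN expr1n mul1r mulrN1 mulNr => <-.
  by apply: eq_Rintegral => w _; rewrite mulN1r.
have four : \int[P]_w ((X w + Y w) ^+ 4) + \int[P]_w ((X w - Y w) ^+ 4)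
    = 2 * \int[P]_w (X w ^+ 4) + 12 * \int[P]_w (X w ^+ 2 * Y w ^+ 2)
      + 2 * \int[P]_w (Y w ^+ 4).
  rewrite -!RintegralZl// -!RintegralD//.
  - by apply: eq_Rintegral => w _; ring.
  - by apply: rintegrableD; exact: rintegrableZ.
  - exact: rintegrableZ.
  - exact: rintegrableZ.
  - exact: rintegrableZ.
move: four; rewrite D4e B4e X4e Y4e vDe vBe X2e Y2e.
move: (\int[P]_w (X w * Y w)) (\int[P]_w (X w ^+ 2 * Y w ^+ 2)) => rho q H.
have : 12 * q = 12 * (vX * vY + 2 * rho ^+ 2) by nra.
lra.
Qed.

End fourth_moments.

Section almost_sure.
Context {R : realType} d (Omega : measurableType d) (P : probability Omega R).

(** Geometrically decaying second moments imply almost sure convergence. *)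
Lemma ae_cvg0_of_sqr_le (Z : nat -> Omega -> R) (C r : R) : 0 <= r -> r < 1 ->
  (forall n, measurable_fun setT (Z n)) ->
  (forall n, P.-integrable setT (EFin \o (fun w => Z n w ^+ 2))) ->
  (forall n, \int[P]_w (Z n w ^+ 2) <= C * r ^+ n) ->
  {ae P, forall w, Z n w @[n --> \oo] --> 0}.
Proof.
move=> r0 r1 mZ iZ ZC.
pose f n w := (Z n w ^+ 2)%:E.
have mf n : measurable_fun setT (f n).
  by apply/measurable_EFinP; exact: measurable_funX.
have f0 n w : (0 <= f n w)%E by rewrite lee_fin sqr_ge0.
have C0 : 0 <= C.
  have := ZC 0%N; rewrite expr0 mulr1; apply: le_trans.
  by apply: Rintegral_ge0 => w _; exact: sqr_ge0.
have int_fin : (\int[P]_w (\sum_(0 <= n <oo) f n w) < +oo)%E.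
  rewrite integral_nneseries//.
  apply: (@le_lt_trans _ _ (\sum_(0 <= n <oo) (C * r ^+ n)%:E)%E).
    apply: lee_nneseries => n _; first by move=> _; exact: integral_ge0.
    have := ZC n; rewrite -lee_fin /Rintegral fineK//.
    exact: (integrable_fin_num measurableT (iZ n)).
  have : cvgn (series (geometric C r)).
    by apply: is_cvg_geometric_series; rewrite ger0_norm.
  move=> cg.
  have -> : (\sum_(0 <= n <oo) (C * r ^+ n)%:E)%E
      = (limn (series (geometric C r)))%:E.
    rewrite -EFin_lim//; apply: congr_lim; apply/funext => n /=.
    by rewrite /series/= sumEFin.
  by rewrite ltry.
have mser : measurable_fun setT (fun w => (\sum_(0 <= n <oo) f n w)%E).
  by apply: ge0_emeasurable_sum.
have iser : P.-integrable setT (fun w => (\sum_(0 <= n <oo) f n w)%E).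
  apply/integrableP; split => //.
  under eq_integral do rewrite gee0_abs ?nneseries_ge0//.
  exact: int_fin.
have := integrable_ae measurableT iser; apply: filterS => w /(_ I) fw.
have lt : (\sum_(0 <= n <oo) f n w < +oo)%E.
  by rewrite -ge0_fin_numE// nneseries_ge0.
apply: cvg_sqr0.
have := @nnseries_is_cvg R (fun n => Z n w ^+ 2) (fun n => sqr_ge0 _) lt.
exact: cvg_series_cvg_0.
Qed.

End almost_sure.

(** * Increments of fractional Brownian motion *)

Section power_convexity.
Context {R : realType}.

Lemma powR_midpoint (q a b : R) : 1 <= q -> 0 <= a -> 0 <= b ->
  2 * ((a + b) / 2) `^ q <= a `^ q + b `^ q.
Proof.
move=> q1 a0 b0.
have half : 0 <= (2^-1 : R) <= 1 by rewrite invr_ge0 ler0n invf_le1 ?ler1n.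
have [h0 h1] := andP half.
have := @convex_powR R q q1 (Itv01 h0 h1) a b.
rewrite !inE/= !in_itv/= a0 b0 => /(_ isT isT).
have e : unstable.onem 2^-1 = 2^-1 :> R by rewrite /unstable.onem; field.
rewrite !convRE/= e => hc.
set u := (X in X `^ q <= _) in hc.
have ue : u = (a + b) / 2.
  transitivity (2^-1 * a + unstable.onem 2^-1 * b); first exact: convRE.
  by rewrite e; field.
by move: hc; rewrite ue; lra.
Qed.

(** With [q = 2 h] this is the sign of the covariances of the increments of
    fractional Brownian motion with Hurst parameter [h] at least one half. *)
Lemma powR_second_difference_ge0 (q x y : R) : 1 <= q ->
  0 <= `|x + y| `^ q + `|x - y| `^ q - 2 * `|x| `^ q.
Proof.
move=> q1; rewrite subr_ge0.
apply: le_trans (powR_midpoint q1 (normr_ge0 _) (normr_ge0 _)).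
rewrite ler_pM2l//; apply: ge0_ler_powR.
- by rewrite (le_trans _ q1).
- by rewrite nnegrE.
- by rewrite nnegrE divr_ge0// addr_ge0.
- rewrite ler_pdivlMr//; apply: le_trans (ler_normD _ _).
  by rewrite (_ : x + y + (x - y) = x * 2) ?normrM ?[`|2|]ger0_norm//; ring.
Qed.

End power_convexity.

Section fractional_brownian_increments.
Context {R : realType} d (Omega : measurableType d) (P : probability Omega R).
Variables (h : R) (W : R -> {RV P >-> R}).
Hypotheses (h_gt : 2^-1 < h) (h_lt : h < 1).
Hypothesis W_fbm : fractional_brownian_motion h W.

(** Combinations of four values of the process cover the sums and differences
    of two increments. *)
Lemma fbm_comb4 (a b c e s1 s2 s3 s4 : R) :
  0 <= s1 -> 0 <= s2 -> 0 <= s3 -> 0 <= s4 ->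
  gaussian P (fun w => a * W s1 w + b * W s2 w + c * W s3 w + e * W s4 w).
Proof.
move=> p1 p2 p3 p4; have [gW _ _ _] := W_fbm.
pose tau (i : 'I_4) := nth 0 [:: s1; s2; s3; s4] i.
pose co (i : 'I_4) := nth 0 [:: a; b; c; e] i.
have := gW 4%N tau co.
have -> : (fun w => \sum_(i < 4) co i * W (tau i) w)
    = (fun w => a * W s1 w + b * W s2 w + c * W s3 w + e * W s4 w).
  apply/funext => w; rewrite !big_ord_recl big_ord0 addr0 !addrA.
  by rewrite /co /tau/=.
apply=> -[[|[|[|[|//]]]] i4]; rewrite /tau/= in_itv/= ?andbT//.
Qed.

Lemma fbm_mean0 s : 0 <= s -> \int[P]_w W s w = 0.
Proof.
move=> s0; have [_ EW _ _] := W_fbm.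
by have := EW s s0; rewrite unlock /Rintegral => ->.
Qed.

Lemma fbm_L4 s : 0 <= s -> L4 P (W s).
Proof.
move=> s0; apply: gaussian_L4 => //; last exact: fbm_mean0.
have := fbm_comb4 1 0 0 0 s0 s0 s0 s0.
congr gaussian; apply/funext => w.
by rewrite mul1r !mul0r !addr0.
Qed.

(** The covariance function of fractional Brownian motion. *)
Definition fbm_cov (s r : R) : R :=
  (s `^ (2 * h) + r `^ (2 * h) - `|s - r| `^ (2 * h)) / 2.

Lemma fbm_covE s r : 0 <= s -> 0 <= r ->
  \int[P]_w (W s w * W r w) = fbm_cov s r.
Proof.
move=> s0 r0; have [_ EW cW _] := W_fbm.
have := cW s r s0 r0; rewrite unlock !EW//= unlock /Rintegral => /(congr1 fine) /= e.
rewrite /fbm_cov -e; congr fine; apply: eq_integral => w _ /=.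
transitivity ((W s w - 0) * (W r w - 0))%:E; last by [].
by rewrite !subr0.
Qed.

Lemma fbm_inc_measurable s r : measurable_fun setT (fun w => W s w - W r w).
Proof. exact: measurable_funB. Qed.

Lemma fbm_inc_mean0 s r : 0 <= s -> 0 <= r ->
  \int[P]_w (W s w - W r w) = 0.
Proof.
move=> s0 r0; rewrite RintegralB ?fbm_mean0 ?subrr//.
- exact: L4_integrable (fbm_L4 s0).
- exact: L4_integrable (fbm_L4 r0).
Qed.

Lemma fbm_inc_gaussian s r : 0 <= s -> 0 <= r ->
  gaussian P (fun w => W s w - W r w).
Proof.
move=> s0 r0; have := fbm_comb4 1 (-1) 0 0 s0 r0 s0 r0.
congr gaussian; apply/funext => w.
by rewrite mul1r mulN1r !mul0r !addr0.
Qed.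

Lemma fbm_inc_L4 s r : 0 <= s -> 0 <= r -> L4 P (fun w => W s w - W r w).
Proof.
move=> s0 r0; apply: gaussian_L4; first exact: fbm_inc_measurable.
  exact: fbm_inc_gaussian.
exact: fbm_inc_mean0.
Qed.

Lemma fbm_inc_cov a b c e : 0 <= a -> 0 <= b -> 0 <= c -> 0 <= e ->
  \int[P]_w ((W a w - W b w) * (W c w - W e w))
  = fbm_cov a c - fbm_cov a e - fbm_cov b c + fbm_cov b e.
Proof.
move=> a0 b0 c0 e0.
have iM s r (s0 : 0 <= s) (r0 : 0 <= r) := L4_integrableM (fbm_L4 s0) (fbm_L4 r0).
have iN s r (s0 : 0 <= s) (r0 : 0 <= r) := rintegrableZ (-1) (iM s r s0 r0).
rewrite -!fbm_covE// -[X in X - _ + _](_ : \int[P]_w (W a w * W c w)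
    + \int[P]_w (-1 * (W a w * W e w)) = _); last first.
  by rewrite RintegralZl// ?mulN1r//; exact: iM.
rewrite -[X in _ + _ - X + _]opprK -[X in _ + _ - - X + _](_ :
    \int[P]_w (-1 * (W b w * W c w)) = _); last first.
  by rewrite RintegralZl// ?mulN1r//; exact: iM.
rewrite opprK -!RintegralD//.
- by apply: eq_Rintegral => w _; ring.
- by apply: rintegrableD; [apply: rintegrableD|]; [exact: iM|exact: iN|exact: iN].
- exact: iM.
- by apply: rintegrableD; [exact: iM|exact: iN].
- exact: iN.
- exact: iM.
- exact: iN.
Qed.

End fractional_brownian_increments.

(** * Quadratic variations of fractional Brownian motion *)

Section fbm_quadratic_variation.
Context {R : realType} d (Omega : measurableType d) (P : probability Omega R).
Variables (h : R) (W : R -> {RV P >-> R}).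
Hypotheses (h_gt : 2^-1 < h) (h_lt : h < 1).
Hypothesis W_fbm : fractional_brownian_motion h W.

Let D k j w := dinc (fun s => W s w) k j.
(** The common variance [v k] of the increments of level [k], and the
    covariance [rho k i j] of two of them. *)
Let v k : R := (2 ^- k) `^ (2 * h).
Let rho k i j : R := \int[P]_w (D k i w * D k j w).

Let D_L4 k j : L4 P (D k j).
Proof. exact: (fbm_inc_L4 W_fbm (dy_ge0 k j.+1) (dy_ge0 k j)). Qed.

Let D_mean0 k j : \int[P]_w D k j w = 0.
Proof. exact: (fbm_inc_mean0 W_fbm (dy_ge0 k j.+1) (dy_ge0 k j)). Qed.

Let D_gauss k j : gaussian P (D k j).
Proof. exact: (fbm_inc_gaussian W_fbm (dy_ge0 k j.+1) (dy_ge0 k j)). Qed.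

Let q_neq0 : 2 * h != 0.
Proof. by apply: lt0r_neq0; have := h_gt; lra. Qed.

Let rhoE k i j : rho k i j
  = (`|(dy k i - dy k j) + 2 ^- k| `^ (2 * h)
     + `|(dy k i - dy k j) - 2 ^- k| `^ (2 * h)
     - 2 * `|dy k i - dy k j| `^ (2 * h)) / 2.
Proof.
rewrite /rho (fbm_inc_cov W_fbm) ?dy_ge0// /fbm_cov.
have -> : dy k i.+1 - dy k j.+1 = dy k i - dy k j :> R by rewrite !dyS; ring.
have -> : dy k i.+1 - dy k j = (dy k i - dy k j) + 2 ^- k :> R.
  by rewrite !dyS; ring.
have -> : dy k i - dy k j.+1 = (dy k i - dy k j) - 2 ^- k :> R.
  by rewrite !dyS; ring.
by field.
Qed.

Let rho_ge0 k i j : 0 <= rho k i j.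
Proof.
rewrite rhoE divr_ge0//; apply: powR_second_difference_ge0.
by have := h_gt; lra.
Qed.

Let D_sqr k j : \int[P]_w (D k j w ^+ 2) = v k.
Proof.
have := rhoE k j j; rewrite /rho subrr add0r normr0 sub0r normrN.
rewrite powR0 ?mulr0 ?subr0//.
rewrite ger0_norm ?invr_ge0 ?exprn_ge0// -/(v k) => rE.
transitivity (\int[P]_w (D k j w * D k j w)); first exact: eq_Rintegral.
by rewrite rE; field.
Qed.

Let D_iM k i j : P.-integrable setT (EFin \o (fun w => D k i w * D k j w)).
Proof. exact: L4_integrableM. Qed.

Let rho_le k i j : rho k i j <= v k.
Proof.
have i2 l : P.-integrable setT (EFin \o (fun w => D k l w ^+ 2)).
  exact: (D_iM k l l).
have : 0 <= \int[P]_w ((D k i w - D k j w) ^+ 2).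
  by apply: Rintegral_ge0 => w _; exact: sqr_ge0.
have -> : \int[P]_w ((D k i w - D k j w) ^+ 2)
    = v k + v k + (-2) * rho k i j.
  rewrite -{1}(D_sqr k i) -(D_sqr k j) /rho -RintegralZl// -!RintegralD//.
  - by apply: eq_Rintegral => w _; ring.
  - exact: rintegrableD.
  - exact: rintegrableZ.
by lra.
Qed.

Let D_isserlis k i j :
  \int[P]_w (D k i w ^+ 2 * D k j w ^+ 2) = v k ^+ 2 + 2 * rho k i j ^+ 2.
Proof.
have [mi _] := D_L4 k i; have [mj _] := D_L4 k j.
rewrite (isserlis mi mj)//; first by rewrite !D_sqr -expr2.
- have := fbm_comb4 W_fbm 1 (-1) 1 (-1) (dy_ge0 k i.+1) (dy_ge0 k i)
    (dy_ge0 k j.+1) (dy_ge0 k j).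
  by congr gaussian; apply/funext => w; rewrite /D /dinc; ring.
- have := fbm_comb4 W_fbm 1 (-1) (-1) 1 (dy_ge0 k i.+1) (dy_ge0 k i)
    (dy_ge0 k j.+1) (dy_ge0 k j).
  by congr gaussian; apply/funext => w; rewrite /D /dinc; ring.
Qed.

(** The covariances of all pairs of increments sum to the variance of the
    total increment. *)
Let sum_rho k N : \sum_(i < N) \sum_(j < N) rho k i j = dy k N `^ (2 * h).
Proof.
have [_ <-] := @Rintegral_sqr_sum _ _ _ P N (D k) (D_iM k).
transitivity (\int[P]_w ((W (dy k N) w - W 0 w) * (W (dy k N) w - W 0 w))).
  apply: eq_Rintegral => w _; rewrite expr2.
  suff -> : \sum_(i < N) D k i w = W (dy k N) w - W 0 w by [].
  rewrite -(big_mkord xpredT (fun i => D k i w)) /D /dinc.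
  by rewrite (telescope_sumr (fun i => W (dy k i) w))// dy0.
rewrite (fbm_inc_cov W_fbm) ?dy_ge0// /fbm_cov !subrr !subr0 !sub0r normrN.
rewrite normr0 powR0// (ger0_norm (dy_ge0 k N)).
by field.
Qed.

(** The centred quadratic variation has a small second moment: its variance
    is twice the sum of the squared covariances, each of which is at most
    [v k] times the covariance itself. *)
Lemma fbm_qv_variance_le k N :
  P.-integrable setT
    (EFin \o (fun w => (\sum_(j < N) (D k j w ^+ 2 - v k)) ^+ 2)) /\
  \int[P]_w ((\sum_(j < N) (D k j w ^+ 2 - v k)) ^+ 2)
    <= 2 * v k * dy k N `^ (2 * h).
Proof.
pose Y j w := D k j w ^+ 2 - v k.
have i2 l : P.-integrable setT (EFin \o (fun w => D k l w ^+ 2)).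
  exact: (D_iM k l l).
have i22 i j := L4_integrable_sqrM (D_L4 k i) (D_L4 k j).
have YE i j : (fun w => Y i w * Y j w)
    = (fun w => D k i w ^+ 2 * D k j w ^+ 2 + (- v k) * D k i w ^+ 2
       + (- v k) * D k j w ^+ 2 + v k ^+ 2).
  by apply/funext => w; rewrite /Y; ring.
have i3 i j : P.-integrable setT (EFin \o (fun w =>
    D k i w ^+ 2 * D k j w ^+ 2 + (- v k) * D k i w ^+ 2)).
  by apply: rintegrableD => //; exact: rintegrableZ.
have i4 i j : P.-integrable setT (EFin \o (fun w =>
    D k i w ^+ 2 * D k j w ^+ 2 + (- v k) * D k i w ^+ 2
       + (- v k) * D k j w ^+ 2)).
  by apply: rintegrableD => //; exact: rintegrableZ.
have iY i j : P.-integrable setT (EFin \o (fun w => Y i w * Y j w)).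
  by rewrite YE; apply: rintegrableD => //; exact: rintegrable_cst.
have EY i j : \int[P]_w (Y i w * Y j w) = 2 * rho k i j ^+ 2.
  rewrite YE RintegralD//; last exact: rintegrable_cst.
  rewrite RintegralD//; last exact: rintegrableZ.
  rewrite RintegralD//; last exact: rintegrableZ.
  rewrite Rintegral_prob_cst !RintegralZl// !D_sqr D_isserlis.
  by ring.
have [h1 h2] := @Rintegral_sqr_sum _ _ _ P N Y iY.
split => //; rewrite -/Y h2 -sum_rho mulr_sumr.
apply: ler_sum => i _; rewrite mulr_sumr; apply: ler_sum => j _.
rewrite EY -mulrA ler_pM2l// expr2.
by apply: ler_wpM2r; [exact: rho_ge0|exact: rho_le].
Qed.

(** Almost surely, the renormalized quadratic variations of fractional
    Brownian motion converge to the length of every dyadic interval starting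
    at [0]. *)
Lemma fbm_qv_ae : {ae P, forall w, forall m i,
  (2 `^ (2 * h - 1)) ^+ (m + n)
    * \sum_(j < i * 2 ^ n) dinc (fun s => W s w) (m + n) j ^+ 2
    @[n --> \oo] --> (dy m i : R)}.
Proof.
apply: ae_foralln => m; apply: ae_foralln => i.
set p := _ `^ _.
have p0 : 0 < p by rewrite powR_gt0.
pose Z n w := p ^+ (m + n) * \sum_(j < i * 2 ^ n) (D (m + n) j w ^+ 2 - v (m + n)).
have vE k : v k = ((2 `^ (2 * h))^-1) ^+ k by rewrite /v exp2V_powR powRN.
have p2 : 2 * p = 2 `^ (2 * h).
  rewrite -{1}[2]powRr1// -powRD ?pnatr_eq0 ?implybT//.
  by congr powR; ring.
have norm0 k : p ^+ k * v k = 2 ^- k.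
  rewrite vE -exprMn -p2 invfM mulrC -mulrA [_ * p]mulrC divff ?gt_eqF//.
  by rewrite mulr1 exprVn.
have mean n : p ^+ (m + n) * ((i * 2 ^ n)%:R * v (m + n)) = dy m i.
  by rewrite mulrCA norm0 -(dy_shift m n).
(* the second moments of Z decay like r ^ n with r = 2 ^ (2 h - 2) *)
pose r : R := p ^+ 2 * (2 `^ (2 * h))^-1.
have r0 : 0 <= r by rewrite mulr_ge0 ?sqr_ge0// invr_ge0 powR_ge0.
have r1 : r < 1.
  have -> : r = 2 `^ (2 * h - 2).
    rewrite /r -powR_mulrn ?powR_ge0// -powRrM -powRN.
    by rewrite -powRD ?pnatr_eq0 ?implybT//; congr powR; ring.
  by apply: powR2_lt1; have := h_lt; lra.
have mD k j : measurable_fun setT (D k j) by have [] := D_L4 k j.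
have Z0 : {ae P, forall w, Z n w @[n --> \oo] --> 0}.
  apply: (@ae_cvg0_of_sqr_le _ _ _ P Z (2 * r ^+ m * dy m i `^ (2 * h)) r) => //.
  - move=> n; apply: measurable_funM => //; apply: measurable_sum => j.
    by apply: measurable_funB => //; apply: measurable_funX.
  - move=> n; have [h1 _] := fbm_qv_variance_le (m + n) (i * 2 ^ n).
    have := rintegrableZ ((p ^+ (m + n)) ^+ 2) h1.
    by congr (_.-integrable _ (EFin \o _)); apply/funext => w; rewrite exprMn.
  - move=> n; have [h1 h2] := fbm_qv_variance_le (m + n) (i * 2 ^ n).
    have -> : \int[P]_w (Z n w ^+ 2) = (p ^+ (m + n)) ^+ 2
        * \int[P]_w ((\sum_(j < i * 2 ^ n) (D (m + n) j w ^+ 2 - v (m + n))) ^+ 2).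
      by rewrite -RintegralZl//; apply: eq_Rintegral => w _; rewrite exprMn.
    apply: le_trans (ler_wpM2l (sqr_ge0 _) h2) _.
    rewrite dy_shift vE exprAC le_eqVlt; apply/orP; left; apply/eqP.
    have -> : 2 * r ^+ m * dy m i `^ (2 * h) * r ^+ n
        = 2 * r ^+ (m + n) * dy m i `^ (2 * h) by rewrite exprD; ring.
    by rewrite /r [(p ^+ 2 / _) ^+ _]exprMn; ring.
move: Z0; apply: filterS => w Zw.
have H := cvgnD Zw (@cvgn_cst R (dy m i)); rewrite add0r in H.
apply: cvgn_eq H => n; rewrite /Z sumrB mulrBr sumr_const card_ord -mulr_natl.
by rewrite mean subrK.
Qed.

End fbm_quadratic_variation.

(** * Integrals over the torus *)

Section torus_integrals.
Context {R : realType}.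
Notation mu := (@lebesgue_measure R).
Notation mu2 := (@lebesgue2 R).
Notation Q := (@torus_domain R).

Lemma measurable_torus_domain :
  measurable (Q : set (measurableTypeR R * measurableTypeR R)).
Proof. by apply: measurableX; exact: measurable_itv. Qed.

Lemma lebesgue2_torus_domain : mu2 Q = 1%E.
Proof.
have h : mu `[0%R, 1%R] = 1%E.
  by rewrite lebesgue_measure_itv/= lte_fin ltr01 oppr0 adde0.
transitivity (mu `[0%R, 1%R] * mu `[0%R, 1%R])%E; last by rewrite h mule1.
by apply: product_measure1E; exact: measurable_itv.
Qed.

Lemma lebesgue2_torus_domain_lty : (mu2 Q < +oo)%E.
Proof. by rewrite lebesgue2_torus_domain ltry. Qed.

Lemma continuous_fst_snd_measurable (u v : R -> R) :
  continuous u -> continuous v ->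
  measurable_fun setT (fun z : R * R => u z.1 * v z.2).
Proof.
move=> cu cv; apply: measurable_funM.
  by apply: measurableT_comp; [exact: continuous_measurable_fun|exact: measurable_fst].
by apply: measurableT_comp; [exact: continuous_measurable_fun|exact: measurable_snd].
Qed.

Lemma continuous_unit_bounded (u : R -> R) : continuous u ->
  exists C : R, forall x, 0 <= x <= 1 -> `|u x| <= C.
Proof.
move=> cu.
have [c _ Hc] := @EVT_max R (fun x => `|u x|) 0 1 ler01 (continuous_subspaceT
  (fun x => cvg_norm (cu x))).
by exists `|u c| => x x01; apply: Hc; rewrite in_itv.
Qed.

Lemma torus_integral_mul (u v : R -> R) : continuous u -> continuous v ->
  \int[mu2]_(z in Q) (u z.1 * v z.2)
  = (\int[mu]_(x in `[0, 1]) u x) * (\int[mu]_(y in `[0, 1]) v y).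
Proof.
move=> cu cv.
have mQ := measurable_torus_domain.
have [Cu Hu] := continuous_unit_bounded cu.
have [Cv Hv] := continuous_unit_bounded cv.
have iv : mu.-integrable `[0, 1] (EFin \o v).
  by apply: continuous_compact_integrable; [exact: segment_compact|exact: continuous_subspaceT].
have iu : mu.-integrable `[0, 1] (EFin \o u).
  by apply: continuous_compact_integrable; [exact: segment_compact|exact: continuous_subspaceT].
pose f (z : R * R) := (u z.1 * v z.2)%:E.
have iQ : mu2.-integrable Q f.
  apply: (@rI_le _ _ _ mu2 Q mQ (fun z => u z.1 * v z.2) (fun=> Cu * Cv)).
  - by apply: measurable_funTS; exact: continuous_fst_snd_measurable.
  - move=> z [/= z1 z2]; rewrite normrM; rewrite !in_itv/= in z1 z2.
    by apply: ler_pM => //; [exact: Hu|exact: Hv].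
  - exact: (rI_cst mQ lebesgue2_torus_domain_lty).
have iT : mu2.-integrable setT (f \_ Q) by rewrite -integrable_mkcond.
rewrite /Rintegral integral_mkcond.
have -> : ((fun z : R * R => (u z.1 * v z.2)%:E) \_ Q) = f \_ Q by [].
rewrite -(integral12_prod_meas1 iT) /fubini_F.
have vE : (\int[mu]_(y in `[0%R, 1%R]) (v y)%:E)%E = (\int[mu]_(y in `[0, 1]) v y)%:E.
  rewrite /Rintegral fineK//; exact: integrable_fin_num iv.
have -> : (fun x : R => \int[mu]_y (f \_ Q) (x, y))%E
   = ((fun x : R => (u x)%:E * (\int[mu]_(y in `[0%R, 1%R]) v y)%R%:E) \_ `[0%R, 1%R])%E.
  apply/funext => x; rewrite patchE; case: ifPn => [|] x01.
    rewrite -vE -integralZl; [|exact: measurable_itv|exact: iv].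
    rewrite [in RHS]integral_mkcond; apply: eq_integral => y _.
    rewrite !patchE /f; case: ifPn => yQ; case: ifPn => y01 //.
      by move: yQ; rewrite inE => -[_ /= yy]; move: y01; rewrite notin_setE.
    move: yQ; rewrite notin_setE => yQ; exfalso; apply: yQ; split.
      by rewrite inE in x01.
    by rewrite inE in y01.
  apply: integral0_eq => y _; rewrite patchE; case: ifPn => // yQ.
  by move: yQ x01; rewrite inE => -[/= h _]; rewrite notin_setE.
rewrite -integral_mkcond integralZr; [|exact: measurable_itv|exact: iu].
have uE : (\int[mu]_(y in `[0%R, 1%R]) (u y)%:E)%E = (\int[mu]_(y in `[0, 1]) u y)%:E.
  rewrite /Rintegral fineK//; exact: integrable_fin_num iu.
by rewrite uE.
Qed.

End torus_integrals.

(** * Integrals of the trigonometric functions *)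

Section trigonometric_polynomials.
Context {R : realType}.
Notation mu := (@lebesgue_measure R).
Notation mu2 := (@lebesgue2 R).
Notation Q := (@torus_domain R).
Implicit Types (f p q : R * R -> R) (k l : int * int).

Let tcos k : R * R -> R := cos \o phase k.
Let tsin k : R * R -> R := sin \o phase k.

Lemma cos_sin_2pi_int (m : int) :
  cos (2 * pi * m%:~R) = 1 :> R /\ sin (2 * pi * m%:~R) = 0 :> R.
Proof.
have nat_case (n : nat) : cos (2 * pi * n%:R) = 1 :> R /\ sin (2 * pi * n%:R) = 0 :> R.
  have -> : 2 * pi * n%:R = 0 + pi *+ 2 *+ n :> R.
    by rewrite add0r -[RHS]mulr_natr -[pi *+ 2]mulr_natr; ring.
  by rewrite (periodicn (@cosD2pi R)) (periodicn (@sinD2pi R)) cos0 sin0.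
case: m => n; first exact: nat_case.
rewrite NegzE mulrNz mulrN cosN sinN; have [-> ->] := nat_case n.+1.
by rewrite oppr0.
Qed.

Lemma unit_integral_FTC (u U : R -> R) : continuous u ->
  (forall x : R, is_derive x 1 U (u x)) ->
  \int[mu]_(x in `[0, 1]) u x = U 1 - U 0.
Proof.
move=> cu dU; rewrite /Rintegral.
have cU : continuous U.
  move=> x; have [dv _] := dU x.
  by apply: differentiable_continuous; apply/derivable1_diffP.
rewrite (@continuous_FTC2 R u U 0 1)//.
- exact: continuous_subspaceT.
- split.
  + by move=> x _; have [] := dU x.
  + exact/cvg_at_right_filter/cU.
  + exact/cvg_at_left_filter/cU.
- by move=> x _; rewrite derive1E; exact: (@derive_val _ _ _ _ _ _ _ (dU x)).
Qed.

Let lin (m : int) (x : R) : R := 2 * pi * m%:~R * x.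

Let cont_cos m : continuous (fun x => cos (lin m x)).
Proof.
move=> x; apply: (@continuous_comp _ _ _ (lin m) cos); last exact: continuous_cos.
by apply: cvgM; [exact: cvg_cst|exact: cvg_id].
Qed.

Let cont_sin m : continuous (fun x => sin (lin m x)).
Proof.
move=> x; apply: (@continuous_comp _ _ _ (lin m) sin); last exact: continuous_sin.
by apply: cvgM; [exact: cvg_cst|exact: cvg_id].
Qed.

Let dlin m (x : R) : is_derive x 1 (lin m) (2 * pi * m%:~R).
Proof. by rewrite /lin; apply: is_derive_eq; rewrite /GRing.scale/=; ring. Qed.

Let freq_neq0 (m : int) : m != 0 -> 2 * pi * m%:~R != 0 :> R.
Proof. by move=> m0; rewrite !mulf_neq0 ?intr_eq0// gt_eqF// pi_gt0. Qed.

Let int_cos m : \int[mu]_(x in `[0, 1]) cos (lin m x) = (m == 0)%:R.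
Proof.
have [->|m0] := eqVneq m 0.
  have dU (x : R) : is_derive x 1 id (cos (lin 0 x)).
    by rewrite /lin mulr0 mul0r cos0; exact: is_derive_id.
  by apply: etrans (unit_integral_FTC (@cont_cos 0) dU) _; rewrite subr0.
have c0 := freq_neq0 m0.
have dU (x : R) : is_derive x 1
    (fun x => (2 * pi * m%:~R)^-1 * sin (lin m x)) (cos (lin m x)).
  have H := is_deriveZ (2 * pi * m%:~R)^-1
    (@is_derive1_comp R sin (lin m) x _ _ (is_derive_sin _) (dlin m x)).
  apply: is_derive_eq H _.
  by rewrite /GRing.scale/= mulrC mulfK.
apply: etrans (unit_integral_FTC (@cont_cos m) dU) _.
rewrite /lin mulr1 !mulr0 sin0 mulr0 subr0.
by have [_ ->] := cos_sin_2pi_int m; rewrite mulr0.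
Qed.

Let int_sin m : \int[mu]_(x in `[0, 1]) sin (lin m x) = 0.
Proof.
have [->|m0] := eqVneq m 0.
  have dU (x : R) : is_derive x 1 (cst 0 : R -> R) (sin (lin 0 x)).
    by rewrite /lin mulr0 mul0r sin0; exact: is_derive_cst.
  by apply: etrans (unit_integral_FTC (@cont_sin 0) dU) _; rewrite subrr.
have c0 := freq_neq0 m0.
have dU (x : R) : is_derive x 1
    (fun x => (- (2 * pi * m%:~R)^-1) * cos (lin m x)) (sin (lin m x)).
  have H := is_deriveZ (- (2 * pi * m%:~R)^-1)
    (@is_derive1_comp R cos (lin m) x _ _ (is_derive_cos _) (dlin m x)).
  apply: is_derive_eq H _.
  by rewrite /GRing.scale/=; move: c0; move: (2 * pi * m%:~R) => c c0; field.
apply: etrans (unit_integral_FTC (@cont_sin m) dU) _.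
rewrite /lin mulr1 !mulr0 cos0.
by have [-> _] := cos_sin_2pi_int m; rewrite subrr.
Qed.

Let phaseE k x : phase k x = lin k.1 x.1 + lin k.2 x.2.
Proof. by rewrite /phase /lin; ring. Qed.

Let tcosE k : tcos k = (fun x => cos (lin k.1 x.1) * cos (lin k.2 x.2)
  - sin (lin k.1 x.1) * sin (lin k.2 x.2)).
Proof. by apply/funext => x; rewrite /tcos/= phaseE cosD. Qed.

Let tsinE k : tsin k = (fun x => sin (lin k.1 x.1) * cos (lin k.2 x.2)
  + cos (lin k.1 x.1) * sin (lin k.2 x.2)).
Proof. by apply/funext => x; rewrite /tsin/= phaseE sinD. Qed.

Lemma measurable_tcos k : measurable_fun setT (tcos k).
Proof.
rewrite tcosE; apply: measurable_funB.
  exact: (continuous_fst_snd_measurable (@cont_cos _) (@cont_cos _)).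
exact: (continuous_fst_snd_measurable (@cont_sin _) (@cont_sin _)).
Qed.

Lemma measurable_tsin k : measurable_fun setT (tsin k).
Proof.
rewrite tsinE; apply: measurable_funD.
  exact: (continuous_fst_snd_measurable (@cont_sin _) (@cont_cos _)).
exact: (continuous_fst_snd_measurable (@cont_cos _) (@cont_sin _)).
Qed.

Let prod_rI (u v : R -> R) : continuous u -> continuous v ->
  (forall x, `|u x| <= 1) -> (forall x, `|v x| <= 1) ->
  mu2.-integrable Q (EFin \o (fun z : R * R => u z.1 * v z.2)).
Proof.
move=> cu cv u1 v1.
apply: (@rI_le _ _ _ mu2 Q measurable_torus_domain _ (fun=> 1)).
- by apply: measurable_funTS; exact: continuous_fst_snd_measurable.
- by move=> z _; rewrite normrM mulr_ile1.
- exact: (rI_cst measurable_torus_domain lebesgue2_torus_domain_lty).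
Qed.

Let cos1 m x : `|cos (lin m x)| <= 1. Proof. by rewrite ler_norml cos_geN1 cos_le1. Qed.
Let sin1 m x : `|sin (lin m x)| <= 1. Proof. by rewrite ler_norml sin_geN1 sin_le1. Qed.

Lemma integral_tcos k : \int[mu2]_(x in Q) tcos k x = (k == 0)%:R.
Proof.
rewrite tcosE RintegralB.
- rewrite (torus_integral_mul (@cont_cos _) (@cont_cos _)).
  rewrite (torus_integral_mul (@cont_sin _) (@cont_sin _)).
  rewrite !int_cos !int_sin mulr0 subr0 -natrM mulnb.
  suff -> : (k.1 == 0) && (k.2 == 0) = (k == 0) by [].
  case: k => a b /=; apply/andP/eqP => [[/eqP -> /eqP ->]//|[-> ->]].
  by rewrite eqxx.
- exact: measurable_torus_domain.
- exact: (prod_rI (@cont_cos _) (@cont_cos _) (cos1 _) (cos1 _)).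
- exact: (prod_rI (@cont_sin _) (@cont_sin _) (sin1 _) (sin1 _)).
Qed.

Lemma integral_tsin k : \int[mu2]_(x in Q) tsin k x = 0.
Proof.
rewrite tsinE RintegralD.
- rewrite (torus_integral_mul (@cont_sin _) (@cont_cos _)).
  rewrite (torus_integral_mul (@cont_cos _) (@cont_sin _)).
  by rewrite !int_sin mulr0 mul0r addr0.
- exact: measurable_torus_domain.
- exact: (prod_rI (@cont_sin _) (@cont_cos _) (sin1 _) (cos1 _)).
- exact: (prod_rI (@cont_cos _) (@cont_sin _) (cos1 _) (sin1 _)).
Qed.

End trigonometric_polynomials.

(** * Trigonometric polynomials *)

Section trigonometric_polynomials_algebra.
Context {R : realType}.
Notation mu2 := (@lebesgue2 R).
Notation Q := (@torus_domain R).
Notation tcos k := ((@cos R) \o (@phase R k)).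
Notation tsin k := ((@sin R) \o (@phase R k)).
Implicit Types (f p q : R * R -> R) (k l : int * int).

Let mQ := @measurable_torus_domain R.
Let Qlty := @lebesgue2_torus_domain_lty R.

(** Real trigonometric polynomials on the torus. *)
Inductive trigp : (R * R -> R) -> Prop :=
| trigp_cos k : trigp (tcos k)
| trigp_sin k : trigp (tsin k)
| trigp_add p q : trigp p -> trigp q -> trigp (fun x => p x + q x)
| trigp_scale c p : trigp p -> trigp (fun x => c * p x).

Lemma phaseD k l x : phase (k.1 + l.1, k.2 + l.2) x = phase k x + phase l x :> R.
Proof. by rewrite /phase/= !intrD; ring. Qed.

Lemma phaseB k l x : phase (k.1 - l.1, k.2 - l.2) x = phase k x - phase l x :> R.
Proof. by rewrite /phase/= !intrD !intrN; ring. Qed.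

Lemma phase0 x : phase (0, 0) x = 0 :> R.
Proof. by rewrite /phase/=; ring. Qed.

Lemma trigp_ext p q : p =1 q -> trigp p -> trigp q.
Proof. by move=> /funext ->. Qed.

Lemma trigp_cst c : trigp (fun=> c).
Proof.
apply: trigp_ext (trigp_scale c (trigp_cos (0, 0))) => x /=.
by rewrite phase0 cos0 mulr1.
Qed.

Lemma trigp_sub p q : trigp p -> trigp q -> trigp (fun x => p x - q x).
Proof.
move=> tp tq; apply: trigp_ext (trigp_add tp (trigp_scale (-1) tq)) => x.
by rewrite mulN1r.
Qed.

Let half_sum (a b : R) p q : trigp p -> trigp q ->
  trigp (fun x => a * p x + b * q x).
Proof. by move=> tp tq; apply: trigp_add; exact: trigp_scale. Qed.

(** By the product formulas. *)
Lemma trigp_mul p q : trigp p -> trigp q -> trigp (fun x => p x * q x).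
Proof.
move=> + tq; elim: tq p => {q} [l|l|q r _ IHq _ IHr|c q _ IH] p.
- elim=> {p} [k|k|p r _ IHp _ IHr|c p _ IH].
  + apply: trigp_ext (half_sum 2^-1 2^-1 (trigp_cos (k.1 + l.1, k.2 + l.2))
      (trigp_cos (k.1 - l.1, k.2 - l.2))) => x /=.
    by rewrite phaseD phaseB cosD cosB; field.
  + apply: trigp_ext (half_sum 2^-1 2^-1 (trigp_sin (k.1 + l.1, k.2 + l.2))
      (trigp_sin (k.1 - l.1, k.2 - l.2))) => x /=.
    by rewrite phaseD phaseB sinD sinB; field.
  + by apply: trigp_ext (trigp_add IHp IHr) => x; rewrite mulrDl.
  + by apply: trigp_ext (trigp_scale c IH) => x; rewrite mulrA.
- elim=> {p} [k|k|p r _ IHp _ IHr|c p _ IH].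
  + apply: trigp_ext (half_sum 2^-1 (- 2^-1) (trigp_sin (k.1 + l.1, k.2 + l.2))
      (trigp_sin (k.1 - l.1, k.2 - l.2))) => x /=.
    by rewrite phaseD phaseB sinD sinB; field.
  + apply: trigp_ext (half_sum (- 2^-1) 2^-1 (trigp_cos (k.1 + l.1, k.2 + l.2))
      (trigp_cos (k.1 - l.1, k.2 - l.2))) => x /=.
    by rewrite phaseD phaseB cosD cosB; field.
  + by apply: trigp_ext (trigp_add IHp IHr) => x; rewrite mulrDl.
  + by apply: trigp_ext (trigp_scale c IH) => x; rewrite mulrA.
- move=> tp; apply: trigp_ext (trigp_add (IHq p tp) (IHr p tp)) => x.
  by rewrite mulrDr.
- move=> tp; apply: trigp_ext (trigp_scale c (IH p tp)) => x.
  by rewrite mulrCA.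
Qed.

Lemma trigp_exp p n : trigp p -> trigp (fun x => p x ^+ n).
Proof.
move=> tp; elim: n => [|n IH]; first exact: trigp_cst.
by apply: trigp_ext (trigp_mul tp IH) => x; rewrite exprS.
Qed.

Lemma trigp_measurable p : trigp p -> measurable_fun setT p.
Proof.
elim=> {p} [k|k|p r _ IHp _ IHr|c p _ IH].
- exact: measurable_tcos.
- exact: measurable_tsin.
- exact: measurable_funD.
- exact: measurable_funM.
Qed.

Lemma trigp_bounded p : trigp p -> exists C, forall x, `|p x| <= C.
Proof.
elim=> {p} [k|k|p r _ [C HC] _ [C' HC']|c p _ [C HC]].
- by exists 1 => x /=; rewrite ler_norml cos_geN1 cos_le1.
- by exists 1 => x /=; rewrite ler_norml sin_geN1 sin_le1.
- by exists (C + C') => x; rewrite (le_trans (ler_normD _ _))// lerD.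
- by exists (`|c| * C) => x; rewrite normrM ler_wpM2l.
Qed.

Lemma trigp_sqi p : trigp p -> sqi mu2 Q p.
Proof.
move=> tp; have [C HC] := trigp_bounded tp.
apply: (@sqi_bounded _ _ _ mu2 Q mQ Qlty p C) => [|x _]; last exact: HC.
by apply: measurable_funTS; exact: trigp_measurable.
Qed.

Let dl k l : R := (k == l)%:R.
Let opp k : int * int := (- k.1, - k.2).

Let pair0 k l : ((k.1 - l.1, k.2 - l.2) == 0) = (l == k).
Proof.
case: k l => [a b] [c e]/=; apply/eqP/eqP => [[/eqP + /eqP]|[-> ->]].
  by rewrite !subr_eq0 => /eqP -> /eqP ->.
by rewrite !subrr.
Qed.

Let pair0D k l : ((k.1 + l.1, k.2 + l.2) == 0) = (l == opp k).
Proof.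
case: k l => [a b] [c e]; rewrite /opp/=; apply/eqP/eqP => [[/eqP + /eqP]|[-> ->]].
  by rewrite !(addrC a) !(addrC b) !addr_eq0 => /eqP -> /eqP ->.
by rewrite !subrr.
Qed.

Let ip_tcos_tcos k l :
  ip mu2 Q (tcos k) (tcos l) = 2^-1 * (dl l k + dl l (opp k)).
Proof.
transitivity (\int[mu2]_(x in Q) (2^-1 * (tcos (k.1 - l.1, k.2 - l.2) x
   + tcos (k.1 + l.1, k.2 + l.2) x))).
  by apply: eq_Rintegral => x _ /=; rewrite phaseB cosB phaseD cosD; field.
have i1 m := (sqi_mul mQ (trigp_sqi (trigp_cos m)) (trigp_sqi (trigp_cst 1))).
have i2 m : mu2.-integrable Q (EFin \o tcos m).
  by have := i1 m; apply: eq_integrable => // x _ /=; rewrite mulr1.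
rewrite RintegralZl//; last exact: (rI_D mQ (i2 _) (i2 _)).
rewrite RintegralD//; try exact: i2.
by rewrite !integral_tcos pair0 pair0D.
Qed.

Let ip_tsin_tsin k l :
  ip mu2 Q (tsin k) (tsin l) = 2^-1 * (dl l k - dl l (opp k)).
Proof.
transitivity (\int[mu2]_(x in Q) (2^-1 * (tcos (k.1 - l.1, k.2 - l.2) x
   - tcos (k.1 + l.1, k.2 + l.2) x))).
  by apply: eq_Rintegral => x _ /=; rewrite phaseB cosB phaseD cosD; field.
have i1 m := (sqi_mul mQ (trigp_sqi (trigp_cos m)) (trigp_sqi (trigp_cst 1))).
have i2 m : mu2.-integrable Q (EFin \o tcos m).
  by have := i1 m; apply: eq_integrable => // x _ /=; rewrite mulr1.
rewrite RintegralZl//; last exact: (integrableB mQ (i2 _) (i2 _)).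
rewrite RintegralB//; try exact: i2.
by rewrite !integral_tcos pair0 pair0D.
Qed.

Let ip_tsin_tcos k l : ip mu2 Q (tsin k) (tcos l) = 0.
Proof.
transitivity (\int[mu2]_(x in Q) (2^-1 * (tsin (k.1 - l.1, k.2 - l.2) x
   + tsin (k.1 + l.1, k.2 + l.2) x))).
  by apply: eq_Rintegral => x _ /=; rewrite phaseB sinB phaseD sinD; field.
have i1 m := (sqi_mul mQ (trigp_sqi (trigp_sin m)) (trigp_sqi (trigp_cst 1))).
have i2 m : mu2.-integrable Q (EFin \o tsin m).
  by have := i1 m; apply: eq_integrable => // x _ /=; rewrite mulr1.
rewrite RintegralZl//; last exact: (rI_D mQ (i2 _) (i2 _)).
rewrite RintegralD//; try exact: i2.
by rewrite !integral_tsin addr0 mulr0.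
Qed.

Let ip_tcos_tsin k l : ip mu2 Q (tcos k) (tsin l) = 0.
Proof. by rewrite ipC; exact: ip_tsin_tcos. Qed.

Let tcos_opp k : tcos (opp k) = tcos k.
Proof.
apply/funext => x /=; rewrite -cosN; congr cos.
by rewrite /phase/= !intrN; ring.
Qed.

Let tsin_opp k : tsin (opp k) = (fun x => (-1) * tsin k x).
Proof.
apply/funext => x /=; rewrite mulN1r -sinN; congr sin.
by rewrite /phase/= !intrN; ring.
Qed.

Let sum_dl (F : seq (int * int)) (g : int * int -> R) k : uniq F -> k \in F ->
  \sum_(l <- F) g l * dl l k = g k.
Proof.
move=> uF kF; rewrite (bigD1_seq k)//= /dl eqxx mulr1 big1 ?addr0//.
by move=> l /negbTE ->; rewrite mulr0.
Qed.

(** Testing against a trigonometric polynomial only sees finitely many Fourier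
    coefficients.  The modes [k] and [- k] are both listed, which makes up for
    the square norm [1 / 2] of the nonconstant cosines and sines. *)
Lemma trigp_reproducing p : trigp p -> exists s : seq (int * int), forall F,
  uniq F -> {subset s <= F} -> forall f, sqi mu2 Q f ->
  ip mu2 Q f p = \sum_(l <- F) (ip mu2 Q f (tcos l) * ip mu2 Q p (tcos l)
                              + ip mu2 Q f (tsin l) * ip mu2 Q p (tsin l)).
Proof.
elim=> {p} [k|k|p q tp [s Hs] tq [s' Hs']|c p tp [s Hs]].
- exists [:: k; opp k] => F uF sF f sf.
  have kF : k \in F by apply: sF; rewrite inE eqxx.
  have kF' : opp k \in F by apply: sF; rewrite !inE eqxx orbT.
  rewrite (eq_bigr (fun l => 2^-1 * (ip mu2 Q f (tcos l) * dl l k)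
      + 2^-1 * (ip mu2 Q f (tcos l) * dl l (opp k)))).
    rewrite big_split/= -!mulr_sumr !sum_dl// tcos_opp; by field.
  move=> l _; rewrite ip_tcos_tcos ip_tcos_tsin mulr0 addr0.
  by ring.
- exists [:: k; opp k] => F uF sF f sf.
  have kF : k \in F by apply: sF; rewrite inE eqxx.
  have kF' : opp k \in F by apply: sF; rewrite !inE eqxx orbT.
  rewrite (eq_bigr (fun l => 2^-1 * (ip mu2 Q f (tsin l) * dl l k)
      - 2^-1 * (ip mu2 Q f (tsin l) * dl l (opp k)))).
    rewrite sumrB -!mulr_sumr !sum_dl// tsin_opp.
    rewrite (ipZr mQ)//; last exact: trigp_sqi (trigp_sin _).
    by field.
  move=> l _; rewrite ip_tsin_tsin ip_tsin_tcos mulr0 add0r.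
  by ring.
- exists (s ++ s') => F uF sF f sf.
  have spq := (trigp_sqi tp, trigp_sqi tq).
  rewrite (ipDr mQ)//; try exact: trigp_sqi.
  rewrite (Hs F uF) ?(Hs' F uF)//; last 2 first.
  + by move=> x xs; apply: sF; rewrite mem_cat xs orbT.
  + by move=> x xs; apply: sF; rewrite mem_cat xs.
  rewrite -big_split/=; apply: eq_bigr => l _.
  rewrite !(ipDl mQ)//; try exact: trigp_sqi; try exact: trigp_sqi (trigp_cos _);
    try exact: trigp_sqi (trigp_sin _).
  by ring.
- exists s => F uF sF f sf.
  rewrite (ipZr mQ)//; last exact: trigp_sqi.
  rewrite (Hs F uF)// mulr_sumr; apply: eq_bigr => l _.
  rewrite !(ipZl mQ)//; try exact: trigp_sqi; try exact: trigp_sqi (trigp_cos _);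
    try exact: trigp_sqi (trigp_sin _).
  by ring.
Qed.

(** A square integrable function that is a limit of trigonometric polynomials
    has square norm at most any bound [M] of the finite sums of its squared
    Fourier coefficients. *)
Lemma parseval_le_of_dense f (M : R) : sqi mu2 Q f ->
  (forall F : seq (int * int), uniq F -> \sum_(l <- F) fourier_sq f l <= M) ->
  (forall e : R, 0 < e -> exists2 p, trigp p &
     ip mu2 Q (fun x => f x - p x) (fun x => f x - p x) < e) ->
  ip mu2 Q f f <= M.
Proof.
move=> sf FM dens; apply/ler_addgt0Pr => e e0.
have [p tp pe] := dens e e0.
have sp := trigp_sqi tp.
have [s Hs] := trigp_reproducing tp.
pose F := undup s.
have uF : uniq F by exact: undup_uniq.
have sF : {subset s <= F} by move=> x; rewrite mem_undup.
have fp := Hs F uF sF f sf; have pp := Hs F uF sF p sp.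
have cs : ip mu2 Q f p ^+ 2 <= (\sum_(l <- F) fourier_sq f l) * ip mu2 Q p p.
  rewrite pp fp; apply: quadratic_form_CS => x y.
  rewrite !mulr_sumr -!big_split/=; apply: sumr_ge0 => l _.
  pose a := ip mu2 Q f (tcos l); pose b := ip mu2 Q f (tsin l).
  pose a' := ip mu2 Q p (tcos l); pose b' := ip mu2 Q p (tsin l).
  rewrite -[fourier_sq f l]/(a ^+ 2 + b ^+ 2) -/a -/b -/a' -/b'.
  have -> : x ^+ 2 * (a ^+ 2 + b ^+ 2) + 2 * (x * y) * (a * a' + b * b')
      + y ^+ 2 * (a' * a' + b' * b')
      = (x * a + y * a') ^+ 2 + (x * b + y * b') ^+ 2 by ring.
  by rewrite addr_ge0 ?sqr_ge0.
have P0 := ip_ge0 mu2 Q p.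
have M0 : 0 <= M by have := FM [::] isT; rewrite big_nil.
have cs2 : ip mu2 Q f p ^+ 2 <= M * ip mu2 Q p p.
  by apply: le_trans cs _; rewrite ler_wpM2r// FM.
have lin : 2 * ip mu2 Q f p <= M + ip mu2 Q p p.
  have h : (2 * ip mu2 Q f p) ^+ 2 <= (M + ip mu2 Q p p) ^+ 2.
    by have := sqr_ge0 (M - ip mu2 Q p p); nra.
  rewrite (le_trans (ler_norm _))// -[leRHS]ger0_norm ?addr_ge0//.
  by rewrite -ler_sqr ?nnegrE// -!normrX !ger0_norm ?sqr_ge0.
by have := pe; rewrite (ip_sqrB mQ sf sp); lra.
Qed.

End trigonometric_polynomials_algebra.

(** * Density of the trigonometric polynomials *)

Section density.
Context {R : realType}.
Notation mu := (@lebesgue_measure R).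
Notation mu2 := (@lebesgue2 R).
Notation Q := (@torus_domain R).
Notation plane := (measurableTypeR R * measurableTypeR R)%type.
Implicit Types (f g p q : R * R -> R) (k : int * int).

Let mQ := @measurable_torus_domain R.
Let Qlty := @lebesgue2_torus_domain_lty R.

(** The squared distance in the mean. *)
Let dist f g := ip mu2 Q (fun x => f x - g x) (fun x => f x - g x).

Let dist_add f f' g g' : sqi mu2 Q f -> sqi mu2 Q f' -> sqi mu2 Q g ->
  sqi mu2 Q g' ->
  dist (fun x => f x + f' x) (fun x => g x + g' x) <= 2 * dist f g + 2 * dist f' g'.
Proof.
move=> sf sf' sg sg'.
pose u x := f x - g x; pose v x := f' x - g' x.
have su : sqi mu2 Q u by exact: (sqiB mQ).
have sv : sqi mu2 Q v by exact: (sqiB mQ).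
have -> : dist (fun x => f x + f' x) (fun x => g x + g' x)
    = ip mu2 Q (fun x => u x + v x) (fun x => u x + v x).
  by congr ip; apply/funext => x; rewrite /u /v; ring.
have := ip_ge0 mu2 Q (fun x => u x - v x).
rewrite (ip_sqrB mQ su sv) (ip_sqrD mQ su sv).
by rewrite -/(dist f g) -/(dist f' g'); lra.
Qed.

Let dist_tri f g p : sqi mu2 Q f -> sqi mu2 Q g -> sqi mu2 Q p ->
  dist f p <= 2 * dist f g + 2 * dist g p.
Proof.
move=> sf sg sp; have := dist_add sf sg sg sp.
have -> // : dist (fun x => f x + g x) (fun x => g x + p x) = dist f p.
by congr ip; apply/funext => x; ring.
Qed.

(** [f] is a limit in the mean of members of [S]. *)
Let approx (S : (R * R -> R) -> Prop) f :=
  forall e : R, 0 < e -> exists2 p, S p & dist f p < e.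

(** Trigonometric polynomials with values in the unit interval. *)
Let S01 p := trigp p /\ forall x, 0 <= p x <= 1.

Let S01_sqi p : S01 p -> sqi mu2 Q p.
Proof. by move=> [tp _]; exact: trigp_sqi. Qed.

Let approx_lim (S : (R * R -> R) -> Prop) f (g : nat -> R * R -> R) :
  (forall p, S p -> sqi mu2 Q p) -> sqi mu2 Q f -> (forall n, sqi mu2 Q (g n)) ->
  (forall n, approx S (g n)) -> dist f (g n) @[n --> \oo] --> 0 -> approx S f.
Proof.
move=> Ss sf sg Sg fg e e0.
have e4 : 0 < e / 4 by rewrite divr_gt0.
have [n _ Hn] := cvgr_lt _ fg _ e4.
have {}Hn := Hn n (leqnn n).
have [p Sp gp] := Sg n _ e4; exists p => //.
have := dist_tri sf (sg n) (Ss _ Sp); rewrite /= in Hn; lra.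
Qed.

Let sqi_indic (A : set plane) : measurable A -> sqi mu2 Q (\1_A : R * R -> R).
Proof.
move=> mA; apply: (@sqi_bounded _ _ _ mu2 Q mQ Qlty _ 1).
  by apply: measurable_funTS; exact: measurable_indic.
by move=> x _; rewrite indicE normr_nat lern1 leq_b1.
Qed.

(** Measurable sets whose indicator is a limit of such polynomials.  They form
    a sigma-algebra, as products of such polynomials are of the same kind. *)
Let good (A : set plane) := measurable A /\ approx S01 (\1_A : R * R -> R).

Let good_ext_ae (A : set plane) g : measurable A -> S01 g ->
  (forall x, Q x -> \1_A x = g x) -> good A.
Proof.
move=> mA Sg Ag; split => // e e0; exists g => //.
rewrite /dist /ip (_ : Rintegral _ _ _ = \int[mu2]_(x in Q) (cst 0 x)).
  by rewrite (Rintegral_cst _ mQ) mul0r.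
by apply: eq_Rintegral => x; rewrite inE => /Ag ->; rewrite subrr mulr0.
Qed.

Let S01_cst (b : bool) : S01 (fun=> b%:R).
Proof. by split; [exact: trigp_cst|move=> x; rewrite ler0n lern1 leq_b1]. Qed.

Let good0 : good set0.
Proof.
apply: good_ext_ae (S01_cst false) _ => //.
by move=> x _; rewrite indicE in_set0.
Qed.

Let goodC A : good A -> good (~` A).
Proof.
move=> [mA Aa]; split; first exact: measurableC.
move=> e /Aa[p [tp p01] pe]; exists (fun x => 1 - p x).
  split; first by apply: trigp_sub => //; exact: trigp_cst.
  by move=> x; have /andP[p0 p1] := p01 x; rewrite subr_ge0 p1 gerBl p0.
apply: le_lt_trans pe; rewrite le_eqVlt; apply/orP; left; apply/eqP.
apply: eq_Rintegral => x _.
have -> : \1_(~` A) x = 1 - \1_A x :> R.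
  by rewrite !indicE in_setC; case: (x \in A); rewrite /= ?subrr ?subr0.
by ring.
Qed.

Let goodI A B : good A -> good B -> good (A `&` B).
Proof.
move=> [mA Aa] [mB Ba]; split; first exact: measurableI.
move=> e e0; have e4 : 0 < e / 4 by rewrite divr_gt0.
have [p [tp p01] pe] := Aa _ e4; have [q [tq q01] qe] := Ba _ e4.
exists (fun x => p x * q x).
  split; first exact: trigp_mul.
  move=> x; have /andP[p0 p1] := p01 x; have /andP[q0 q1] := q01 x.
  by rewrite mulr_ge0// mulr_ile1.
have sp := trigp_sqi tp; have sq := trigp_sqi tq.
have sA := sqi_indic mA; have sB := sqi_indic mB.
have spq := trigp_sqi (trigp_mul tp tq).
have sAB := sqi_indic (measurableI _ _ mA mB).
pose u x : R := \1_A x - p x; pose v x : R := \1_B x - q x.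
have su : sqi mu2 Q u by exact: (sqiB mQ).
have sv : sqi mu2 Q v by exact: (sqiB mQ).
apply: (@le_lt_trans _ _ (2 * ip mu2 Q u u + 2 * ip mu2 Q v v)); last first.
  by rewrite -/(dist _ p) -/(dist _ q); lra.
have iu := sqi_mul mQ su su; have iv := sqi_mul mQ sv sv.
rewrite /ip -!RintegralZl// -RintegralD//; try exact: (rI_Z mQ).
apply: le_Rintegral => //.
- by apply: (sqi_mul mQ); exact: (sqiB mQ).
- by apply: (rI_D mQ); exact: (rI_Z mQ).
- move=> x _.
  have -> : \1_(A `&` B) x = \1_A x * \1_B x :> R.
    by rewrite !indicE in_setI; case: (x \in A); rewrite /= ?mul1r ?mul0r.
  have /andP[p0 p1] := p01 x; have /andP[q0 q1] := q01 x.
  have a01 : 0 <= (\1_B x : R) <= 1 by rewrite indicE ler0n lern1 leq_b1.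
  move: a01 => /andP[b0 b1]; rewrite /u /v.
  move: (\1_A x : R) (\1_B x : R) (p x) (q x) b0 b1 p0 p1 q0 q1 => a b c e'.
  move=> b0 b1 c0 c1 d0 d1.
  have -> : a * b - c * e' = b * (a - c) + c * (b - e') by ring.
  set s := a - c; set t := b - e'.
  have h1 : (b * s + c * t) * (b * s + c * t)
      <= 2 * (b ^+ 2 * (s * s)) + 2 * (c ^+ 2 * (t * t)).
    by have := sqr_ge0 (b * s - c * t); nra.
  have h2 : b ^+ 2 * (s * s) <= s * s.
    by rewrite ler_piMl -?expr2 ?sqr_ge0// exprn_ile1.
  have h3 : c ^+ 2 * (t * t) <= t * t.
    by rewrite ler_piMl -?expr2 ?sqr_ge0// exprn_ile1.
  lra.
Qed.

Let goodU A B : good A -> good B -> good (A `|` B).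
Proof.
move=> gA gB; rewrite -[A `|` B]setCK setCU.
by apply: goodC; apply: goodI; exact: goodC.
Qed.

Let good_bigcup (A : nat -> set plane) : (forall n, good (A n)) ->
  good (\bigcup_n A n).
Proof.
move=> gA; have mU : measurable (\bigcup_n A n).
  by apply: bigcup_measurable => n _; have [] := gA n.
split => //.
pose B n := \big[setU/set0]_(i < n) A i.
have gB n : good (B n).
  rewrite /B; elim: n => [|n IH]; first by rewrite big_ord0.
  by rewrite big_ord_recr; exact: goodU.
have mB n : measurable (B n) by have [] := gB n.
apply: (@approx_lim S01 _ (fun n => \1_(B n) : R * R -> R)) => //.
- exact: sqi_indic.
- by move=> n; exact: sqi_indic.
- by move=> n; have [] := gB n.
apply: (@ip_dominated _ _ _ mu2 Q mQ _ _ (fun=> 1)).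
- by move=> n; apply: measurable_funTS; exact: measurable_indic.
- by apply: measurable_funTS; exact: measurable_indic.
- by have [tp _] := S01_cst true; exact: trigp_sqi.
- apply: aeW => x _; have [[k _ Ak]|nA] := pselect ((\bigcup_n A n) x).
    apply: cvgn_near_eq (@cvgn_cst R _); exists k.+1 => // n /= kn.
    rewrite !indicE mem_set ?mem_set//; first by exists k.
    by rewrite /B -bigcup_mkord; exists k.
  apply: cvgn_eq (@cvgn_cst R _) => n.
  rewrite !indicE memNset ?memNset//.
  by rewrite /B -bigcup_mkord => -[k _ Ak]; apply: nA; exists k.
- by move=> n x _; rewrite indicE normr_nat lern1 leq_b1.
- by move=> x _; rewrite indicE normr_nat lern1 leq_b1.
Qed.

Let good_sigma : sigma_algebra setT good.
Proof.
split; [exact: good0|move=> A gA|exact: good_bigcup].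
by rewrite setTD; exact: goodC.
Qed.

Lemma bernoulli_le (u : R) n : -1 <= u -> 1 + n%:R * u <= (1 + u) ^+ n.
Proof.
move=> u1; elim: n => [|n IH]; first by rewrite mul0r addr0 expr0.
rewrite exprS; apply: (@le_trans _ _ ((1 + u) * (1 + n%:R * u))).
  rewrite -natr1 mulrDl mul1r; have : 0 <= n%:R * u ^+ 2.
    by rewrite mulr_ge0// sqr_ge0.
  by nra.
by rewrite ler_wpM2l//; lra.
Qed.

(** The polynomials [(1 - y ^ n) ^ (2 ^ n)] converge on the unit interval to
    the indicator of [y < 1 / 2], except at [1 / 2]. *)
Lemma cvg_bernstein_indic (y : R) : 0 <= y <= 1 -> y != 2^-1 ->
  (1 - y ^+ n) ^+ (2 ^ n) @[n --> \oo] --> ((y < 2^-1)%R%:R : R).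
Proof.
move=> /andP[y0 y1] yn.
have yn1 n : 0 <= 1 - y ^+ n <= 1.
  by rewrite subr_ge0 exprn_ile1//= gerBl exprn_ge0.
have le1 n : (1 - y ^+ n) ^+ (2 ^ n) <= 1.
  by have /andP[a b] := yn1 n; rewrite exprn_ile1.
have ge0 n : 0 <= (1 - y ^+ n) ^+ (2 ^ n).
  by have /andP[a b] := yn1 n; rewrite exprn_ge0.
have [yl|yl] := ltP y 2^-1.
  apply: (@squeeze_cvgr _ _ _ _ (fun n => 1 - (2 * y) ^+ n) (fun=> 1)).
  - apply: nearW => n; rewrite le1 andbT.
    have := @bernoulli_le (- y ^+ n) (2 ^ n); rewrite lerN2 exprn_ile1// => /(_ isT).
    by rewrite natrX mulrN -exprMn.
  - have h : (2 * y) ^+ n @[n --> \oo] --> 0.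
      by apply: cvg_expr; rewrite ger0_norm ?mulr_ge0//; lra.
    by have := cvgnB (@cvgn_cst R 1) h; rewrite subr0.
  - exact: cvgn_cst.
have {yn}yl : 2^-1 < y by rewrite lt_neqAle eq_sym yn.
have y2 : 1 < 2 * y by lra.
apply: (@squeeze_cvgr _ _ _ _ (fun=> 0) (fun n => ((2 * y)^-1) ^+ n)).
- apply: nearW => n; rewrite ge0/=.
  have u0 : 0 <= y ^+ n by rewrite exprn_ge0.
  have b1 := @bernoulli_le (y ^+ n) (2 ^ n).
  have {}b1 : (2 * y) ^+ n <= (1 + y ^+ n) ^+ (2 ^ n).
    rewrite exprMn; apply: le_trans (b1 _); last by lra.
    by rewrite natrX lerDr.
  have p0 : 0 < (2 * y) ^+ n by rewrite exprn_gt0//; lra.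
  rewrite exprVn -[leRHS]mul1r ler_pdivlMr//.
  apply: le_trans (ler_wpM2l (ge0 n) b1) _.
  have /andP[a1 a2] := yn1 n; have u2 := sqr_ge0 (y ^+ n).
  rewrite -exprMn exprn_ile1//; first by rewrite mulr_ge0//; lra.
  by rewrite (_ : (1 - y ^+ n) * (1 + y ^+ n) = 1 - (y ^+ n) ^+ 2); [lra|ring].
- exact: cvgn_cst.
- by apply: cvg_expr; rewrite ger0_norm ?invr_ge0 ?invf_lt1//; lra.
Qed.

(** A half-plane [c < a], where [c] is a coordinate, is good.  If [0 < a <= 1],
    its points with [0 < c < 1] are those at which the trigonometric polynomial
    [y] below is less than [1 / 2], and the polynomials of
    [cvg_bernstein_indic] turn [y] into an indicator. *)
Let good_half (c : plane -> R) k (a : R) :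
  (forall x, phase k x = 2 * pi * c x) -> measurable_fun setT c ->
  (forall x, Q x -> 0 <= c x <= 1) ->
  (forall r, mu2 (c @^-1` [set r]) = 0%E) ->
  good (c @^-1` `]-oo, a[).
Proof.
move=> kc mc c01 cnull.
have mA : measurable (c @^-1` `]-oo, a[ : set plane).
  by rewrite -[X in measurable X]setTI; apply: mc => //; exact: measurable_itv.
have inA x : (\1_(c @^-1` `]-oo, a[) x : R) = (c x < a)%R%:R.
  rewrite indicE (_ : (x \in _) = (c x < a))//.
  by apply/idP/idP; rewrite inE /= in_itv.
have [a0|a0] := leP a 0.
  apply: good_ext_ae (S01_cst false) _ => // x /c01/andP[c0 _].
  by rewrite inA ltNge (le_trans a0 c0).
have [a1|a1] := ltP 1 a.
  apply: good_ext_ae (S01_cst true) _ => // x /c01/andP[_ c1].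
  by rewrite inA (le_lt_trans c1 a1).
pose y (x : R * R) := 2^-1 + 4^-1 * (cos (pi * a)
   - (cos (pi * a) * ((@cos R) \o phase k) x
      + sin (pi * a) * ((@sin R) \o phase k) x)).
have ty : trigp y.
  apply: trigp_add; first exact: trigp_cst.
  apply: trigp_scale; apply: trigp_sub; first exact: trigp_cst.
  by apply: trigp_add; apply: trigp_scale; [exact: trigp_cos|exact: trigp_sin].
have yE x : y x = 2^-1 + 2^-1 * (sin (pi * c x) * sin (pi * (c x - a))).
  rewrite /y /= kc; set s := pi * c x; set t := pi * (c x - a).
  have -> : pi * a = s - t by rewrite /s /t; ring.
  have -> : 2 * pi * c x = s + s by rewrite /s; ring.
  rewrite cosB sinB cosD sinD.
  have := cos2Dsin2 s; have := cos2Dsin2 t.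
  move: (cos s) (sin s) (cos t) (sin t) => cs ss ct st h1 h2.
  have -> : (cs * ct + ss * st) * (cs * cs - ss * ss)
     + (ss * ct - cs * st) * (ss * cs + cs * ss)
     = (cs ^+ 2 + ss ^+ 2) * (cs * ct - ss * st) by ring.
  by rewrite h2; field.
have y01 x : 0 <= y x <= 1.
  have : `|sin (pi * c x) * sin (pi * (c x - a))| <= 1.
    by rewrite normrM mulr_ile1// ler_norml sin_geN1 sin_le1.
  rewrite ler_norml yE => /andP[h1 h2]; apply/andP; split; lra.
split => //; apply: (@approx_lim S01 _ (fun n x => (1 - y x ^+ n) ^+ (2 ^ n))).
- exact: S01_sqi.
- exact: sqi_indic.
- move=> n; apply: trigp_sqi; apply: trigp_exp; apply: trigp_sub.
    exact: trigp_cst.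
  exact: trigp_exp.
- move=> n e e0; exists (fun x => (1 - y x ^+ n) ^+ (2 ^ n)).
    split.
      apply: trigp_exp; apply: trigp_sub; first exact: trigp_cst.
      exact: trigp_exp.
    move=> x; have /andP[h0 h1] := y01 x.
    rewrite exprn_ge0 ?exprn_ile1//= ?subr_ge0 ?exprn_ile1//.
    by rewrite gerBl exprn_ge0.
  rewrite /dist /ip (_ : Rintegral _ _ _ = \int[mu2]_(x in Q) (cst 0 x)).
    by rewrite (Rintegral_cst _ mQ) mul0r.
  by apply: eq_Rintegral => x _; rewrite subrr mulr0.
apply: (@ip_dominated _ _ _ mu2 Q mQ _ _ (fun=> 1)).
- move=> n; apply: measurable_funTS; apply: trigp_measurable.
  by apply: trigp_exp; apply: trigp_sub; [exact: trigp_cst|exact: trigp_exp].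
- by apply: measurable_funTS; exact: measurable_indic.
- by have [tp _] := S01_cst true; exact: trigp_sqi.
- have ne r : {ae mu2, forall x, c x <> r}.
    exists (c @^-1` [set r]); split => //.
      rewrite -[X in measurable X]setTI; apply: mc => //; exact: measurable_set1.
    by move=> x /= /contrapT.
  apply: filterS3 (ne 0) (ne 1) (ne a) => x x0 x1 xa Qx.
  have /andP[c0 c1] := c01 x Qx.
  have {x0}c0 : 0 < c x by rewrite lt_neqAle c0 andbT eq_sym; exact/eqP.
  have {x1}c1 : c x < 1 by rewrite lt_neqAle c1 andbT; exact/eqP.
  have s0 : 0 < sin (pi * c x).
    by apply: sin_gt0_pi; rewrite mulr_gt0 ?pi_gt0//= gtr_pMr ?pi_gt0.
  have -> : \1_(c @^-1` `]-oo, a[) x = (y x < 2^-1)%R%:R :> R.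
    rewrite inA; suff -> : (c x < a) = (y x < 2^-1) by [].
    rewrite yE gtrDl pmulr_rlt0 ?invr_gt0// pmulr_rlt0//.
    have [ca|ca] := ltP (c x) a.
      apply/esym; rewrite -oppr_gt0 -sinN; apply: sin_gt0_pi.
      rewrite -mulrN opprB mulr_gt0 ?pi_gt0 ?subr_gt0//=.
      by rewrite gtr_pMr ?pi_gt0//; lra.
    have {}ca : a < c x by rewrite lt_neqAle ca andbT eq_sym; exact/eqP.
    apply/esym/negbTE; rewrite -leNgt ltW//; apply: sin_gt0_pi.
    by rewrite mulr_gt0 ?pi_gt0 ?subr_gt0//= gtr_pMr ?pi_gt0//; lra.
  apply: cvg_bernstein_indic => //; rewrite yE.
  rewrite -subr_eq0 addrAC subrr add0r mulf_neq0// mulf_neq0//.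
    by rewrite gt_eqF.
  have [ca|ca] := ltP (c x) a.
    rewrite lt_eqF// -oppr_gt0 -sinN; apply: sin_gt0_pi.
    rewrite -mulrN opprB mulr_gt0 ?pi_gt0 ?subr_gt0//=.
    by rewrite gtr_pMr ?pi_gt0//; lra.
  have {}ca : a < c x by rewrite lt_neqAle ca andbT eq_sym; exact/eqP.
  rewrite gt_eqF//; apply: sin_gt0_pi.
  by rewrite mulr_gt0 ?pi_gt0 ?subr_gt0//= gtr_pMr ?pi_gt0//; lra.
- move=> n x _; have /andP[h0 h1] := y01 x.
  rewrite ger0_norm ?exprn_ile1 ?exprn_ge0//= ?subr_ge0 ?exprn_ile1//.
  by rewrite gerBl exprn_ge0.
- by move=> x _; rewrite indicE normr_nat lern1 leq_b1.
Qed.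

(** The rays unbounded below generate the Borel sets of the line, and the
    preimages of Borel sets under the coordinates generate those of the
    plane. *)
Let good_preimage (c : plane -> R) : (forall a, good (c @^-1` `]-oo, a[)) ->
  forall B : set (measurableTypeR R), measurable B -> good (c @^-1` B).
Proof.
move=> cg B; rewrite RGenInftyO.measurableE.
move: B; apply: smallest_sub.
  split => [|A|A gA].
  - by rewrite /= preimage_set0; exact: good0.
  - by rewrite /= setTD preimage_setC; exact: goodC.
  - by rewrite /= preimage_bigcup; exact: good_bigcup.
by move=> A [a ->]; exact: cg.
Qed.

Let good_fst (B : set (measurableTypeR R)) : measurable B ->
  good ((fst : plane -> R) @^-1` B).
Proof.
apply: good_preimage => a; apply: (@good_half fst (1, 0)).
- by move=> x; rewrite /phase/=; ring.
- exact: measurable_fst.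
- by move=> x [/= + _]; rewrite in_itv.
- move=> r; have -> : (fst : plane -> R) @^-1` [set r] = [set r] `*` setT.
    by apply/seteqP; split => x //= [].
  transitivity (mu [set r] * mu setT)%E.
    by apply: product_measure1E => //; exact: measurable_set1.
  by rewrite lebesgue_measure_set1 mul0e.
Qed.

Let good_snd (B : set (measurableTypeR R)) : measurable B ->
  good ((snd : plane -> R) @^-1` B).
Proof.
apply: good_preimage => a; apply: (@good_half snd (0, 1)).
- by move=> x; rewrite /phase/=; ring.
- exact: measurable_snd.
- by move=> x [/= _ +]; rewrite in_itv.
- move=> r; have -> : (snd : plane -> R) @^-1` [set r] = setT `*` [set r].
    by apply/seteqP; split => x //= [].
  transitivity (mu setT * mu [set r])%E.
    by apply: product_measure1E => //; exact: measurable_set1.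
  by rewrite lebesgue_measure_set1 mule0.
Qed.

Let good_measurable (A : set plane) : measurable A -> good A.
Proof.
rewrite measurable_prod_measurableType; move: A; apply: smallest_sub.
  exact: good_sigma.
move=> _ [A mA [B mB <-]].
have -> : A `*` B = ((fst : plane -> R) @^-1` A) `&` ((snd : plane -> R) @^-1` B).
  by apply/seteqP; split => x [].
by apply: goodI; [exact: good_fst|exact: good_snd].
Qed.

Let approxD f g : sqi mu2 Q f -> sqi mu2 Q g -> approx trigp f ->
  approx trigp g -> approx trigp (fun x => f x + g x).
Proof.
move=> sf sg fa ga e e0; have e4 : 0 < e / 4 by rewrite divr_gt0.
have [p tp pe] := fa _ e4; have [q tq qe] := ga _ e4.
exists (fun x => p x + q x); first exact: trigp_add.
have := dist_add sf sg (trigp_sqi tp) (trigp_sqi tq); lra.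
Qed.

Let approxZ c f : sqi mu2 Q f -> approx trigp f -> approx trigp (fun x => c * f x).
Proof.
move=> sf fa e e0; have c0 : 0 < c ^+ 2 + 1 by rewrite ltr_wpDl// sqr_ge0.
have [p tp pe] := fa (e / (c ^+ 2 + 1)) (divr_gt0 e0 c0).
exists (fun x => c * p x); first exact: trigp_scale.
have sfp : sqi mu2 Q (fun x => f x - p x) by apply: (sqiB mQ) => //; exact: trigp_sqi.
have -> : dist (fun x => c * f x) (fun x => c * p x) = c ^+ 2 * dist f p.
  transitivity (ip mu2 Q (fun x => c * (f x - p x)) (fun x => c * (f x - p x))).
    by congr ip; apply/funext => x; rewrite mulrBr.
  by rewrite (ipZl mQ)// ?(ipZr mQ)//; [rewrite mulrA -expr2|exact: (sqiZ mQ)].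
move: pe; rewrite ltr_pdivlMr// => pe; apply: le_lt_trans pe.
by rewrite mulrC ler_wpM2l ?ip_ge0// lerDl.
Qed.

Import HBNNSimple.

(** Approximation passes from indicators to simple functions, then to
    nonnegative square integrable functions by monotone limits. *)
Let approx_nnsfun (h : {nnsfun plane >-> R}) : sqi mu2 Q h /\ approx trigp h.
Proof.
have -> : (h : plane -> R) = (fun x => \sum_(r <- finmap.enum_fset (fset_set (range h)))
    r * \1_(h @^-1` [set r]) x).
  by apply/funext => x; rewrite fimfunE fsbig_finite.
elim: (finmap.enum_fset (fset_set (range h))) => /= [|r s [IH1 IH2]].
  have -> : (fun x : plane => \sum_(r <- [::]) r * \1_(h @^-1` [set r]) x)
      = (fun=> 0 : R) by apply/funext => x; rewrite big_nil.
  split; first exact: (trigp_sqi (trigp_cst 0)).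
  move=> e e0; exists (fun=> 0); first exact: trigp_cst.
  rewrite /dist /ip (_ : Rintegral _ _ _ = \int[mu2]_(x in Q) (cst 0 x)).
    by rewrite (Rintegral_cst _ mQ) mul0r.
  by apply: eq_Rintegral => x _; rewrite subrr mulr0.
have -> : (fun x : plane => \sum_(q <- r :: s) q * \1_(h @^-1` [set q]) x)
    = (fun x => r * \1_(h @^-1` [set r]) x + \sum_(q <- s) q * \1_(h @^-1` [set q]) x : R).
  by apply/funext => x; rewrite big_cons.
have mr : measurable (h @^-1` [set r]) by exact: measurable_funPTI.
have s1 := sqi_indic mr.
have a1 : approx trigp (\1_(h @^-1` [set r])).
  have [_ ga] := good_measurable mr.
  by move=> e /ga[p [tp _] pe]; exists p.
split; first by apply: (sqiD mQ) => //; exact: (sqiZ mQ).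
by apply: approxD => //; [exact: (sqiZ mQ)|exact: approxZ].
Qed.

Let approx_ge0 f : sqi mu2 Q f -> (forall x, 0 <= f x) -> approx trigp f.
Proof.
move=> sf f0; have [mf _] := sf.
have mEf : measurable_fun Q (EFin \o f : plane -> \bar R) by exact/measurable_EFinP.
pose h n := nnsfun_approx mQ mEf n.
have hcvg x : Q x -> h n x @[n --> \oo] --> f x.
  move=> Qx; have := @cvg_nnsfun_approx _ plane R Q mQ _ mEf
    (fun x _ => f0 x) x Qx.
  by move=> /fine_cvg.
have hle n x : Q x -> h n x <= f x.
  move=> Qx; have nd : nondecreasing_seq (fun n => h n x).
    move=> i j ij; have := @nd_nnsfun_approx _ plane R Q mQ _ mEf i j ij.
    by move=> /lefP; exact.
  rewrite -(cvg_lim (@Rhausdorff R) (hcvg x Qx)).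
  by apply: nondecreasing_cvgn_le nd _ n; apply/cvg_ex; exists (f x); exact: hcvg.
apply: (@approx_lim trigp _ (fun n => h n)) => //.
- by move=> p; exact: trigp_sqi.
- by move=> n; have [] := approx_nnsfun (h n).
- by move=> n; have [] := approx_nnsfun (h n).
apply: (@ip_dominated _ _ _ mu2 Q mQ _ _ f) => //.
- by move=> n; have [[]] := approx_nnsfun (h n).
- by apply: aeW => x; exact: hcvg.
- by move=> n x Qx; rewrite ger0_norm// hle.
- by move=> x Qx; rewrite ger0_norm.
Qed.

(** Trigonometric polynomials are dense in the square integrable functions on
    the torus. *)
Lemma trigp_dense f : sqi mu2 Q f -> forall e : R, 0 < e ->
  exists2 p, trigp p & ip mu2 Q (fun x => f x - p x) (fun x => f x - p x) < e.
Proof.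
move=> sf; have [mf if2] := sf.
have sabs : sqi mu2 Q (fun x => `|f x|).
  split; first exact: measurableT_comp.
  by move: if2; apply: eq_integrable => // x _ /=; rewrite real_normK ?num_real.
pose a x := `|f x| + f x; pose b x := `|f x| - f x.
have sa : sqi mu2 Q a by exact: (sqiD mQ).
have sb : sqi mu2 Q b by exact: (sqiB mQ).
have a0 x : 0 <= a x by have := ler_norm (- f x); rewrite normrN /a; lra.
have b0 x : 0 <= b x by rewrite subr_ge0 ler_norm.
have : approx trigp (fun x => 2^-1 * a x + (- 2^-1) * b x).
  by apply: approxD; try exact: (sqiZ mQ); apply: approxZ => //; exact: approx_ge0.
have -> // : (fun x => 2^-1 * a x + (- 2^-1) * b x) = f.
by apply/funext => x; rewrite /a /b; field.
Qed.

End density.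

Section parseval.
Context {R : realType}.
Notation mu2 := (@lebesgue2 R).
Notation Q := (@torus_domain R).
Implicit Types f : R * R -> R.

(** The nontrivial half of Parseval's identity. *)
Lemma parseval_le f (M : R) : sqi mu2 Q f ->
  (forall F : seq (int * int), uniq F -> \sum_(l <- F) fourier_sq f l <= M) ->
  ip mu2 Q f f <= M.
Proof.
by move=> sf FM; apply: parseval_le_of_dense => // e e0; exact: trigp_dense.
Qed.

Lemma fourier_sq_ge0 f k : 0 <= fourier_sq f k.
Proof. by rewrite /fourier_sq addr_ge0// sqr_ge0. Qed.

(** The weights of the Sobolev norms of nonnegative order are at least one. *)
Lemma Bnorm_fourier_le (beta c : R) f : 0 <= beta -> 0 <= c ->
  (Bnorm beta f <= c%:E)%E ->
  forall F : seq (int * int), uniq F -> \sum_(l <- F) fourier_sq f l <= c ^+ 2.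
Proof.
move=> beta0 c0; rewrite /Bnorm /sobolev_norm.
set w := fun k : int * int =>
  (1 + (2 * pi) ^+ 2 * (k.1%:~R ^+ 2 + k.2%:~R ^+ 2)) `^ (2 * beta) : R.
have w1 k : 1 <= w k.
  have h : 1 <= 1 + (2 * pi) ^+ 2 * (k.1%:~R ^+ 2 + k.2%:~R ^+ 2) :> R.
    by rewrite lerDl mulr_ge0 ?addr_ge0 ?sqr_ge0.
  have := ler_powR h (_ : 0 <= 2 * beta); rewrite powRr0; apply.
  by rewrite mulr_ge0.
set E := esum _ _ => EC F uF.
have E0 : (0 <= E)%E.
  apply: esum_ge0 => k _; rewrite lee_fin mulr_ge0 ?fourier_sq_ge0//.
  by rewrite (le_trans _ (w1 k)).
have E_le : (E <= (c ^+ 2)%:E)%E.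
  move: E0 EC; case: E => [r| |]//.
  - rewrite /= !lee_fin => r0; rewrite powR12_sqrt// => rc.
    by rewrite -(sqr_sqrtr r0) ler_pXn2r ?nnegrE ?sqrtr_ge0.
  - by move=> _; rewrite poweRyr ?invr_eq0//.
suff: ((\sum_(l <- F) fourier_sq f l)%:E <= (c ^+ 2)%:E)%E by rewrite lee_fin.
apply: (le_trans _ E_le).
apply: (@le_trans _ _ (\sum_(l <- F) (w l * fourier_sq f l)%:E)%E).
  rewrite sumEFin lee_fin; apply: ler_sum => l _.
  by rewrite ler_peMl ?fourier_sq_ge0.
apply: esum_ge; exists [set` F]; first by split => //; exact: finite_seq.
by rewrite fsbig_seq.
Qed.

End parseval.

(** * The Biot-Savart law on the Fourier side *)

Section trigonometric_smooth.
Context {R : realType}.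
Implicit Types (k : int * int) (a b : R).
Notation tcos k := ((@cos R) \o (@phase R k)).
Notation tsin k := ((@sin R) \o (@phase R k)).

(** A directional derivative computed along the line. *)
Lemma is_derive_line (f : R * R -> R) (g : R -> R) (x v : R * R) (dg : R) :
  (forall s, f (s *: v + x) = g s) -> is_derive (0 : R) 1 g dg ->
  is_derive x v f dg.
Proof.
move=> fg [dvg eg].
have E : (fun s : R => s^-1 *: ((f \o shift x) (s *: v) - f x))
    = (fun s : R => s^-1 *: ((g \o shift 0) (s *: (1 : R)) - g 0)).
  apply/funext => s /=; rewrite -(fg 0) scale0r add0r fg.
  by rewrite addr0 [s *: (1 : R)]mulr1.
split; first by rewrite /derivable E.
by rewrite -eg /derive E.
Qed.

(** The real trigonometric functions of frequency [k], a family stable under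
    partial derivatives. *)
Definition trig k a b : R * R -> R := fun x => a * tcos k x + b * tsin k x.

Lemma is_derive_trig k a b (x v : R * R) :
  is_derive x v (trig k a b) (trig k (phase k v * b) (- (phase k v * a)) x).
Proof.
set p := phase k v; set q := phase k x.
pose y (s : R) : R := q + s * p.
apply: (@is_derive_line _ (fun s => a * cos (y s) + b * sin (y s))).
  by move=> s; rewrite /trig/= /y /q /p /phase/= /GRing.scale/=; congr (_ * cos _ + _ * sin _); ring.
have dy' : is_derive (0 : R) 1 y p.
  by rewrite /y; apply: is_derive_eq; rewrite /GRing.scale/=; ring.
have y0 : y 0 = q by rewrite /y mul0r addr0.
have dc := @is_derive1_comp R cos y 0 _ _ (is_derive_cos _) dy'.
have ds := @is_derive1_comp R sin y 0 _ _ (is_derive_sin _) dy'.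
have H := is_deriveD (is_deriveZ a dc) (is_deriveZ b ds).
apply: is_derive_eq H _.
by rewrite y0 /trig/= -/q /GRing.scale/=; ring.
Qed.

Lemma partial1_trig k a b : partial1 (trig k a b)
  = trig k (2 * pi * k.1%:~R * b) (- (2 * pi * k.1%:~R * a)).
Proof.
apply/funext => x; rewrite /partial1 (@derive_val _ _ _ _ _ _ _ (is_derive_trig k a b x (1, 0))).
by rewrite /phase/= mulr1 mulr0 addr0.
Qed.

Lemma partial2_trig k a b : partial2 (trig k a b)
  = trig k (2 * pi * k.2%:~R * b) (- (2 * pi * k.2%:~R * a)).
Proof.
apply/funext => x; rewrite /partial2 (@derive_val _ _ _ _ _ _ _ (is_derive_trig k a b x (0, 1))).
by rewrite /phase/= mulr1 mulr0 add0r.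
Qed.

Lemma continuous_trig k a b : continuous (trig k a b).
Proof.
have cp : continuous (@phase R k).
  move=> x; apply: cvgM; first exact: cvg_cst.
  apply: cvgD; apply: cvgM; try exact: cvg_cst; [exact: cvg_fst|exact: cvg_snd].
move=> x; apply: cvgD; apply: cvgM; try exact: cvg_cst.
  by apply: (@continuous_comp _ _ _ (phase k) cos); [exact: cp|exact: continuous_cos].
by apply: (@continuous_comp _ _ _ (phase k) sin); [exact: cp|exact: continuous_sin].
Qed.

Lemma trig_smooth k a b : torus_smooth (trig k a b).
Proof.
split=> [x|n].
  have P1 : phase k (x.1 + 1, x.2) = phase k x + 2 * pi * k.1%:~R :> R.
    by rewrite /phase/=; ring.
  have P2 : phase k (x.1, x.2 + 1) = phase k x + 2 * pi * k.2%:~R :> R.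
    by rewrite /phase/=; ring.
  have [c1 s1] := @cos_sin_2pi_int R k.1; have [c2 s2] := @cos_sin_2pi_int R k.2.
  by rewrite /trig/= P1 P2 !cosD !sinD c1 s1 c2 s2 !mulr1 !mulr0 !subr0 !addr0.
elim: n a b => [|n IH] a b /=; first exact: continuous_trig.
split; [exact: continuous_trig| | | |].
- by move=> x; have [] := is_derive_trig k a b x (1, 0).
- by move=> x; have [] := is_derive_trig k a b x (0, 1).
- by rewrite partial1_trig; exact: IH.
- by rewrite partial2_trig; exact: IH.
Qed.

Lemma trig_cos k : trig k 1 0 = tcos k.
Proof. by apply/funext => x; rewrite /trig mul1r mul0r addr0. Qed.

Lemma trig_sin k : trig k 0 1 = tsin k.
Proof. by apply/funext => x; rewrite /trig mul1r mul0r add0r. Qed.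

End trigonometric_smooth.

Section biot_savart_energy.
Context {R : realType}.
Notation mu2 := (@lebesgue2 R).
Notation Q := (@torus_domain R).
Implicit Types (f w : R * R -> R) (v : R * R -> R * R) (k : int * int).
Let mQ := @measurable_torus_domain R.

Lemma L2_sqi f : L2 f -> sqi mu2 Q f.
Proof. by move=> [_ ? ?]; split. Qed.

Lemma inner_trig f k (a b : R) : sqi mu2 Q f ->
  inner f (trig k a b) = a * inner f (cos \o phase k) + b * inner f (sin \o phase k).
Proof.
move=> sf; have sc := trigp_sqi (@trigp_cos R k).
have ss := trigp_sqi (@trigp_sin R k).
transitivity (ip mu2 Q f (trig k a b)) => //.
rewrite /trig (ipDr mQ)//; try exact: (sqiZ mQ).
by rewrite !(ipZr mQ).
Qed.

(** At frequency [k] the velocity is [2 pi |k|] times smaller than the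
    vorticity, hence smaller unless [k = 0]; its zero mode vanishes. *)
Lemma biot_savart_fourier_le w v k : biot_savart w v ->
  fourier_sq (fst \o v) k + fourier_sq (snd \o v) k <= fourier_sq w k.
Proof.
move=> [/L2_sqi s1 /L2_sqi s2 [m1 m2] dv cw]; rewrite /fourier_sq.
have cosk := @trig_cos R k; have sink := @trig_sin R k.
have := dv _ (trig_smooth k 1 0); have := dv _ (trig_smooth k 0 1).
have := cw _ (trig_smooth k 1 0); have := cw _ (trig_smooth k 0 1).
rewrite !partial1_trig !partial2_trig !cosk !sink !inner_trig//.
have [->|k0] := eqVneq k (0, 0).
  move=> _ _ _ _.
  have -> : (@cos R) \o phase (0, 0) = cst 1.
    by apply/funext => x /=; rewrite phase0 cos0.
  have s0 f : inner f (sin \o phase (0, 0)) = 0.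
    rewrite /inner (_ : Rintegral _ _ _ = \int[mu2]_(x in Q) (cst 0 x)).
      by rewrite (Rintegral_cst _ mQ) mul0r.
    by apply: eq_Rintegral => x _; rewrite /= phase0 sin0 mulr0.
  by rewrite m1 m2 !s0 expr0n/= !addr0 sqr_ge0.
set a := 2 * pi * k.1%:~R; set b := 2 * pi * k.2%:~R.
have ab : 1 <= a ^+ 2 + b ^+ 2.
  have -> : a ^+ 2 + b ^+ 2 = (2 * pi) ^+ 2 * (k.1 ^+ 2 + k.2 ^+ 2)%:~R.
    by rewrite /a /b rmorphD !rmorphXn/=; ring.
  have p1 : 1 <= (2 * pi : R) ^+ 2.
    by rewrite -[leLHS](expr1n _ 2) ler_pXn2r ?nnegrE ?mulr_ge0 ?pi_ge0//; have := @pi_ge2 R; lra.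
  rewrite mulr_ege1// ler1z -gtz0_ge1 lt_neqAle addr_ge0 ?sqr_ge0// andbT eq_sym.
  rewrite paddr_eq0 ?sqr_ge0// !sqrf_eq0; apply: contra k0.
  by case: (k) => i j /= /andP[/eqP -> /eqP ->].
move: (inner (fst \o v) (cos \o _)) (inner (fst \o v) (sin \o _)) => c1 t1.
move: (inner (snd \o v) (cos \o _)) (inner (snd \o v) (sin \o _)) => c2 t2.
rewrite !mulr0 !mulr1 oppr0 !mul0r !addr0 !add0r.
move=> <- <- d1 d2.
(* the divergence equations d1 and d2 turn the inequality into the one for the
   squared lengths of the Fourier coefficients *)
have -> : (- b * t1 - - a * t2) ^+ 2 + (b * c1 - a * c2) ^+ 2
    = (a ^+ 2 + b ^+ 2) * (c1 ^+ 2 + t1 ^+ 2 + (c2 ^+ 2 + t2 ^+ 2))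
      - (a * c1 + b * c2) ^+ 2 - (- a * t1 + - b * t2) ^+ 2 by ring.
by rewrite d1 d2 expr0n/= !subr0 ler_peMl// !addr_ge0 ?sqr_ge0.
Qed.

End biot_savart_energy.

(** * Continuous functions on the torus *)

Section continuous_functions.
Context {R : realType}.
Notation mu2 := (@lebesgue2 R).
Notation Q := (@torus_domain R).
Notation plane := (measurableTypeR R * measurableTypeR R)%type.

(** An open set is a countable union of squares with rational centre and
    radius [1 / (n + 1)], hence measurable for the product sigma-algebra. *)
Lemma open_plane_measurable (A : set (R * R)) : open A ->
  measurable (A : set plane).
Proof.
move=> oA.
pose box (i : rat * rat * nat) : set (R * R) :=
  ball (ratr i.1.1 : R) i.2.+1%:R^-1 `*` ball (ratr i.1.2 : R) i.2.+1%:R^-1.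
have -> : A = \bigcup_i (if `[< box i `<=` A >] then box i else set0).
  apply/seteqP; split => [x Ax|x [i _]]; last first.
    by case: ifPn => // /asboolP; apply.
  have /nbhs_ballP[e /= e0 eA] := open_nbhs_nbhs (conj oA Ax).
  have [n ne] : exists n : nat, n.+1%:R^-1 < e / 2 :> R.
    have e2 : 0 < e / 2 by rewrite divr_gt0.
    have [n _ /(_ n (leqnn n)) h] := near_infty_natSinv_lt (PosNum e2).
    by exists n.
  have rd y : exists q : rat, `|y - ratr q| < n.+1%:R^-1 :> R.
    have : y - n.+1%:R^-1 < y + n.+1%:R^-1 by rewrite ltrBlDr -addrA ltrDl addr_gt0.
    by move=> /rat_in_itvoo[q]; rewrite in_itv/= => qy; exists q; rewrite ltr_distlC.
  have [p hp] := rd x.1; have [q hq] := rd x.2.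
  exists (p, q, n) => //; rewrite ifT; last first.
    have lt_e (a b : R) : a < n.+1%:R^-1 -> b < n.+1%:R^-1 -> a + b < e.
      by move=> an bn; rewrite (splitr e) ltrD//; exact: lt_trans ne.
    apply/asboolP => y [/=]; rewrite /ball/= => y1 y2; apply: eA; split => /=.
      by apply: le_lt_trans (ler_distD (ratr p) x.1 y.1) _; exact: lt_e.
    by apply: le_lt_trans (ler_distD (ratr q) x.2 y.2) _; exact: lt_e.
  by split; rewrite /= /ball/= distrC.
apply: countable_bigcupT_measurable => [|i]; first exact: countableP.
case: ifPn => // _; apply: measurableX; exact: measurable_ball.
Qed.

Lemma continuous_plane_measurable (f : R * R -> R) : continuous f ->
  measurable_fun setT (f : plane -> R).
Proof.
move=> /continuousP cf; apply: (measurability _ (RGenOpens.measurableE R)).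
move=> _ [_ [a [b ->] <-]]; rewrite setTI; apply: open_plane_measurable.
exact/cf/interval_open.
Qed.

Lemma continuous_torus_bounded (f : R * R -> R) : continuous f ->
  exists2 C : R, 0 <= C & forall x, Q x -> `|f x| <= C.
Proof.
move=> cf.
have cQ : compact Q by apply: compact_setX; exact: segment_compact.
have Q0 : Q !=set0 by exists (0, 0); split; rewrite /= in_itv/= lexx ler01.
have [c _ Hc] := compact_EVT_max Q0 cQ (continuous_subspaceT
  (fun x => cvg_norm (cf x))).
by exists `|f c| => // x Qx; apply: Hc; rewrite inE.
Qed.

Lemma continuous_sqi f : continuous f -> sqi mu2 Q f.
Proof.
move=> cf; have [C _ HC] := continuous_torus_bounded cf.
apply: (sqi_bounded measurable_torus_domain lebesgue2_torus_domain_lty) HC.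
by apply: measurable_funTS; exact: continuous_plane_measurable.
Qed.

Lemma torus_smooth_continuous f : @torus_smooth R f ->
  [/\ continuous f, continuous (partial1 f), continuous (partial2 f)
    & continuous (laplacian f)].
Proof.
move=> [_ /(_ 2)] /= [cf _ _ [c1 _ _ c11 _] [c2 _ _ _ c22]].
by split => // x; apply: cvgD; [exact: c11|exact: c22].
Qed.

End continuous_functions.

(** * Hoelder continuous paths of square integrable functions *)

Section hoelder_continuity.
Context {R : realType}.
Notation mu2 := (@lebesgue2 R).
Notation Q := (@torus_domain R).
Implicit Types (f p : R * R -> R) (g : R -> R * R -> R) (gamma t : R).
Let mQ := @measurable_torus_domain R.

(** Paths on [[0, t]] with values in the square integrable functions on the
    torus, Hoelder continuous of exponent [gamma] for the norm. *)
Definition hoelder_L2 gamma t g :=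
  (forall s, 0 <= s <= t -> sqi mu2 Q (g s)) /\
  exists2 C : R, 0 <= C & forall r s, 0 <= r <= t -> 0 <= s <= t ->
    ip mu2 Q (fun x => g r x - g s x) (fun x => g r x - g s x)
    <= (C * `|r - s| `^ gamma) ^+ 2.

Lemma ip_le f p (a b : R) : sqi mu2 Q f -> sqi mu2 Q p -> 0 <= a -> 0 <= b ->
  ip mu2 Q f f <= a ^+ 2 -> ip mu2 Q p p <= b ^+ 2 -> `|ip mu2 Q f p| <= a * b.
Proof.
move=> sf sp a0 b0 fa pb.
rewrite -ler_sqr ?nnegrE ?mulr_ge0// real_normK ?num_real// exprMn.
by apply: le_trans (ip_CS mQ sf sp) _; apply: ler_pM => //; exact: ip_ge0.
Qed.

Lemma hoelder_L2_cst gamma t f : continuous f -> hoelder_L2 gamma t (fun=> f).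
Proof.
move=> cf; split=> [s _|]; first exact: continuous_sqi.
exists 0 => // r s _ _; rewrite mul0r expr0n/=.
rewrite /ip (_ : Rintegral _ _ _ = \int[mu2]_(x in Q) (cst 0 x)).
  by rewrite (Rintegral_cst _ mQ) mul0r.
by apply: eq_Rintegral => x _; rewrite subrr mulr0.
Qed.

Lemma hoelder_L2_add gamma t g h : hoelder_L2 gamma t g -> hoelder_L2 gamma t h ->
  hoelder_L2 gamma t (fun s x => g s x + h s x).
Proof.
move=> [sg [C C0 HC]] [sh [D D0 HD]]; split=> [s st|].
  by apply: (sqiD mQ); [exact: sg|exact: sh].
exists (2 * (C + D)) => [|r s rt st]; first by rewrite mulr_ge0 ?addr_ge0.
pose f x := g r x - g s x; pose k x := h r x - h s x.
have sf : sqi mu2 Q f by apply: (sqiB mQ); exact: sg.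
have sk : sqi mu2 Q k by apply: (sqiB mQ); exact: sh.
have -> : (fun x => g r x + h r x - (g s x + h s x)) = (fun x => f x + k x).
  by apply/funext => x; rewrite /f /k; ring.
have fC : ip mu2 Q f f <= (C * `|r - s| `^ gamma) ^+ 2 := HC r s rt st.
have kD : ip mu2 Q k k <= (D * `|r - s| `^ gamma) ^+ 2 := HD r s rt st.
have := ip_ge0 mu2 Q (fun x => f x - k x).
have -> : ip mu2 Q (fun x => f x - k x) (fun x => f x - k x)
  = ip mu2 Q f f - 2 * ip mu2 Q f k + ip mu2 Q k k := ip_sqrB mQ sf sk.
have -> : ip mu2 Q (fun x => f x + k x) (fun x => f x + k x)
  = ip mu2 Q f f + 2 * ip mu2 Q f k + ip mu2 Q k k := ip_sqrD mQ sf sk.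
move: fC kD; set y := `|r - s| `^ gamma.
move: (ip mu2 Q f f) (ip mu2 Q f k) (ip mu2 Q k k) => a b c aC cD abc.
have -> : (2 * (C + D) * y) ^+ 2
    = 2 * ((C * y) ^+ 2 + (D * y) ^+ 2) + 2 * (C ^+ 2 + D ^+ 2 + 4 * (C * D)) * y ^+ 2.
  by ring.
have : 0 <= 2 * (C ^+ 2 + D ^+ 2 + 4 * (C * D)) * y ^+ 2.
  apply: mulr_ge0 (sqr_ge0 y); apply: mulr_ge0 => //.
  apply: addr_ge0; first by apply: addr_ge0; exact: sqr_ge0.
  by apply: mulr_ge0 => //; exact: mulr_ge0.
by lra.
Qed.

Lemma hoelder_L2_mul gamma t g p : hoelder_L2 gamma t g -> continuous p ->
  hoelder_L2 gamma t (fun s x => g s x * p x).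
Proof.
move=> [sg [C C0 HC]] cp; have [K K0 HK] := continuous_torus_bounded cp.
have [mp _] := continuous_sqi cp.
(* multiplication by p is bounded by K *)
have dom f : sqi mu2 Q f -> sqi mu2 Q (fun x => f x * p x) /\
    ip mu2 Q (fun x => f x * p x) (fun x => f x * p x) <= K ^+ 2 * ip mu2 Q f f.
  move=> [mf if2].
  have le x : Q x -> (f x * p x) ^+ 2 <= K ^+ 2 * f x ^+ 2.
    move=> Qx; rewrite exprMn mulrC ler_wpM2r ?sqr_ge0//.
    by rewrite -(real_normK (num_real (p x))) ler_sqr ?nnegrE// HK.
  have s1 : sqi mu2 Q (fun x => f x * p x).
    split; first exact: measurable_funM.
    apply: (rI_le mQ _ _ (rI_Z mQ (K ^+ 2) if2)).
      by apply: measurable_funX; exact: measurable_funM.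
    by move=> x Qx; rewrite ger0_norm ?sqr_ge0 ?le.
  split=> //.
  have i2 := sqi_mul mQ (conj mf if2) (conj mf if2).
  apply: (@le_trans _ _ (\int[mu2]_(x in Q) (K ^+ 2 * (f x * f x)))).
    apply: le_Rintegral => [|| |x Qx].
    - exact: mQ.
    - exact: (sqi_mul mQ s1 s1).
    - exact: (rI_Z mQ (K ^+ 2) i2).
    - by rewrite -!expr2 le.
  by rewrite RintegralZl.
split=> [s st|]; first by have [] := dom _ (sg s st).
exists (K * C) => [|r s rt st]; first by rewrite mulr_ge0.
have -> : (fun x => g r x * p x - g s x * p x) = (fun x => (g r x - g s x) * p x).
  by apply/funext => x; rewrite mulrBl.
have [_ le] := dom _ (sqiB mQ (sg r rt) (sg s st)).
by apply: le_trans le _; rewrite -mulrA [leRHS]exprMn ler_wpM2l ?sqr_ge0// HC.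
Qed.

Lemma hoelder_L2_bounded gamma t g : 0 < gamma -> hoelder_L2 gamma t g ->
  exists2 B : R, 0 <= B & forall s, 0 <= s <= t -> ip mu2 Q (g s) (g s) <= B ^+ 2.
Proof.
move=> g0 [sg [C C0 HC]].
have [t0|t0] := ltP t 0.
  by exists 0 => // s /andP[s0 /le_lt_trans/(_ t0)]; rewrite ltNge s0.
have z0 : (0 : R) <= 0 <= t by apply/andP.
set A := C * t `^ gamma; have A0 : 0 <= A by rewrite mulr_ge0 ?powR_ge0.
exists (A + Num.sqrt (ip mu2 Q (g 0) (g 0))) => [|s st].
  by rewrite addr_ge0 ?sqrtr_ge0.
have s1 := sqiB mQ (sg s st) (sg 0 z0).
have -> : g s = (fun x => (g s x - g 0 x) + g 0 x).
  by apply/funext => x; rewrite subrK.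
have := ip_sqrtD mQ s1 (sg 0 z0); set G := (fun x => _ - _ + _).
move=> h; rewrite -(sqr_sqrtr (ip_ge0 mu2 Q G)) ler_sqr ?nnegrE ?sqrtr_ge0//.
  apply: le_trans h _; rewrite lerD2r -(ger0_norm A0) -sqrtr_sqr ler_sqrt ?sqr_ge0//.
  apply: le_trans (HC s 0 st z0) _; rewrite ler_sqr ?nnegrE ?mulr_ge0 ?powR_ge0//.
  rewrite ler_wpM2l// subr0; have /andP[s0 sle] := st.
  by rewrite ger0_norm//; apply: ge0_ler_powR; rewrite ?nnegrE// ltW.
by rewrite addr_ge0 ?sqrtr_ge0.
Qed.

Lemma hoelder_L2_ip gamma t g h : 0 < gamma ->
  hoelder_L2 gamma t g -> hoelder_L2 gamma t h ->
  exists2 C : R, 0 <= C & forall r s, 0 <= r <= t -> 0 <= s <= t ->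
    `|ip mu2 Q (g r) (h r) - ip mu2 Q (g s) (h s)| <= C * `|r - s| `^ gamma.
Proof.
move=> g0 hg hh.
have [B B0 HB] := hoelder_L2_bounded g0 hg.
have [B' B'0 HB'] := hoelder_L2_bounded g0 hh.
have [sg [C C0 HC]] := hg; have [sh [D D0 HD]] := hh.
exists (C * B' + B * D) => [|r s rt st]; first by rewrite addr_ge0 ?mulr_ge0.
have -> : ip mu2 Q (g r) (h r) - ip mu2 Q (g s) (h s)
    = ip mu2 Q (fun x => g r x - g s x) (h r)
      + ip mu2 Q (g s) (fun x => h r x - h s x).
  rewrite (ipBl mQ) ?(ipBr mQ); try by [exact: sg|exact: sh].
  by ring.
set y := `|r - s| `^ gamma.
have y0 : 0 <= y by exact: powR_ge0.
apply: le_trans (ler_normD _ _) _; rewrite mulrDl; apply: lerD.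
  rewrite mulrAC; apply: ip_le; rewrite ?mulr_ge0//.
  - by apply: (sqiB mQ); exact: sg.
  - exact: sh.
  - exact: HC.
  - exact: HB'.
rewrite -mulrA; apply: ip_le; rewrite ?mulr_ge0//.
- exact: sg.
- by apply: (sqiB mQ); exact: sh.
- exact: HB.
- exact: HD.
Qed.

End hoelder_continuity.

(** * The paths of vorticity and velocity *)

Section vorticity_paths.
Context {R : realType}.
Notation mu2 := (@lebesgue2 R).
Notation Q := (@torus_domain R).
Implicit Types (f g : R * R -> R) (v : R * R -> R * R).
Implicit Types (w : R -> R * R -> R) (u : R -> R * R -> R * R) (gamma beta t : R).
Let mQ := @measurable_torus_domain R.

Lemma L2B f g : L2 f -> L2 g -> L2 (fun x => f x - g x).
Proof.
move=> Lf Lg; have [m i] := sqiB mQ (L2_sqi Lf) (L2_sqi Lg).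
have [pf _ _] := Lf; have [pg _ _] := Lg.
by split => // x; have [-> ->] := pf x; have [-> ->] := pg x.
Qed.

Lemma innerB f f' g : L2 f -> L2 f' -> continuous g ->
  inner (fun x => f x - f' x) g = inner f g - inner f' g.
Proof.
move=> /L2_sqi sf /L2_sqi sf' cg.
exact: (ipBl mQ sf sf' (continuous_sqi cg)).
Qed.

Lemma biot_savartB f f' v v' : L2 f -> L2 f' ->
  biot_savart f v -> biot_savart f' v' ->
  biot_savart (fun x => f x - f' x) (fun x => v x - v' x).
Proof.
move=> Lf Lf' [L1 L2' [m1 m2] dv cw] [L1' L2'' [m1' m2'] dv' cw'].
have c1 : continuous (cst 1 : R * R -> R) by move=> x; exact: cvg_cst.
have E1 g : continuous g -> inner (fst \o (fun x => v x - v' x)) g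
    = inner (fst \o v) g - inner (fst \o v') g.
  by move=> cg; exact: (innerB L1 L1' cg).
have E2 g : continuous g -> inner (snd \o (fun x => v x - v' x)) g
    = inner (snd \o v) g - inner (snd \o v') g.
  by move=> cg; exact: (innerB L2' L2'' cg).
split.
- exact: (L2B L1 L1').
- exact: (L2B L2' L2'').
- by rewrite E1// E2// m1 m2 m1' m2' subrr.
- move=> psi spsi; have [_ p1 p2 _] := torus_smooth_continuous spsi.
  by rewrite E1// E2// addrACA -opprD dv// dv'// subrr.
- move=> psi spsi; have [p0 p1 p2 _] := torus_smooth_continuous spsi.
  rewrite (E1 _ p2) (E2 _ p1) (innerB Lf Lf' p0) -(cw _ spsi) -(cw' _ spsi).
  have swap (a b c d : R) : a - b - (c - d) = a - c - (b - d) by ring.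
  exact: swap.
Qed.

(** The regularity of the vorticity in the Sobolev scale of order at least
    zero passes to the mean square norm, and from there to the velocity. *)
Lemma holder_path_L2 gamma beta t w u : 0 <= beta -> holder_path gamma beta t w ->
  (forall s, s \in `[0, t] -> biot_savart (w s) (u s)) ->
  [/\ hoelder_L2 gamma t w, hoelder_L2 gamma t (fun s => fst \o u s)
    & hoelder_L2 gamma t (fun s => snd \o u s)].
Proof.
move=> beta0 [Bw [C HC]] bs.
have inI s : 0 <= s <= t -> s \in `[0, t] by rewrite in_itv.
have Lw s : 0 <= s <= t -> L2 (w s) by move=> /inI/Bw[].
have fw r s : 0 <= r <= t -> 0 <= s <= t -> forall F : seq (int * int), uniq F ->
    \sum_(l <- F) fourier_sq (fun x => w r x - w s x) l
    <= (`|C| * `|r - s| `^ gamma) ^+ 2.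
  move=> rt st; apply: (Bnorm_fourier_le beta0).
    by rewrite mulr_ge0 ?powR_ge0.
  apply: le_trans (HC r s (inI _ rt) (inI _ st)) _.
  by rewrite lee_fin ler_wpM2r ?powR_ge0// ler_norm.
have fu r s : 0 <= r <= t -> 0 <= s <= t -> forall F : seq (int * int), uniq F ->
    \sum_(l <- F) (fourier_sq (fst \o (fun x => u r x - u s x)) l
                   + fourier_sq (snd \o (fun x => u r x - u s x)) l)
    <= (`|C| * `|r - s| `^ gamma) ^+ 2.
  move=> rt st F uF; apply: le_trans (fw r s rt st F uF).
  apply: ler_sum => l _; apply: biot_savart_fourier_le.
  by apply: biot_savartB; [exact: Lw|exact: Lw|exact/bs/inI|exact/bs/inI].
split; (split=> [s st|]; last exists `|C| => // r s rt st).
- exact/L2_sqi/Lw.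
- by apply: parseval_le (fw r s rt st); apply: (sqiB mQ); exact/L2_sqi/Lw.
- by have [/L2_sqi] := bs s (inI s st).
- have [/L2_sqi s1 _ _ _ _] := bs r (inI r rt).
  have [/L2_sqi s2 _ _ _ _] := bs s (inI s st).
  apply: parseval_le => [|F uF]; first exact: (sqiB mQ).
  apply: le_trans (fu r s rt st F uF); apply: ler_sum => l _.
  by rewrite lerDl fourier_sq_ge0.
- by have [_ /L2_sqi] := bs s (inI s st).
- have [_ /L2_sqi s1 _ _ _] := bs r (inI r rt).
  have [_ /L2_sqi s2 _ _ _] := bs s (inI s st).
  apply: parseval_le => [|F uF]; first exact: (sqiB mQ).
  apply: le_trans (fu r s rt st F uF); apply: ler_sum => l _.
  by rewrite lerDr fourier_sq_ge0.
Qed.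

Lemma smooth_field_advect_continuous v f : smooth_field v -> torus_smooth f ->
  continuous (advect v f).
Proof.
move=> [s1 s2] sf; have [_ c1 c2 _] := torus_smooth_continuous sf.
have [v1 _ _ _] := torus_smooth_continuous s1.
have [v2 _ _ _] := torus_smooth_continuous s2.
by move=> x; apply: cvgD; apply: cvgM; [exact: v1|exact: c1|exact: v2|exact: c2].
Qed.

Lemma noise_coefficient_hoelder gamma t w f : 0 < gamma -> hoelder_L2 gamma t w ->
  continuous f ->
  exists C : R, forall r s, 0 <= r <= t -> 0 <= s <= t ->
    `|inner (w r) f - inner (w s) f| <= C * `|r - s| `^ gamma.
Proof.
move=> g0 hw cf.
by have [C _ HC] := hoelder_L2_ip g0 hw (hoelder_L2_cst gamma t cf); exists C.
Qed.

(** The drift is a continuous, hence bounded, function of time. *)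
Lemma drift_lipschitz gamma t w u f : 0 < gamma -> hoelder_L2 gamma t w ->
  hoelder_L2 gamma t (fun s => fst \o u s) ->
  hoelder_L2 gamma t (fun s => snd \o u s) -> torus_smooth f ->
  exists M : R, forall r s, 0 <= r <= t -> 0 <= s <= t ->
    `| \int[lebesgue_measure]_(q in `[0, r])
         inner (w q) (advect (u q) f \+ laplacian f)
     - \int[lebesgue_measure]_(q in `[0, s])
         inner (w q) (advect (u q) f \+ laplacian f)| <= M * `|r - s|.
Proof.
move=> g0 hw h1 h2 sf; have [_ c1 c2 cl] := torus_smooth_continuous sf.
have hk := hoelder_L2_add (hoelder_L2_add (hoelder_L2_mul h1 c1)
  (hoelder_L2_mul h2 c2)) (hoelder_L2_cst gamma t cl).
have [C C0 HC] := hoelder_L2_ip g0 hw hk.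
set b := fun q => inner (w q) (advect (u q) f \+ laplacian f).
have {}HC r s : 0 <= r <= t -> 0 <= s <= t -> `|b r - b s| <= C * `|r - s| `^ gamma.
  by move=> rt st; exact: HC.
have cb : {within `[0, t], continuous b}.
  by apply: modulus_continuous_within; exact: (hoelder_modulus g0 HC).
pose M := C * t `^ gamma + `|b 0|.
have bM s : 0 <= s <= t -> `|b s - 0| <= M.
  move=> st; have /andP[s0 sle] := st; have t0 := le_trans s0 sle.
  have z0 : (0 : R) <= 0 <= t by apply/andP.
  rewrite subr0 -[X in `|X|](subrK (b 0)); apply: le_trans (ler_normD _ _) _.
  rewrite lerD2r; apply: le_trans (HC s 0 st z0) _; rewrite ler_wpM2l//.
  by rewrite subr0 ger0_norm//; apply: ge0_ler_powR; rewrite ?nnegrE// ltW.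
have lip r s : 0 <= r -> r <= s -> s <= t ->
    `|\int[lebesgue_measure]_(q in `[0, s]) b q
      - \int[lebesgue_measure]_(q in `[0, r]) b q| <= M * `|r - s|.
  move=> r0 rs st; rewrite (distrC r s) (ger0_norm (_ : 0 <= s - r)) ?subr_ge0//.
  have := integral_increment_le cb r0 rs st (c := 0) (e := M).
  rewrite mul0r subr0; apply => q /andP[rq qs]; apply: bM.
  by rewrite (le_trans r0 rq) (le_trans qs st).
exists M => r s /andP[r0 rt] /andP[s0 st].
have [rs|/ltW sr] := leP r s; last by rewrite (distrC r); exact: lip.
by rewrite distrC; exact: lip.
Qed.

End vorticity_paths.

(** * Convergence of the estimator *)

Theorem proposition20 (R : realType) (d : measure_display)
    (Omega : measurableType d) (P : probability Omega R)
    (h gamma alpha : R) (h_gt : 2^-1 < h) (h_lt : h < 1)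
    (gamma_gt : 2^-1 < gamma) (gamma_lt : gamma < h) (alpha_gt : 1 < alpha)
    (W : R -> {RV P >-> R}) (W_fbm : fractional_brownian_motion h W)
    (xi : R * R -> R * R) (xi_smooth : smooth_field xi)
    (xi_div : divergence_free xi)
    (t : R) (t_gt0 : 0 < t)
    (omega : R -> Omega -> R * R -> R)
    (omega_paths : {ae P, forall x,
       continuous_path alpha t (omega^~ x) /\
       holder_path gamma (alpha - gamma) t (omega^~ x)})
    (omega_sol : {ae P, forall x,
       weak_solution xi t (fun s => W s x) (omega^~ x)})
    (phi : R * R -> R) (phi_smooth : torus_smooth phi)
    (phi_nondeg : {ae P, forall x,
       0 < \int[lebesgue_measure]_(s in `[0, t])
             (inner (omega s x) (advect xi phi)) ^+ 2}) :
  let Q k x := dyadic_qv t (fun s => inner (omega s x) phi) k in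
  {ae P, forall x,
     (\forall k \near \oo, 0 < Q k x) /\
     hurst_estimator (Q^~ x) @ \oo --> h}.
Proof.
have h_gt0 : 0 < h by rewrite (lt_trans _ h_gt)// invr_gt0.
have gamma_gt0 : 0 < gamma by rewrite (lt_trans _ gamma_gt)// invr_gt0.
have beta_ge0 : 0 <= alpha - gamma by lra.
have gh : 1 < gamma + h by lra.
move=> Q0.
have qvW := fbm_qv_ae h_gt h_lt W_fbm.
apply: filterS3 (filterI omega_paths omega_sol) phi_nondeg qvW.
move=> x [[_ hp] [u bs eqn]] nondeg qv.
have [hw hu1 hu2] := holder_path_L2 beta_ge0 hp bs.
apply: (hurst_estimator_cvg nondeg).
pose D r := \int[lebesgue_measure]_(s in `[0, r])
  inner (omega s x) (advect (u s) phi \+ laplacian phi).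
apply: (@dyadic_qv_cvg R h gamma t (fun s => W s x) _ D _ h_lt gamma_gt0 gh t_gt0).
- exact: qv.
- apply: noise_coefficient_hoelder gamma_gt0 hw _.
  exact: smooth_field_advect_continuous.
- exact: drift_lipschitz gamma_gt0 hw hu1 hu2 phi_smooth.
- by move=> r rt; apply: eqn; rewrite // in_itv.
Qed.
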